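(* Let $F$ be a nonarchimedean local field, $D$ a central division algebra over $F$ of dimension $d^2$, $G=\mathrm{GL}_r(D)$, $n=rd$, $G^*=\mathrm{GL}_n(F)$. For every finite-dimensional algebraic representation $V$ of ${}^LG={}^LG^*$ one has $\mathfrak{T}(Z_V^* )=Z_V$ in the Bernstein center $\mathfrak{Z}(G)$.
   Context: All representations of $G,G^*$ are complex and smooth. ${}^LG=\mathrm{GL}_n(\mathbb{C})\rtimes W_F={}^LG^*$ (direct product); a finite-dimensional algebraic representation of it is a continuous one whose restriction to $\mathrm{GL}_n(\mathbb{C})$ is algebraic. $I_F\subset W_F$ is the inertia group and $\Phi\in W_F$ a geometric Frobenius. Bernstein center: $\mathfrak{X}_G$ is the Bernstein variety, whose points are $G$-conjugacy classes $(M,\sigma)_G$ of pairs of a Levi subgroup $M$ and an irreducible supercuspidal representation $\sigma$ of $M$; $\mathfrak{Z}(G)=\mathbb{C}[\mathfrak{X}_G]$. Similarly for $G^*$. Langlands parameters: $\mathrm{rec}^*$ is the local Langlands correspondence for $\mathrm{GL}_n(F)$; $JL:\Pi^2(\mathrm{GL}_m(D))\to\Pi^2(\mathrm{GL}_{md}(F))$ is the Jacquet–Langlands bijection between essentially square-integrable irreducible representations. If $\pi\in\Pi(G)$ is the Langlands quotient (unique irreducible quotient) of the standard representation $\sigma_1\times\cdots\times\sigma_k$, $\sigma_i=|\mathrm{Nrd}|^{e_i}\sigma_i^u\in\Pi^2(\mathrm{GL}_{r_i}(D))$ with $\sigma_i^u$ square-integrable and $e_1\ge\cdots\ge e_k$,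 its parameter is $\varphi_\pi=\bigoplus_i\mathrm{rec}^*(JL(\sigma_i))$. The restriction $\varphi_\pi|_{W_F}$ depends only on the supercuspidal support of $\pi$. $Z_V\in\mathfrak{Z}(G)$ is the regular function $(M,\sigma)_G\mapsto\mathrm{tr}(\varphi_\pi(\Phi)\,|\,V^{I_F})$, where $\pi$ is any irreducible representation of $G$ with supercuspidal support $(M,\sigma)_G$ and $V^{I_F}$ is the space of invariants of $V$ under $\varphi_\pi(I_F)$. $Z_V^*\in\mathfrak{Z}(G^* )$ is defined the same way for $G^*$. The homomorphism $\mathfrak{T}:\mathfrak{Z}(G^* )\to\mathfrak{Z}(G)$ is pullback of functions along the morphism $\mathfrak{X}_G\to\mathfrak{X}_{G^*}$ sending $(M,\sigma)_G$ to the supercuspidal support $(M^*_\sigma,\rho_\sigma)_{G^*}$ of $JL(\sigma)$; here, for $M\cong\prod_i\mathrm{GL}_{r_i}(D)$, $JL(\otimes\sigma_i)=\otimes JL(\sigma_i)$ is a representation of $M^*\cong\prod_i\mathrm{GL}_{r_id}(F)\subset G^*$. *)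

(* Defs.v *)
From HB Require Import structures.
From mathcomp Require Import all_boot all_order all_algebra all_field.
From mathcomp Require Import complex.
From mathcomp Require Import boolp classical_sets functions reals exp.
From mathcomp Require mpoly.

Set Implicit Arguments.
Unset Strict Implicit.
Unset Printing Implicit Defensive.
Import Order.TTheory GRing.Theory Num.Theory.
Local Open Scope ring_scope.

(******************************************************************************)
(* Nonarchimedean local fields and central division algebras                  *)
(******************************************************************************)

Definition val_ge (F : fieldType) (v : F -> int) (N : int) (x : F) : bool :=
  (x == 0) || (N <= v x).

(* A nonarchimedean local field, given with its normalized discrete valuation
   (whose value at 0 is irrelevant): complete, with a residue field of finite
   cardinality [lf_q]; [s] is a system of representatives of the residue
   field. *)
Record localField := LocalField {
  lf_car :> fieldType;
  lf_val : lf_car -> int;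
  lf_q : nat;
  lf_valM : forall x y, x != 0 -> y != 0 -> lf_val (x * y) = lf_val x + lf_val y;
  lf_valD : forall N x y,
    val_ge lf_val N x -> val_ge lf_val N y -> val_ge lf_val N (x + y);
  lf_unif : exists x, x != 0 /\ lf_val x = 1;
  lf_complete : forall u : nat -> lf_car,
    (forall N, exists n0, forall i j, (n0 <= i)%N -> (n0 <= j)%N ->
       val_ge lf_val N (u i - u j)) ->
    exists l, forall N, exists n0, forall i, (n0 <= i)%N ->
       val_ge lf_val N (u i - l);
  lf_residue : exists s : 'I_lf_q -> lf_car,
    (forall i, val_ge lf_val 0 (s i)) /\
    (forall x, val_ge lf_val 0 x -> exists! i, val_ge lf_val 1 (x - s i)) }.

Definition vge (F : localField) := val_ge (@lf_val F).

(* The normalized absolute value of F. *)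
Definition labs (R : realType) (F : localField) (x : F) : R :=
  if x == 0 then 0 else (lf_q F)%:R ^ (- lf_val x).

Record divAlg (F : localField) := DivAlg {
  da_car :> falgType F;
  da_deg : nat;
  da_div : forall x : da_car, x != 0 -> x \is a GRing.unit;
  da_central : forall x : da_car, (forall y, x * y = y * x) -> exists a : F, x = a%:A;
  da_dim : \dim {:da_car} = (da_deg ^ 2)%N }.

Lemma base_div (F : localField) (x : F^o) : x != 0 -> x \is a GRing.unit.
Proof. by move=> x0; rewrite unitfE. Qed.

Lemma base_central (F : localField) (x : F^o) :
  (forall y, x * y = y * x) -> exists a : F, x = a%:A.
Proof. by move=> _; exists x; rewrite /GRing.scale /= mulr1. Qed.

Lemma base_dim (F : localField) : \dim {:F^o} = (1 ^ 2)%N.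
Proof. by rewrite dimvf /dim. Qed.

(* F itself, so that GL_n(F) and GL_r(D) are treated uniformly. *)
Definition baseAlg (F : localField) : divAlg F :=
  DivAlg (@base_div F) (@base_central F) (base_dim F).

Section LinearGroup.
Context {R : realType} {F : localField} {A : divAlg F}.

(* Left multiplication by a on A, in an F-basis of A. *)
Definition regmx (a : A) : 'M[F]_(\dim {:A}) :=
  \matrix_(i, j) coord (vbasis {:A}) i (a * (vbasis {:A})`_j).

(* The action of g on column vectors A^m, as a matrix over F; its determinant
   is Nrd(g)^d and its characteristic polynomial is the d-th power of the
   reduced characteristic polynomial of g. *)
Definition bigmx (m : nat) (g : 'M[A]_m) : 'M[F]_(\sum_(p < m) \dim {:A}) :=
  \mxblock_(p < m, q < m) regmx (g p q).

Definition absdet m (g : 'M[A]_m) : R := labs R (\det (bigmx g)).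

Definition absNrd m (g : 'M[A]_m) : R := powR (absdet g) (da_deg A)%:R^-1.

Definition valNrd m (g : 'M[A]_m) : int :=
  (lf_val (\det (bigmx g)) %/ (da_deg A)%:Z)%Z.

Definition inverse_mx m (g h : 'M[A]_m) := g *m h = 1%:M /\ h *m g = 1%:M.

Definition GL m (g : 'M[A]_m) := exists h, inverse_mx g h.

(* The congruence neighbourhoods of 1 in GL_m(A); these are compact open
   subgroups, forming a basis of neighbourhoods of 1, for N large. *)
Definition congr_nbhd m (N : int) (g : 'M[A]_m) :=
  GL g /\ forall p q i, vge N (coord (vbasis {:A}) i ((g - 1%:M) p q)).

(* Levi and parabolic subgroups: a colouring c of the standard basis and an
   element x (with inverse xi) give the Levi subgroup x L_c xi, where L_c is
   the group of c-block-diagonal matrices; a second colouring c' gives the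
   unipotent radical of the parabolic subgroup of x L_c xi of
   c'-block-upper-triangular matrices, whose Levi subgroup is x L_c' xi when
   c' refines c. *)
Definition levi m (c : 'I_m -> 'I_m) (x xi : 'M[A]_m) (h : 'M[A]_m) :=
  GL h /\ forall p q, c p != c q -> (xi *m h *m x) p q = 0.

Definition unip m (c c' : 'I_m -> 'I_m) (x xi : 'M[A]_m) (h : 'M[A]_m) :=
  forall p q, ~~ ((c p == c q) && (c' p < c' q)%N) ->
    (xi *m h *m x) p q = (p == q)%:R.

Definition refines m (c' c : 'I_m -> 'I_m) :=
  forall p q, c' p = c' q -> c p = c q.

Definition is_levi m (M : 'M[A]_m -> Prop) :=
  exists c x xi, inverse_mx x xi /\ forall h, M h <-> levi c x xi h.

(* The colour-a block of a c-block-diagonal matrix, extended by the identity. *)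
Definition colour_part m (c : 'I_m -> 'I_m) (a : 'I_m) (y : 'M[A]_m) : 'M[A]_m :=
  \matrix_(p, q) if (c p == a) && (c q == a) then y p q else (p == q)%:R.

(* delta_P^(1/2), delta_P(y) = |det_F (Ad y | Lie N)|, at a c'-block-diagonal y;
   on the (a,b)-block, a < b, of Lie N, y acts by X |-> y_a X y_b^-1. *)
Definition sqrt_modulus m (c c' : 'I_m -> 'I_m) (y : 'M[A]_m) : R :=
  let below a := #|[pred q | [exists p, (c' p == a) && (c p == c q)] & (a < c' q)%N]| in
  let above a := #|[pred q | [exists p, (c' p == a) && (c p == c q)] & (c' q < a)%N]| in
  \prod_(a < m)
    powR (absdet (colour_part c' a y)) (((below a)%:R - (above a)%:R) / 2%:R).

End LinearGroup.

(* idx identifies the disjoint union of the 'I_(m i) with 'I_r. *)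
Definition blocks k (m : 'I_k -> nat) r (idx : forall i, 'I_(m i) -> 'I_r) :=
  bijective (fun u : {i : 'I_k & 'I_(m i)} => idx (tag u) (tagged u)).

(* The block-diagonal matrix with diagonal blocks h i, placed according to idx. *)
Definition bdiag (T : nzRingType) k (m : 'I_k -> nat) r
    (idx : forall i, 'I_(m i) -> 'I_r) (h : forall i, 'M[T]_(m i)) : 'M[T]_r :=
  \matrix_(p, q) \sum_i \sum_(a | idx i a == p) \sum_(b | idx i b == q) h i a b.

(******************************************************************************)
(* Smooth representations                                                     *)
(******************************************************************************)

Section Subspaces.
Context {R : realType}.
Implicit Types U V : lmodType R[i].

Definition subspace U (W : U -> Prop) :=
  W 0 /\ forall (a : R[i]) u v, W u -> W v -> W (a *: u + v).

Definition linear_on U V (W : U -> Prop) (f : U -> V) :=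
  forall (a : R[i]) u v, W u -> W v -> f (a *: u + v) = a *: f u + f v.

Definition spanned U (S : U -> Prop) (v : U) :=
  forall W, subspace W -> (forall s, S s -> W s) -> W v.

Definition basis_on U (W : U -> Prop) n (b : 'I_n -> U) :=
  [/\ forall i, W (b i),
      forall v, W v -> exists a : 'I_n -> R[i], v = \sum_i a i *: b i
    & forall a : 'I_n -> R[i], \sum_i a i *: b i = 0 -> forall i, a i = 0].

Definition multilinear_on k (U : 'I_k -> lmodType R[i]) V
    (W : forall i, U i -> Prop) (t : (forall i, U i) -> V) :=
  forall u, (forall i, W i (u i)) -> forall i (a : R[i]) (y z : U i),
    W i y -> W i z ->
    t (dfwith u (a *: y + z)) = a *: t (dfwith u y) + t (dfwith u z).

End Subspaces.

Section Representations.
Context {R : realType} {F : localField} {A : divAlg F}.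
Local Notation C := R[i].

(* Underlying data of a representation, on a subspace pcar of psp, of a
   subgroup H of GL_m(A). The value of pact outside H or outside pcar is
   irrelevant; the axioms are in smooth_rep. *)
Record prerep m := Prerep {
  psp : lmodType C;
  pcar : psp -> Prop;
  pact : 'M[A]_m -> psp -> psp }.

Definition smooth_rep m (H : 'M[A]_m -> Prop) (p : prerep m) :=
  [/\ subspace (@pcar m p),
      forall h, H h -> linear_on (@pcar m p) (pact h) /\
                       (forall u : psp p, pcar u -> pcar (pact h u)),
      forall u : psp p, pcar u -> pact 1%:M u = u,
      forall h h' (u : psp p), H h -> H h' -> pcar u ->
        pact (h *m h') u = pact h (pact h' u)
    & forall u : psp p, pcar u ->
        exists N, forall h, H h -> congr_nbhd N h -> pact h u = u].

Definition subrep m (H : 'M[A]_m -> Prop) (p : prerep m) (W : psp p -> Prop) :=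
  [/\ subspace W, forall u, W u -> pcar u
    & forall h u, H h -> W u -> W (pact h u)].

Definition irrep m (H : 'M[A]_m -> Prop) (p : prerep m) :=
  [/\ smooth_rep H p, exists2 u : psp p, pcar u & u <> 0
    & forall W : psp p -> Prop, subrep H W ->
        (forall u, W u -> u = 0) \/ (forall u, pcar u -> W u)].

(* p' is the image of the subrepresentation W of p under a morphism. *)
Definition image_of m (H : 'M[A]_m -> Prop) (p p' : prerep m) (W : psp p -> Prop) :=
  exists f : psp p -> psp p',
    [/\ linear_on W f, forall u, W u -> pcar (f u),
        forall u', pcar u' -> exists2 u, W u & f u = u'
      & forall h u, H h -> W u -> f (pact h u) = pact h (f u)].

Definition subquotient m (H : 'M[A]_m -> Prop) (p p' : prerep m) :=
  exists2 W : psp p -> Prop, subrep H W & image_of H p' W.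

Definition quotient_rep m (H : 'M[A]_m -> Prop) (p p' : prerep m) :=
  image_of H p' (@pcar m p).

Definition equiv m (H : 'M[A]_m -> Prop) (p p' : prerep m) :=
  exists f : psp p -> psp p',
    [/\ linear_on (@pcar m p) f, forall u, pcar u -> pcar (f u),
        forall u', pcar u' -> exists2 u, pcar u & f u = u',
        forall u, pcar u -> f u = 0 -> u = 0
      & forall h u, H h -> pcar u -> f (pact h u) = pact h (f u)].

Definition twist m (chi : 'M[A]_m -> C) (p : prerep m) : prerep m :=
  Prerep (@pcar m p) (fun h u => chi h *: pact h u).

Definition conj_rep m (g gi : 'M[A]_m) (p : prerep m) : prerep m :=
  Prerep (@pcar m p) (fun h u => pact (g *m h *m gi) u).

(* The span of the vectors k u - u, k in K. *)
Definition coinv_kernel m (K : 'M[A]_m -> Prop) (p : prerep m) : psp p -> Prop :=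
  spanned (fun w => exists k u, [/\ K k, pcar u & w = pact k u - u]).

(* Irreducible with vanishing Jacquet modules along all proper parabolic
   subgroups of the Levi subgroup M. *)
Definition supercuspidal m (M : 'M[A]_m -> Prop) (s : prerep m) :=
  irrep M s /\
  forall c x xi, inverse_mx x xi -> (forall h, M h <-> levi c x xi h) ->
  forall c' : 'I_m -> 'I_m, (exists p q, c p = c q /\ (c' p < c' q)%N) ->
  forall u : psp s, pcar u -> coinv_kernel (unip c c' x xi) u.

(* Normalized parabolic induction to the Levi subgroup L = x L_c xi from its
   parabolic subgroup with Levi subgroup x L_c' xi, where c' refines c:
   functions f : L -> s (extended by 0) with
   f(n m g) = delta^(1/2)(m) s(m) f(g), invariant on the right under an open
   subgroup; L acts by right translation. *)
Definition parind m (c c' : 'I_m -> 'I_m) (x xi : 'M[A]_m) (s : prerep m) : prerep m :=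
  @Prerep m ('M[A]_m -> psp s)
    (fun f =>
      [/\ forall g, ~ levi c x xi g -> f g = 0,
          forall g, pcar (f g),
          forall n l g, unip c c' x xi n -> levi c' x xi l -> levi c x xi g ->
            f (n *m l *m g) =
            (sqrt_modulus c c' (xi *m l *m x) : R)%:C%C *: pact l (f g)
        & exists N, forall k g, levi c x xi k -> congr_nbhd N k ->
            levi c x xi g -> f (g *m k) = f g])
    (fun h f g => f (g *m h)).

(* The Levi subgroup M is identified by (idx, x) with the product of the
   GL_(m i)(A), and s with the external tensor product of the s_ i: t is a
   universal multilinear map, equivariant for M. *)
Definition factorized r (M : 'M[A]_r -> Prop) (s : prerep r)
    k (m : 'I_k -> nat) (idx : forall i, 'I_(m i) -> 'I_r) (x xi : 'M[A]_r)
    (s_ : forall i, prerep (m i)) :=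
  [/\ smooth_rep M s, blocks idx, inverse_mx x xi,
      forall h, M h <-> exists2 h_ : (forall i, 'M[A]_(m i)),
        (forall i, GL (h_ i)) & h = x *m bdiag idx h_ *m xi
    & exists t : (forall i, psp (s_ i)) -> psp s,
      [/\ forall u, (forall i, pcar (u i)) -> pcar (t u),
          multilinear_on (fun i => @pcar _ (s_ i)) t,
          forall h_ u, (forall i, GL (h_ i)) -> (forall i, pcar (u i)) ->
            t (fun i => pact (h_ i) (u i)) = pact (x *m bdiag idx h_ *m xi) (t u)
        & forall (V : lmodType C) (b : (forall i, psp (s_ i)) -> V),
            multilinear_on (fun i => @pcar _ (s_ i)) b ->
            (exists2 g : psp s -> V, linear_on (@pcar r s) g
               & forall u, (forall i, pcar (u i)) -> g (t u) = b u) /\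
            (forall g g' : psp s -> V,
               linear_on (@pcar r s) g -> linear_on (@pcar r s) g' ->
               (forall u, (forall i, pcar (u i)) -> g (t u) = g' (t u)) ->
               forall v, pcar v -> g v = g' v)]].

(* A pair (M, sigma): a point of the Bernstein variety, up to conj_pair. *)
Record cuspPair r := CuspPair {
  cp_levi : 'M[A]_r -> Prop;
  cp_rep : prerep r;
  cp_leviP : is_levi cp_levi;
  cp_repP : supercuspidal cp_levi cp_rep }.

Definition conj_pair r (y z : cuspPair r) :=
  exists g gi, [/\ inverse_mx g gi,
    forall h, cp_levi y h <-> cp_levi z (g *m h *m gi)
    & equiv (cp_levi y) (cp_rep y) (conj_rep g gi (cp_rep z))].

(* y represents the supercuspidal support of the representation p of the Levi
   subgroup L of GL_r(A), with L = GL_r(A) for constant c. *)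
Definition has_support r (L : 'M[A]_r -> Prop) (p : prerep r) (y : cuspPair r) :=
  exists c c' x xi,
    [/\ inverse_mx x xi, forall h, L h <-> levi c x xi h, refines c' c,
        forall h, cp_levi y h <-> levi c' x xi h
      & subquotient L (parind c c' x xi (cp_rep y)) p].

Definition smooth_functional m (p : prerep m) (l : psp p -> C) :=
  linear_on (V := C^o) (@pcar m p) l /\
  exists N, forall k u, congr_nbhd N k -> pcar u -> l (pact k u) = l u.

(* Square-integrable irreducible representations of GL_m(A): unitary central
   character, and matrix coefficients square-integrable modulo the centre F^*.
   As u is fixed by K_N, the integral of |l(p(g) u)|^2 over GL_m(A)/F^* is,
   up to a constant, the sum over GL_m(A)/(F^* K_N). *)
Definition square_integrable m (p : prerep m) :=
  [/\ irrep (@GL F A m) p,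
      exists2 w : F -> C, forall a, a != 0 -> `|w a| = 1
        & forall a (u : psp p), a != 0 -> pcar u -> pact ((a%:A)%:M) u = w a *: u
    & forall (l : psp p -> C) (u : psp p), smooth_functional l -> pcar u ->
      exists N0, forall N, N0 <= N -> exists B : R,
      forall n (g : 'I_n -> 'M[A]_m),
        (forall i, GL (g i)) ->
        (forall i j, i != j -> forall a k, a != 0 -> congr_nbhd N k ->
           g j <> a%:A *: (g i *m k)) ->
        \sum_i `|l (pact (g i) u)| ^+ 2 <= B%:C%C].

(* p = |Nrd|^e p^u with p^u square-integrable. *)
Definition ess_square_integrable_exp m (e : R) (p : prerep m) :=
  irrep (@GL F A m) p /\
  square_integrable (twist (fun g => (powR (absNrd g) (- e))%:C%C) p).

Definition ess_square_integrable m (p : prerep m) :=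
  exists e, ess_square_integrable_exp e p.

(* The value at g of the Harish-Chandra character, for g regular semisimple:
   the trace of p(1_{g K}) / vol(K) for K = K_N small, i.e. of e_K p(g) on the
   K-fixed vectors. Here e_K is the projection onto the K-fixed vectors along
   the span of the k u - u, k in K. *)
Definition character_value m (p : prerep m) (g : 'M[A]_m) (t : C) :=
  exists N0, forall N, N0 <= N ->
  exists n (b : 'I_n -> psp p) (T : 'M[C]_n),
    [/\ basis_on (fun u => pcar u /\ forall k, congr_nbhd N k -> pact k u = u) b,
        forall j, coinv_kernel (congr_nbhd N) (pact g (b j) - \sum_i T i j *: b i)
      & t = \tr T].

(* The data of a standard representation s_1 x ... x s_k of GL_r(A). *)
Definition standard_data r k (m : 'I_k -> nat) (s : forall i, prerep (m i)) :=
  [/\ forall i, (0 < m i)%N, (\sum_i m i)%N = r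
    & exists e : 'I_k -> R,
        (forall i, ess_square_integrable_exp (e i) (s i)) /\
        (forall i j : 'I_k, (i <= j)%N -> e j <= e i)].

(* p is the unique irreducible quotient of s_1 x ... x s_k, which is induced
   from the standard block-upper-triangular parabolic subgroup. *)
Definition langlands_quotient r k (m : 'I_k -> nat) (s : forall i, prerep (m i))
    (p : prerep r) :=
  exists (idx : forall i, 'I_(m i) -> 'I_r) (c0 c : 'I_r -> 'I_r) (t : prerep r),
    let st := parind c0 c 1%:M 1%:M t in
    [/\ forall i a, val (idx i a) = (\sum_(j < k | (j < i)%N) m j + a)%N,
        (forall i a, val (c (idx i a)) = val i) /\ (forall p q, c0 p = c0 q),
        factorized (levi c 1%:M 1%:M) t idx 1%:M 1%:M s,
        irrep (@GL F A r) p /\ quotient_rep (@GL F A r) st p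
      & forall p', irrep (@GL F A r) p' -> quotient_rep (@GL F A r) st p' ->
          equiv (@GL F A r) p' p].

End Representations.
Arguments prerep R {F} A m.
Arguments cuspPair R {F} A r.

(* Langlands: standard representations of the groups GL_r(A) have a unique
   irreducible quotient. *)
Definition langlands_quotient_theorem (R : realType) (F : localField) (A : divAlg F) :=
  forall r k (m : 'I_k -> nat) (s : forall i, prerep R A (m i)),
    (0 < r)%N -> standard_data r s -> exists p : prerep R A r, langlands_quotient s p.

(******************************************************************************)
(* The Bernstein centre                                                       *)
(******************************************************************************)

Section BernsteinCentre.
Context {R : realType} {F : localField} {A : divAlg F}.
Local Notation C := R[i].

(* The unramified character of x L_c xi with parameters z a, one per colour. *)
Definition unram_char r (c : 'I_r -> 'I_r) (x xi : 'M[A]_r) (z : 'I_r -> C)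
    (h : 'M[A]_r) : C :=
  \prod_a z a ^ valNrd (colour_part c a (xi *m h *m x)).

(* Regularity on the Bernstein variety: along every orbit of twists of (M,
   sigma) by unramified characters of M, f is a Laurent polynomial in the
   parameters of the unramified character. *)
Definition regular_on_variety r (f : cuspPair R A r -> C) :=
  forall (y : cuspPair R A r) c x xi, inverse_mx x xi ->
    (forall h, cp_levi y h <-> levi c x xi h) ->
  exists n (P : mpoly.mpoly r C), forall (z : 'I_r -> C), (forall a, z a != 0) ->
  forall y' : cuspPair R A r, (forall h, cp_levi y' h <-> cp_levi y h) ->
    equiv (cp_levi y) (cp_rep y') (twist (unram_char c x xi z) (cp_rep y)) ->
    (\prod_a z a) ^+ n * f y' = mpoly.meval z P.

Record bernsteinCentre r := BernsteinCentre {
  bz_fun :> cuspPair R A r -> C;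
  bz_conj : forall y z, conj_pair y z -> bz_fun y = bz_fun z;
  bz_regular : regular_on_variety bz_fun }.

End BernsteinCentre.
Arguments bernsteinCentre R {F} A r.

(******************************************************************************)
(* The Weil group and Weil-Deligne representations                            *)
(******************************************************************************)

Record sepClosure (F : localField) := SepClosure {
  sc_car :> fieldType;
  sc_in : {rmorphism F -> sc_car};
  sc_sep : forall x, exists2 p : {poly F}, separable_poly p & root (map_poly sc_in p) x;
  sc_closed : forall p : {poly sc_car}, separable_poly p -> (1 < size p)%N ->
    exists x, root p x }.

Section Weil.
Context {R : realType} {F : localField} (Fs : sepClosure F).
Local Notation C := R[i].

Definition integral (x : Fs) :=
  exists p : {poly F}, [/\ p \is monic, forall i, vge 0 p`_i & root (map_poly (sc_in Fs) p) x].

(* The maximal ideal of the ring of integers of Fs. *)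
Definition in_max_ideal (x : Fs) := x = 0 \/ ~ integral x^-1.

(* w acts on the residue field as the (a - b)-th power of the geometric
   Frobenius, i.e. of the inverse of x |-> x^q. *)
Definition frob_power (w : Fs -> Fs) (a b : nat) :=
  forall x, integral x -> in_max_ideal (w x ^+ (lf_q F ^ a) - x ^+ (lf_q F ^ b)).

Definition galois_elt (w : Fs -> Fs) :=
  [/\ bijective w, forall x y, w (x + y) = w x + w y,
      forall x y, w (x * y) = w x * w y & forall a, w (sc_in Fs a) = sc_in Fs a].

Definition weil (w : Fs -> Fs) := galois_elt w /\ exists a b, frob_power w a b.
Definition inertia (w : Fs -> Fs) := galois_elt w /\ frob_power w 0 0.
Definition geometric_frobenius (w : Fs -> Fs) := galois_elt w /\ frob_power w 1 0.

(* Basic open subgroups of the Weil group. *)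
Definition inertia_fix (S : seq Fs) (w : Fs -> Fs) :=
  inertia w /\ forall x, x \in S -> w x = x.

Record wdrep n := WDRep {
  wd_r : (Fs -> Fs) -> 'M[C]_n;
  wd_N : 'M[C]_n }.

Definition wd_iso n (f f' : wdrep n) :=
  exists2 P : 'M[C]_n, P \in unitmx
    & (forall w, weil w -> P *m wd_r f w = wd_r f' w *m P) /\
      P *m wd_N f = wd_N f' *m P.

Definition frob_semisimple_wdrep n (f : wdrep n) :=
  [/\ wd_r f id = 1%:M,
      forall w w', weil w -> weil w' -> wd_r f (w \o w') = wd_r f w *m wd_r f w',
      exists S, forall w, inertia_fix S w -> wd_r f w = 1%:M,
      forall w a b, weil w -> frob_power w a b ->
        (lf_q F)%:R ^+ a *: (wd_r f w *m wd_N f) =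
        (lf_q F)%:R ^+ b *: (wd_N f *m wd_r f w)
    & forall w, geometric_frobenius w ->
        exists2 P, P \in unitmx & is_diag_mx (P *m wd_r f w *m invmx P)].

Definition irreducible_weil n (f : wdrep n) :=
  (0 < n)%N /\ forall U : 'M[C]_n,
    (forall w, weil w -> (U *m wd_r f w <= U)%MS) -> \rank U = 0%N \/ \rank U = n.

(* The inverse of the local reciprocity map, normalized so that geometric
   Frobenius elements correspond to uniformizers: for E = F(alpha) finite
   abelian over F, w is trivial on E iff art w is a norm from E (s lists the
   conjugates of alpha). *)
Definition reciprocity (art : (Fs -> Fs) -> F) :=
  [/\ forall w, weil w -> art w != 0,
      forall w w', weil w -> weil w' -> art (w \o w') = art w * art w',
      forall a, a != 0 -> exists2 w, weil w & art w = a,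
      forall w a b, weil w -> frob_power w a b -> lf_val (art w) = a%:Z - b%:Z
    & forall (p : {poly F}) (s : seq Fs) (alpha : Fs),
        irreducible_poly p -> uniq s ->
        map_poly (sc_in Fs) p = \prod_(b <- s) ('X - b%:P) -> alpha \in s ->
        (forall w, weil w -> exists g : {poly F}, w alpha = (map_poly (sc_in Fs) g).[alpha]) ->
        (forall w w', weil w -> weil w' -> w (w' alpha) = w' (w alpha)) ->
        forall w, weil w ->
          (w alpha = alpha <->
           exists g : {poly F},
             sc_in Fs (art w) = \prod_(b <- s) (map_poly (sc_in Fs) g).[b])].

(* A finite-dimensional algebraic representation of GL_n(C) x W_F: continuous,
   with algebraic restriction to GL_n(C). *)
Record algRep n := AlgRep {
  ar_dim : nat;
  ar :> 'M[C]_n -> (Fs -> Fs) -> 'M[C]_ar_dim;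
  ar_one : ar 1%:M id = 1%:M;
  ar_mul : forall g g' w w', g \in unitmx -> g' \in unitmx -> weil w -> weil w' ->
    ar (g *m g') (w \o w') = ar g w *m ar g' w';
  ar_alg : exists k (P : 'I_ar_dim -> 'I_ar_dim -> mpoly.mpoly (n * n) C),
    forall g, g \in unitmx -> forall i j,
      \det g ^+ k * ar g id i j = mpoly.meval (fun t => mxvec g 0 t) (P i j);
  ar_cont : forall g w (eps : R), g \in unitmx -> weil w -> 0 < eps ->
    exists (delta : R) (S : seq Fs), 0 < delta /\
    forall g' u, g' \in unitmx -> inertia_fix S u ->
      (forall i j, `|g' i j - g i j| < delta%:C%C) ->
      forall i j, `|ar g' (w \o u) i j - ar g w i j| < eps%:C%C }.

(* t is the trace of f(Phi) on the space of vectors invariant under all f(w),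
   w in the inertia group; the columns of B are a basis of that space. *)
Definition trace_on_inertia_invariants N (f : (Fs -> Fs) -> 'M[C]_N)
    (Phi : Fs -> Fs) (t : C) :=
  exists k (B : 'M[C]_(N, k)) (T : 'M[C]_k),
    [/\ \rank B = k,
        forall u : 'cV[C]_N,
          (forall w, inertia w -> f w *m u = u) <-> exists y, u = B *m y,
        f Phi *m B = B *m T & t = \tr T].

End Weil.
Arguments wdrep R {F} Fs n.
Arguments algRep R {F} Fs n.

(******************************************************************************)
(* The Langlands and Jacquet-Langlands correspondences                        *)
(******************************************************************************)

Section Correspondences.
Context {R : realType} {F : localField} (Fs : sepClosure F).
Local Notation C := R[i].

Definition quasi_character (chi : F -> C) :=
  [/\ chi 1 = 1, forall a b, a != 0 -> b != 0 -> chi (a * b) = chi a * chi b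
    & exists N, forall a, a != 0 -> vge N (a - 1) -> chi a = 1].

Definition contragredient m (p p' : prerep R (baseAlg F) m) :=
  exists B : psp p' -> psp p -> C,
    [/\ forall u', pcar u' -> smooth_functional (B u'),
        forall (a : C) u' v' u, pcar u' -> pcar v' -> pcar u ->
          B (a *: u' + v') u = a * B u' u + B v' u,
        forall u', pcar u' -> (forall u, pcar u -> B u' u = 0) -> u' = 0,
        forall l, smooth_functional l ->
          exists2 u', pcar u' & forall u, pcar u -> B u' u = l u
      & forall g u' u, @GL F (baseAlg F) m g -> pcar u' -> pcar u ->
          B (pact g u') (pact g u) = B u' u].

(* The restriction of a Weil-Deligne parameter to W_F is its component wd_r.
   The local Langlands correspondence for the groups GL_m(F) has the following
   properties: bijectivity, irreducible parameters <-> supercuspidals, duality,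
   and, through local class field theory, the case m = 1, twisting and central
   characters. Local factors of pairs are not included, so that a statement
   about all such rec covers in particular the local Langlands correspondence. *)
Definition langlands_correspondence
    (rec : forall m, prerep R (baseAlg F) m -> wdrep R Fs m) :=
  let irr m := @irrep R F (baseAlg F) m (@GL F (baseAlg F) m) in
  let eqv m := @equiv R F (baseAlg F) m (@GL F (baseAlg F) m) in
  (forall m p, (0 < m)%N -> irr m p -> frob_semisimple_wdrep (rec m p)) /\
  (forall m p p', (0 < m)%N -> irr m p -> irr m p' ->
     (eqv m p p' <-> wd_iso (rec m p) (rec m p'))) /\
  (forall m f, (0 < m)%N -> frob_semisimple_wdrep f ->
     exists2 p, irr m p & wd_iso (rec m p) f) /\
  (forall m p, (0 < m)%N -> irr m p ->
     (supercuspidal (@GL F (baseAlg F) m) p <-> irreducible_weil (rec m p))) /\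
  (forall m p p', (0 < m)%N -> irr m p -> irr m p' -> contragredient p p' ->
     wd_iso (rec m p')
       (WDRep (fun w => (invmx (wd_r (rec m p) w))^T) (- (wd_N (rec m p))^T))) /\
  exists2 art, reciprocity art &
  [/\ forall chi (p : prerep R (baseAlg F) 1), irr 1%N p ->
        (forall g (u : psp p), GL g -> pcar u -> pact g u = chi (g ord0 ord0) *: u) ->
        forall w, weil w -> wd_r (rec 1%N p) w = (chi (art w))%:M,
      forall m chi p, (0 < m)%N -> quasi_character chi -> irr m p ->
        wd_iso (rec m (twist (fun g : 'M[baseAlg F]_m => chi (\det (g : 'M[F]_m))) p))
          (WDRep (fun w => chi (art w) *: wd_r (rec m p) w) (wd_N (rec m p)))
    & forall m p (chi : F -> C), (0 < m)%N -> irr m p ->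
        (forall a (u : psp p), a != 0 -> pcar u -> pact ((a : baseAlg F)%:M) u = chi a *: u) ->
        forall w, weil w -> \det (wd_r (rec m p) w) = chi (art w)].

(* The Jacquet-Langlands correspondence: the bijection between essentially
   square-integrable classes of GL_m(D) and GL_md(F) with
   (-1)^m Theta_p(g) = (-1)^(md) Theta_{JL p}(g') whenever g and g' are regular
   semisimple with the same reduced characteristic polynomial. *)
Definition jacquet_langlands (D : divAlg F)
    (JL : forall m, prerep R D m -> prerep R (baseAlg F) (m * da_deg D)) :=
  forall m, (0 < m)%N ->
  [/\ forall p, ess_square_integrable p -> ess_square_integrable (JL m p),
      forall p p', ess_square_integrable p -> ess_square_integrable p' ->
        (equiv (@GL F D m) p p' <->
         equiv (@GL F (baseAlg F) (m * da_deg D)) (JL m p) (JL m p')),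
      forall p', ess_square_integrable p' ->
        exists2 p, ess_square_integrable p
          & equiv (@GL F (baseAlg F) (m * da_deg D)) (JL m p) p'
    & forall p g (g' : 'M[F]_(m * da_deg D)), ess_square_integrable p ->
        @GL F D m g -> @GL F (baseAlg F) (m * da_deg D) g' ->
        separable_poly (char_poly g') ->
        char_poly (bigmx g) = char_poly g' ^+ da_deg D ->
        forall t : C, character_value p g ((-1) ^+ m * t) <->
          character_value (JL m p) g' ((-1) ^+ (m * da_deg D) * t)].

(* f is a Langlands parameter of the irreducible representation p of GL_r(A),
   f = (+)_i lpar (s i), where p is the Langlands quotient of
   s_1 x ... x s_k and lpar gives the parameters, of dimension dm m, of
   essentially square-integrable representations of GL_m(A). *)
Definition parameter_of (A : divAlg F) (dm : nat -> nat)
    (lpar : forall m, prerep R A m -> wdrep R Fs (dm m))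
    r (p : prerep R A r) (f : wdrep R Fs (dm r)) :=
  exists k (m : 'I_k -> nat) (s : forall i, prerep R A (m i))
         (idx : forall i, 'I_(dm (m i)) -> 'I_(dm r)),
    [/\ standard_data r s, langlands_quotient s p, blocks idx
      & wd_iso f (WDRep (fun w => bdiag idx (fun i => wd_r (lpar (m i) (s i)) w))
                        (bdiag idx (fun i => wd_N (lpar (m i) (s i)))))].

(* z is the function (M, sigma) |-> tr (phi_p(Phi) | V^I), p any irreducible
   representation of GL_r(A) with supercuspidal support (M, sigma); the
   parameter in the L-group is w |-> (phi_p(w), w). *)
Definition is_Z_V (A : divAlg F) (dm : nat -> nat)
    (lpar : forall m, prerep R A m -> wdrep R Fs (dm m))
    (Phi : Fs -> Fs) r (V : algRep R Fs (dm r)) (z : bernsteinCentre R A r) :=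
  forall (y : cuspPair R A r) p f t,
    irrep (@GL F A r) p -> has_support (@GL F A r) p y -> parameter_of lpar p f ->
    trace_on_inertia_invariants (fun w => V (wd_r f w) w) Phi t ->
    z y = t.

(* z represents the supercuspidal support (M*_sigma, rho_sigma) of
   JL(sigma) = (x) JL(s i), where y = (M, sigma) and sigma = (x) s i. *)
Definition JL_support (D : divAlg F)
    (JL : forall m, prerep R D m -> prerep R (baseAlg F) (m * da_deg D))
    r (y : cuspPair R D r) (z : cuspPair R (baseAlg F) (r * da_deg D)) :=
  exists k (m : 'I_k -> nat) (s : forall i, prerep R D (m i)) idx x xi
         Ms tau idx' x' xi',
    [/\ forall i, (0 < m i)%N /\ ess_square_integrable (s i),
        factorized (cp_levi y) (cp_rep y) idx x xi s,
        factorized (m := fun i => (m i * da_deg D)%N) Ms tau idx' x' xi'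
          (fun i => JL (m i) (s i))
      & has_support Ms tau z].

End Correspondences.

(* Main.v *)
(* Write sigma = (x) s_i for the point (M, sigma), and tau = (x) JL(s_i). Ordering
   the s_i by decreasing exponents, let p be the Langlands quotient of the
   corresponding standard representation of G, and let p' be that of the JL(s_i),
   ordered by their own exponents. The parameters of p and p' are both the direct
   sum of the rec(JL(s_i)), and p has supercuspidal support (M, sigma). As p' is a
   quotient of a representation induced from tau, and tau is a subquotient of one
   induced from the supercuspidal support of JL(sigma), transitivity and exactness
   of parabolic induction show that p' has that support too. Hence Z_V at
   (M, sigma) and Z_V^* at its image are the same trace.

   The order of the blocks in a parabolic subgroup matters here, and a Levi
   subgroup does not determine it; this is harmless since any two presentations of
   the same Levi subgroup as a conjugate of a block-diagonal group differ by a
   matrix which permutes the blocks. Exactness amounts to lifting a function from G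
   to a quotient of the inducing representation: this can be done on one double
   coset P g K at a time, by averaging over a bounded group. *)

From HB Require Import structures.
Require Import Defs.
From mathcomp Require Import all_boot all_order all_algebra.
From mathcomp Require Import all_field fingroup perm.
From mathcomp Require Import complex boolp functions reals exp.
From mathcomp Require Import zify ring.

Set Implicit Arguments.
Unset Strict Implicit.
Unset Printing Implicit Defensive.

(** * Valuations and absolute values of determinants *)

Section Valuation.
Import Order.TTheory GRing.Theory Num.Theory.
Local Open Scope ring_scope.
Context {F : localField}.
Implicit Types (x y : F) (N M : int).

(** [is_Z_V] gives a value only once a representation, a parameter and a trace are exhibited, so all
    three must be produced on both sides, with one common parameter. Averaging needs no Haar
    measure. A lift chosen at g must be fixed by the elements of the Levi subgroup through which the
    stabilizer of P g in P g K acts. They form a bounded group, so a smooth vector has a finite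
    orbit under it, and delta^(1/2) is trivial on it, so the modulus disappears from the invariance
    condition. Two presentations of a Levi subgroup are compared through its centre: scalars taking
    distinct values on distinct colours separate the homogeneous parts of A^m, so a matrix relating
    the two presentations must match these parts. Representations are predicates on an ambient space
    with an action by all matrices. Two presentations of the same parabolic subgroup therefore give
    equal induced representations, not merely isomorphic ones, and can be rewritten into each
    other. *)

Lemma lf_val1 : lf_val (1 : F) = 0.
Proof. by apply: (addrI (lf_val (1 : F))); rewrite addr0 -lf_valM ?mulr1 ?oner_neq0. Qed.

Lemma lf_valN1 : lf_val (- 1 : F) = 0.
Proof.
have n1 : (- 1 : F) != 0 by rewrite oppr_eq0 oner_neq0.
have := lf_valM n1 n1; rewrite mulrNN mulr1 lf_val1.
by set v := lf_val _; clearbody v; lia.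
Qed.

Lemma vge0 N : vge N (0 : F). Proof. by rewrite /vge /val_ge eqxx. Qed.

Lemma vge_lf_val x : vge (lf_val x) x.
Proof. by rewrite /vge /val_ge lexx orbT. Qed.

Lemma vgeW N M x : N <= M -> vge M x -> vge N x.
Proof.
move=> NM /orP[/eqP->|Mx]; first exact: vge0.
by rewrite /vge /val_ge (le_trans NM Mx) orbT.
Qed.

Lemma vgeM N M x y : vge N x -> vge M y -> vge (N + M) (x * y).
Proof.
have [->|x0] := eqVneq x 0; first by rewrite mul0r (vge0 (N + M)).
have [->|y0] := eqVneq y 0; first by rewrite mulr0 (vge0 (N + M)).
rewrite /vge /val_ge (negPf x0) (negPf y0) mulf_eq0 (negPf x0) (negPf y0) /=.
by rewrite lf_valM //; apply: lerD.
Qed.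

Lemma vgeN N x : vge N x -> vge N (- x).
Proof.
move=> Nx; rewrite -mulN1r -[N]add0r; apply: vgeM => //.
by rewrite -lf_valN1 vge_lf_val.
Qed.

Lemma vgeD N x y : vge N x -> vge N y -> vge N (x + y).
Proof. exact: lf_valD. Qed.

Lemma vgeB N x y : vge N x -> vge N y -> vge N (x - y).
Proof. by move=> Nx /vgeN; apply: vgeD. Qed.

Lemma vge_sum N (I : finType) (P : pred I) (f : I -> F) :
  (forall i, P i -> vge N (f i)) -> vge N (\sum_(i | P i) f i).
Proof.
move=> Nf; elim/big_ind: _ => // [|x y]; [exact: vge0|exact: vgeD].
Qed.

Lemma vge_prod N n (f : 'I_n -> F) :
  (forall i, vge N (f i)) -> vge (N *+ n) (\prod_i f i).
Proof.
elim: n f => [|n IH] f Nf.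
  by rewrite big_ord0 mulr0n -lf_val1 vge_lf_val.
by rewrite big_ord_recl mulrS; apply: vgeM => //; apply: IH.
Qed.

Lemma vge_det N n (B : 'M[F]_n) :
  (forall i j, vge N (B i j)) -> vge (N *+ n) (\det B).
Proof.
move=> NB; apply: vge_sum => s _; rewrite -[N *+ n]add0r.
apply: vgeM; last by apply: vge_prod => i.
by case: (odd_perm s); [rewrite -lf_valN1|rewrite -lf_val1]; apply: vge_lf_val.
Qed.

Lemma lf_q_gt0 : (0 < lf_q F)%N.
Proof.
have [s [_ /(_ 0 (vge0 0))[i _]]] := @lf_residue F.
exact: leq_ltn_trans (ltn_ord i).
Qed.

(** Digit expansion along a uniformizer. It stands in for compactness: a ball is finite modulo a
    smaller ball. *)
Lemma digits a b : exists (I : finType) (dig : F -> I),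
  forall x y, vge a x -> vge a y -> dig x = dig y -> vge b (x - y).
Proof.
suff H k : exists (I : finType) (dig : F -> I),
  forall x y, vge a x -> vge a y -> dig x = dig y -> vge (a + k%:Z) (x - y).
  have [I [dig Hd]] := H (absz (b - a)); exists I, dig => x y ax ay e.
  by apply: vgeW (Hd _ _ ax ay e); lia.
elim: k => [|k [I [dig Hd]]].
  by exists unit, (fun=> tt) => x y ax ay _; rewrite addr0; exact: vgeB.
have [pi [pi0 vpi]] := @lf_unif F.
have [s [s0 Hs]] := @lf_residue F.
have [res resP] : exists res : F -> 'I_(lf_q F),
    forall u, vge 0 u -> vge 1 (u - s (res u)).
  suff /choice[res H] : forall u, exists i, vge 0 u -> vge 1 (u - s i).
    by exists res.
  move=> u; case: (boolP (vge 0 u)) => u0; last by exists (Ordinal lf_q_gt0).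
  by have [i [Hi _]] := Hs u u0; exists i.
(* [rep] picks a point of the ball in each class of the digits found so far. *)
have [rep repP] : exists rep : I -> F,
    forall x, vge a x -> vge a (rep (dig x)) /\ dig (rep (dig x)) = dig x.
  suff /choice[rep H] : forall d, exists z, forall x, vge a x -> dig x = d ->
      vge a z /\ dig z = d.
    by exists rep => x ax; exact: (H _ x ax erefl).
  move=> d; have [[x [ax xd]]|nx] := pselect (exists x, vge a x /\ dig x = d).
    by exists x => ? _ _; split.
  by exists 0 => x ax xd; case: nx; exists x.
have [p [p0 vp]] : exists p : F, p != 0 /\ lf_val p = a + k%:Z.
  have vX n : pi ^+ n != 0 /\ lf_val (pi ^+ n) = n%:Z.
    elim: n => [|n [IH0 IH]]; first by rewrite expr0 oner_neq0 lf_val1.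
    by rewrite exprS mulf_neq0 // lf_valM // vpi IH; split=> //; lia.
  have [[n ->]|[n ->]] : (exists n : nat, a + k%:Z = n%:Z) \/ (exists n : nat, a + k%:Z = - n%:Z).
  - case: (leP 0 (a + k%:Z)) => H; [left|right]; exists (absz (a + k%:Z)); lia.
  - by exists (pi ^+ n); have [] := vX n.
  - have [n0 vn] := vX n.
    exists (pi ^+ n)^-1; split; first by rewrite invr_eq0.
    have := lf_valM n0 (y := (pi ^+ n)^-1); rewrite invr_eq0 mulfV // lf_val1 vn.
    by move=> /(_ n0) H; lia.
(* As [p] has valuation a + k, the quotient of x - rep by p is integral, and its residue is the next
   digit. *)
exists (prod I 'I_(lf_q F)), (fun x => (dig x, res ((x - rep (dig x)) / p))).
move=> x y ax ay [dxy rxy].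
set ux := (x - rep (dig x)) / p; set uy := (y - rep (dig y)) / p.
have vpV : vge (- (a + k%:Z)) p^-1.
  have := lf_valM p0 (y := p^-1); rewrite invr_eq0 mulfV // lf_val1 vp.
  by move=> /(_ p0) e; apply: vgeW (vge_lf_val _); lia.
have u0 z : vge a z -> vge 0 ((z - rep (dig z)) / p).
  move=> az; have [ar dr] := repP z az.
  by rewrite -(subrr (a + k%:Z)); apply: vgeM => //; apply: Hd.
have -> : x - y = p * ((ux - s (res ux)) - (uy - s (res uy))).
  rewrite /ux /uy rxy -dxy; move: (s _) => t; move: (rep _) => z.
  by field.
rewrite -addn1 PoszD addrA; apply: vgeM; first by rewrite -vp vge_lf_val.
by apply: vgeB; apply: resP; apply: u0.
Qed.

(** Powers of a uniformizer. These scalars tell colours apart in the central elements of Levi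
    subgroups. *)
Lemma val_distinct k : exists lam : 'I_k -> F, (forall i, lam i != 0) /\ injective lam.
Proof.
have [pi [pi0 vpi]] := @lf_unif F.
have vX n : lf_val (pi ^+ n) = n%:Z.
  elim: n => [|n IH]; first by rewrite expr0 lf_val1.
  by rewrite exprS lf_valM ?expf_neq0 // vpi IH; lia.
exists (fun i => pi ^+ i); split=> [i|i j eij]; first by rewrite expf_neq0.
by apply/val_inj; have := vX i; rewrite eij vX => -[].
Qed.

End Valuation.

Section AbsDet.
Import Order.TTheory GRing.Theory Num.Theory.
Local Open Scope ring_scope.
Context {R : realType} {F : localField} {A : divAlg F}.

Lemma labsM (x y : F) : labs R (x * y) = labs R x * labs R y.
Proof.
rewrite /labs mulf_eq0; have [|x0] := eqVneq x 0; first by rewrite mul0r.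
have [|y0] := eqVneq y 0; first by rewrite mulr0.
rewrite /= lf_valM // opprD expfzDr //.
by rewrite pnatr_eq0 -lt0n lf_q_gt0.
Qed.

Lemma labs1 : labs R (1 : F) = 1.
Proof. by rewrite /labs oner_eq0 lf_val1 oppr0 expr0z. Qed.

Lemma labs_gt0 (x : F) : x != 0 -> 0 < labs R x.
Proof. by move=> x0; rewrite /labs (negPf x0) exprz_gt0 // ltr0n lf_q_gt0. Qed.

Local Notation b := (vbasis {: A}).
Local Notation dA := (\dim {: A}).

Lemma dA_gt0 : (0 < dA)%N.
Proof.
rewrite lt0n dimv_eq0 -subv0; apply/negP => /subvP/(_ 1 (memvf _)).
by rewrite memv0 oner_eq0.
Qed.

Lemma coordE (a : A) : a = \sum_i coord b i a *: b`_i.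
Proof. by apply: coord_vbasis; apply: memvf. Qed.

Lemma regmxM (x y : A) : regmx (x * y) = regmx x *m regmx y.
Proof.
apply/matrixP => i j; rewrite !mxE -mulrA {1}[y * _]coordE mulr_sumr linear_sum.
by apply: eq_bigr => k _; rewrite !mxE -scalerAr linearZ /= mulrC.
Qed.

Lemma regmx1 : regmx (1 : A) = 1%:M.
Proof.
by apply/matrixP => i j; rewrite !mxE mul1r coord_free ?(basis_free (vbasisP _)) // eq_sym.
Qed.

Lemma regmx0 : regmx (0 : A) = 0.
Proof. by apply/matrixP => i j; rewrite !mxE mul0r linear0. Qed.

Lemma regmx_sum (I : finType) (f : I -> A) : regmx (\sum_i f i) = \sum_i regmx (f i).
Proof.
apply/matrixP => i j; rewrite !mxE mulr_suml linear_sum summxE.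
by apply: eq_bigr => k _; rewrite mxE.
Qed.

Lemma bigmxM m (g h : 'M[A]_m) : bigmx (g *m h) = bigmx g *m bigmx h.
Proof.
rewrite /bigmx mul_mxblock; apply: eq_mxblock => p q.
by rewrite mxE regmx_sum; apply: eq_bigr => k _; rewrite regmxM.
Qed.

Lemma bigmxE m (g : 'M[A]_m) s t :
  bigmx g s t = regmx (g (tagnat.sig1 s) (tagnat.sig1 t)) (tagnat.sig2 s) (tagnat.sig2 t).
Proof. by rewrite /bigmx !mxE. Qed.

Lemma sig_eqE m (s t : 'I_(\sum_(p < m) dA)) : (s == t) =
  (tagnat.sig1 s == tagnat.sig1 t) && (tagnat.sig2 s == tagnat.sig2 t :> 'I_dA).
Proof.
rewrite -(can_eq tagnat.sigK) /tagnat.sig1 /tagnat.sig2.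
case: (tagnat.sig s) (tagnat.sig t) => p i [q j] /=.
rewrite -tag_eqE /tag_eq /=; case: eqVneq => //= e.
by case: q / e j => j; rewrite tagged_asE.
Qed.

Lemma bigmx1 m : bigmx (1%:M : 'M[A]_m) = 1%:M.
Proof.
apply/matrixP => s t; rewrite bigmxE [RHS]mxE sig_eqE [(1%:M : 'M[A]_m) _ _]mxE.
by case: eqVneq => _; rewrite ?regmx1 ?regmx0 mxE.
Qed.

Local Notation absdet := (@absdet R F A _).

Lemma absdetM m (g h : 'M[A]_m) : absdet (g *m h) = absdet g * absdet h.
Proof. by rewrite /absdet bigmxM det_mulmx labsM. Qed.

Lemma absdet1 m : absdet (1%:M : 'M[A]_m) = 1.
Proof. by rewrite /absdet bigmx1 det1 labs1. Qed.

Lemma det_bigmx_neq0 m (g : 'M[A]_m) : GL g -> \det (bigmx g) != 0.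
Proof.
case=> h [gh _]; have : \det (bigmx g) * \det (bigmx h) = 1.
  by rewrite -det_mulmx -bigmxM gh bigmx1 det1.
by move=> e; apply: contra_eq_neq e => ->; rewrite mul0r eq_sym oner_neq0.
Qed.

Lemma absdet_gt0 m (g : 'M[A]_m) : GL g -> 0 < absdet g.
Proof. by move=> /det_bigmx_neq0 ?; apply: labs_gt0. Qed.

Lemma absdet_conj m (g h y : 'M[A]_m) : inverse_mx g h -> absdet (g *m y *m h) = absdet y.
Proof.
by case=> gh _; rewrite !absdetM mulrAC -absdetM gh absdet1 mul1r.
Qed.

(** A permutation with a nonzero term never lowers [rk], and raises it strictly wherever it moves an
    index. Since it preserves the sum of [rk], it moves nothing. *)
Lemma det_unitriangular n (B : 'M[F]_n) (rk : 'I_n -> nat) :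
  (forall i, B i i = 1) -> (forall i j, i != j -> B i j != 0 -> (rk i < rk j)%N) ->
  \det B = 1.
Proof.
move=> B1 Blt; rewrite /determinant (bigD1 1%g) //= odd_perm1 expr0 mul1r.
rewrite big1 ?big1 ?addr0 // => [s s1|i _]; last by rewrite perm1 B1.
suff [i /eqP Bi] : exists i, B i (s i) == 0 by rewrite (bigD1 i) //= Bi mul0r mulr0.
apply/existsP; apply: contraNT s1; rewrite negb_exists => /forallP nz.
apply/eqP/permP => i; rewrite perm1; apply/eqP.
have le j : (rk j <= rk (s j))%N.
  by case: (eqVneq j (s j)) => [<-//|js]; apply/ltnW/Blt.
apply: contraT => si; suff : (\sum_j rk j < \sum_j rk (s j))%N.
  by rewrite [X in (_ < X)%N](_ : _ = \sum_j rk j) ?ltnn // [RHS](reindex_inj (@perm_inj _ s)).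
by rewrite (bigD1 i) //= [X in (_ < X)%N](bigD1 i) //= -addSn leq_add ?leq_sum // Blt // eq_sym.
Qed.

Lemma absdet_unitriangular m (g : 'M[A]_m) (rk : 'I_m -> nat) :
  (forall p, g p p = 1) -> (forall p q, p != q -> g p q != 0 -> (rk p < rk q)%N) ->
  absdet g = 1.
Proof.
move=> g1 glt; rewrite /absdet (@det_unitriangular _ _ (fun s => rk (tagnat.sig1 s))) ?labs1 //.
  by move=> s; rewrite bigmxE g1 regmx1 mxE eqxx.
move=> s t; rewrite bigmxE sig_eqE; case: eqVneq => [<-|pq _] /=.
  by rewrite g1 regmx1 mxE => /negPf->; rewrite eqxx.
by move=> H; apply: glt => //; apply: contra_neq H => ->; rewrite regmx0 mxE.
Qed.

(** A nonzero determinant has a nonzero term, and its permutation, running along nonzero entries,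
    matches rows in [P] with columns in [Q]. Working over F multiplies both cardinals by the
    dimension of A. *)
Lemma GL_card m (g : 'M[A]_m) (P Q : pred 'I_m) : GL g ->
  (forall p q, g p q != 0 -> P p = Q q) -> #|P| = #|Q|.
Proof.
move=> /det_bigmx_neq0 d0 PQ.
have [s Hs] : exists s : 'S__, forall i, bigmx g i (s i) != 0.
  apply: contrapT => /forallNP H; move/eqP: d0; apply.
  rewrite /determinant big1 // => s _.
  have [i Hi] : exists i, bigmx g i (s i) = 0.
    by have /existsNP[i /negP] := H s; rewrite negbK => /eqP; exists i.
  by rewrite (bigD1 i) //= Hi mul0r mulr0.
have cardE (S : pred 'I_m) : #|[pred t : 'I_(\sum_(p < m) dA) | S (tagnat.sig1 t)]| = (#|S| * dA)%N.
  rewrite -sum1_card (reindex (@tagnat.rank m (fun=> dA))) /=; last first.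
    exists (@tagnat.sig m (fun=> dA)) => ? _; [exact: tagnat.rankK|exact: tagnat.sigK].
  transitivity (\sum_(u : {i : 'I_m & 'I_dA} | S (tag u) && true) 1)%N.
    by apply: eq_bigl => u; rewrite inE /tagnat.sig1 tagnat.rankK andbT.
  rewrite -(sig_big_dep S (fun _ _ => true) (fun _ _ => 1%N)) /=.
  by rewrite -sum_nat_const; apply: eq_bigr => p _; rewrite sum1_card card_ord.
apply/eqP; rewrite -(eqn_pmul2r dA_gt0) -!cardE; apply/eqP.
have <- : #|[preim s of [pred t : 'I_(\sum_(p < m) dA) | Q (tagnat.sig1 t)]]| =
    #|[pred t : 'I_(\sum_(p < m) dA) | Q (tagnat.sig1 t)]|.
  rewrite (card_preim perm_inj); apply: eq_card => t; rewrite !inE.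
  by suff -> : t \in codom s by []; apply/codomP; exists (s^-1 t)%g; rewrite permKV.
apply: eq_card => t; rewrite !inE.
apply: PQ; have := Hs t; rewrite bigmxE; apply: contra_neq => ->.
by rewrite regmx0 mxE.
Qed.

End AbsDet.

(** * Bounded sets of matrices and congruence subgroups *)

Section Bounded.
Import Order.TTheory GRing.Theory Num.Theory.
Local Open Scope ring_scope.
Context {R : realType} {F : localField} {A : divAlg F}.
Local Notation b := (vbasis {: A}).
Local Notation dA := (\dim {: A}).

Definition mge N m (g : 'M[A]_m) := forall p q i, vge N (coord b i (g p q)).

Lemma vge_fam (I : finType) (f : I -> F) : exists N, forall i, vge N (f i).
Proof.
exists (- \sum_i `|lf_val (f i)|) => i; apply: vgeW (vge_lf_val _).
have s0 : 0 <= \sum_(j | j != i) `|lf_val (f j)| by apply: sumr_ge0.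
by rewrite (bigD1 i) //= lerNl (le_trans (ler_norm _)) // normrN lerDl.
Qed.

Lemma mge_ex m (g : 'M[A]_m) : exists N, mge N g.
Proof.
have [N HN] := vge_fam (fun u : 'I_m * 'I_m * 'I_dA => coord b u.2 (g u.1.1 u.1.2)).
by exists N => p q i; apply: (HN (p, q, i)).
Qed.

Lemma mgeW N M m (g : 'M[A]_m) : N <= M -> mge M g -> mge N g.
Proof. by move=> NM Hg p q i; apply: vgeW NM (Hg p q i). Qed.

Lemma mgeD N m (g h : 'M[A]_m) : mge N g -> mge N h -> mge N (g + h).
Proof. by move=> Hg Hh p q i; rewrite mxE linearD; apply: vgeD; [exact: Hg|exact: Hh]. Qed.

Lemma mgeN N m (g : 'M[A]_m) : mge N g -> mge N (- g).
Proof. by move=> Hg p q i; rewrite mxE linearN; apply: vgeN; apply: Hg. Qed.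

(** The loss [c] comes from the valuations of the structure constants of A in the chosen basis. *)
Lemma mgeM m : exists c, forall N M (g h : 'M[A]_m),
  mge N g -> mge M h -> mge (N + M - c) (g *m h).
Proof.
have [c Hc] := vge_fam (fun u : 'I_dA * 'I_dA * 'I_dA => coord b u.2 (b`_(u.1.1) * b`_(u.1.2))).
exists (- c) => N M g h Hg Hh p q i; rewrite opprK mxE linear_sum.
apply: vge_sum => r _; rewrite [g p r]coordE [h r q]coordE mulr_suml linear_sum.
apply: vge_sum => k _; rewrite mulr_sumr linear_sum; apply: vge_sum => l _.
rewrite -scalerAl -scalerAr !linearZ /= -addrA.
by apply: vgeM; [exact: Hg|apply: vgeM; [exact: Hh|exact: (Hc (k, l, i))]].
Qed.

Lemma digits_mx m x y : exists (I : finType) (dig : 'M[A]_m -> I),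
  forall g h, mge x g -> mge x h -> dig g = dig h -> mge y (g - h).
Proof.
have [I [dig Hd]] := @digits F x y.
exists {ffun 'I_m * 'I_m * 'I_dA -> I},
  (fun g => [ffun u => dig (coord b u.2 (g u.1.1 u.1.2))]).
move=> g h Hg Hh /ffunP e p q i; have := e (p, q, i).
by rewrite !ffunE !mxE linearB; apply: Hd; [exact: Hg|exact: Hh].
Qed.

Lemma inverse_mxC m (g h : 'M[A]_m) : inverse_mx g h -> inverse_mx h g.
Proof. by case. Qed.

Lemma inverse_mxM m (g g' h h' : 'M[A]_m) :
  inverse_mx g g' -> inverse_mx h h' -> inverse_mx (g *m h) (h' *m g').
Proof.
move=> [g1 g2] [h1 h2]; split.
  by rewrite mulmxA -(mulmxA g) h1 mulmx1.
by rewrite mulmxA -(mulmxA h') g2 mulmx1.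
Qed.

Lemma inverse_mx1 m : inverse_mx (1%:M : 'M[A]_m) 1%:M.
Proof. by split; rewrite mulmx1. Qed.

Lemma inverse_mx_GL m (g h : 'M[A]_m) : inverse_mx g h -> GL g.
Proof. by exists h. Qed.

Lemma GL1 m : GL (1%:M : 'M[A]_m).
Proof. exact: inverse_mx_GL (inverse_mx1 m). Qed.

Lemma GLM m (g h : 'M[A]_m) : GL g -> GL h -> GL (g *m h).
Proof. by move=> [g' Hg] [h' Hh]; exact: inverse_mx_GL (inverse_mxM Hg Hh). Qed.

Lemma congrW m N M (k : 'M[A]_m) : N <= M -> congr_nbhd M k -> congr_nbhd N k.
Proof. by move=> NM [Gk Hk]; split=> //; apply: (mgeW NM (g := k - 1%:M)). Qed.

Lemma congr_nbhd1 m N : congr_nbhd N (1%:M : 'M[A]_m).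
Proof. by split=> [|p q i]; [exact: GL1|rewrite subrr mxE linear0 vge0]. Qed.

Lemma congr_bounded m N : exists M, forall k : 'M[A]_m, congr_nbhd N k -> mge M k.
Proof.
have [M HM] := mge_ex (1%:M : 'M[A]_m).
exists (Num.min N M) => k [_ Hk]; rewrite -(subrK 1%:M k).
apply: mgeD; [apply: mgeW Hk|apply: mgeW HM]; by rewrite ge_min lexx ?orbT.
Qed.

(** For products it suffices that N be at least the loss [c] of a multiplication. Inverses ask for c
    + 1, so that each use of Y = - X - X Y gains at least one level. *)
Lemma congr_nbhd_group m : exists N0, forall N, N0 <= N ->
  (forall k k' : 'M[A]_m, congr_nbhd N k -> congr_nbhd N k' -> congr_nbhd N (k *m k')) /\
  (forall k k' : 'M[A]_m, congr_nbhd N k -> inverse_mx k k' -> congr_nbhd N k').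
Proof.
have [c Hc] := mgeM m; exists (Num.max c (c + 1)) => N; rewrite ge_max => /andP[cN c1N].
split=> [k k' [Gk Hk] [Gk' Hk']|k k' [Gk Hk] kk'].
  split; first exact: GLM.
  have -> : k *m k' - 1%:M = (k - 1%:M) *m (k' - 1%:M) + ((k - 1%:M) + (k' - 1%:M)).
    move: (k - 1%:M) (k' - 1%:M) (subrK 1%:M k) (subrK 1%:M k') => x y <- <-.
    by rewrite mulmxDl mul1mx mulmxDr mulmx1 -!addrA addrN addr0.
  apply: mgeD; last exact: mgeD.
  by apply: mgeW (Hc _ _ _ _ Hk Hk'); rewrite -addrA lerDl subr_ge0.
split; first exact: inverse_mx_GL (inverse_mxC kk').
set X := k - 1%:M; set Y := k' - 1%:M.
have eY : Y = - X - X *m Y.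
  have : k *m k' = 1%:M by case: kk'.
  rewrite -(subrK 1%:M k) -(subrK 1%:M k') -/X -/Y mulmxDl mul1mx mulmxDr mulmx1 => e.
  have e0 : X *m Y + X + Y = 0 by apply: (addIr 1%:M); rewrite add0r -addrA.
  by apply/eqP; rewrite -opprD -addr_eq0 addrC [X + _]addrC; apply/eqP.
have [M HM] := mge_ex Y.
(* Y has some level [M] to begin with; [eY] is iterated until level N is reached. *)
have H j : mge (Num.min N (M + j%:Z)) Y.
  elim: j => [|j IH]; first by apply: mgeW HM; rewrite ge_min addr0 lexx orbT.
  rewrite eY; apply: mgeD; apply: mgeN; first by apply: mgeW Hk; rewrite ge_min lexx.
  apply: mgeW (Hc _ _ _ _ Hk IH).
  by clear -c1N; lia.
by apply: mgeW (H (absz (N - M))); clear; lia.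
Qed.

Lemma congr_conj m (g h : 'M[A]_m) : inverse_mx g h -> forall N,
  exists N', forall k, congr_nbhd N' k -> congr_nbhd N (g *m k *m h).
Proof.
move=> gh N; have [c Hc] := mgeM m; have [M HM] := mge_ex g; have [M' HM'] := mge_ex h.
exists (N + c + c - M - M') => k [Gk Hk]; split.
  apply: GLM; last exact: inverse_mx_GL (inverse_mxC gh).
  by apply: GLM => //; exact: inverse_mx_GL gh.
have -> : g *m k *m h - 1%:M = g *m (k - 1%:M) *m h.
  by rewrite mulmxBr mulmx1 mulmxBl; case: gh => ->.
by apply: mgeW (Hc _ _ _ _ (Hc _ _ _ _ HM Hk) HM'); clear; lia.
Qed.

(* The determinants of the powers of h have valuations bounded below. *)
Lemma absdet_bounded m (H : 'M[A]_m -> Prop) :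
  (forall h h', H h -> H h' -> H (h *m h')) ->
  (forall h, H h -> exists2 h', H h' & h *m h' = 1%:M) ->
  (exists N, forall h, H h -> mge N h) ->
  forall h, H h -> absdet h = 1 :> R.
Proof.
move=> HM HV [N HN].
pose v (h : 'M[A]_m) := lf_val (\det (bigmx h)).
have d0 h : H h -> \det (bigmx h) != 0.
  move=> /HV[h' _ hh']; have : \det (bigmx h) * \det (bigmx h') = 1.
    by rewrite -det_mulmx -bigmxM hh' bigmx1 det1.
  by move=> e; apply: contra_eq_neq e => ->; rewrite mul0r eq_sym oner_neq0.
have vM h h' : H h -> H h' -> v (h *m h') = v h + v h'.
  by move=> Hh Hh'; rewrite /v bigmxM det_mulmx lf_valM // d0.
have [B HB] : exists B, forall h, H h -> B <= v h.
  have [c Hc] := vge_fam (fun u : 'I_dA * 'I_dA * 'I_dA => coord b u.2 (b`_(u.1.1) * b`_(u.1.2))).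
  exists ((N + c) *+ (\sum_(p < m) dA)) => h Hh.
  have : vge ((N + c) *+ (\sum_(p < m) dA)) (\det (bigmx h)).
    apply: vge_det => s t; rewrite bigmxE mxE [h _ _]coordE mulr_suml linear_sum.
    apply: vge_sum => k _; rewrite -scalerAl linearZ /=.
    by apply: vgeM; [exact: (HN _ Hh)|exact: (Hc (k, _, _))].
  by rewrite /vge /val_ge (negPf (d0 h Hh)).
have v0 h : H h -> 0 <= v h.
  move=> Hh.
  have [hn] : exists hn : nat -> 'M[A]_m, forall n, H (hn n) /\ v (hn n) = v h *+ n.+1.
    exists (fun n => iter n (mulmx h) h); elim=> [//|n [IH1 IH2]] /=; split; first exact: HM.
    by rewrite vM // IH2 -mulrS.
  move=> Hn; case: (lerP 0 (v h)) => // v1.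
  have [H1 H2] := Hn (absz B); have := HB _ H1; rewrite H2 -mulr_natr.
  by move: (v h) v1 => w; clear; nia.
move=> h Hh; have [h' Hh' hh'] := HV _ Hh.
have := vM _ _ Hh Hh'; rewrite hh' /v bigmx1 det1 lf_val1 -/(v h) -/(v h').
have := v0 _ Hh; have := v0 _ Hh'; rewrite /absdet /labs (negPf (d0 _ Hh)) -/(v h).
move: (v h) (v h') => w w' H1 H2 e; have -> : w = 0 by move: e H1 H2; clear; lia.
by rewrite oppr0 expr0z.
Qed.

End Bounded.

(** * Block-diagonal matrices and the modulus character *)

Section Blocks.
Import Order.TTheory GRing.Theory Num.Theory.
Local Open Scope ring_scope.
Context {F : localField} {A : divAlg F} {m : nat}.
Implicit Types (P Q : pred 'I_m) (c : 'I_m -> 'I_m) (y z g h : 'M[A]_m).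

Definition separates P y := forall p q, P p != P q -> y p q = 0.

Definition blockdiag c y := forall p q, c p != c q -> y p q = 0.

Definition indic_mx P : 'M[A]_m := \matrix_(p, q) ((p == q) && P p)%:R.

(** This is [colour_part] for an arbitrary set of indices: unions of colour classes occur when a
    colouring is compared with a refinement. *)
Definition dpart P y : 'M[A]_m :=
  \matrix_(p, q) if P p && P q then y p q else (p == q)%:R.

Lemma mul_indic P y p q : (indic_mx P *m y) p q = if P p then y p q else 0.
Proof.
rewrite mxE (bigD1 p) //= mxE eqxx big1 ?addr0 => [|r rp].
  by case: (P p); rewrite ?mul1r ?mul0r.
by rewrite mxE eq_sym (negPf rp) mul0r.
Qed.

Lemma indic_mul P y p q : (y *m indic_mx P) p q = if P q then y p q else 0.
Proof.
rewrite mxE (bigD1 q) //= mxE eqxx big1 ?addr0 => [|r rp].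
  by case: (P q); rewrite ?mulr1 ?mulr0.
by rewrite mxE (negPf rp) mulr0.
Qed.

(** Commuting with a projection is visibly stable under products and inverses, which a condition on
    entries is not. *)
Lemma separatesP P y : separates P y <-> indic_mx P *m y = y *m indic_mx P.
Proof.
split=> [H|/matrixP H p q].
  apply/matrixP => p q; rewrite mul_indic indic_mul.
  by case EP: (P p); case EQ: (P q) => //; rewrite H ?EP ?EQ.
by have := H p q; rewrite mul_indic indic_mul; case: (P p); case: (P q).
Qed.

Lemma separates1 P : separates P 1%:M.
Proof. by move=> p q; rewrite mxE; case: (eqVneq p q) => // ->; rewrite eqxx. Qed.

Lemma separatesM P y z : separates P y -> separates P z -> separates P (y *m z).
Proof. by rewrite !separatesP => Hy Hz; rewrite mulmxA Hy -mulmxA Hz mulmxA. Qed.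

Lemma separatesV P y z : inverse_mx y z -> separates P y -> separates P z.
Proof.
rewrite !separatesP => -[yz zy] Hy.
by rewrite -[LHS]mul1mx -zy -mulmxA [y *m _]mulmxA -Hy -(mulmxA (indic_mx P)) yz mulmx1.
Qed.

Lemma blockdiagP c y : blockdiag c y <-> forall a, separates (fun p => c p == a) y.
Proof.
split=> [H a p q Hpq|H p q cpq]; last first.
  by apply: (H (c p)); rewrite eqxx [c q == _]eq_sym (negPf cpq).
by apply: H; apply: contraNneq Hpq => ->.
Qed.

Lemma blockdiag1 c : blockdiag c 1%:M.
Proof. by apply/blockdiagP => a; apply: separates1. Qed.

Lemma blockdiagM c y z : blockdiag c y -> blockdiag c z -> blockdiag c (y *m z).
Proof.
by move=> /blockdiagP Hy /blockdiagP Hz; apply/blockdiagP => a; apply: separatesM.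
Qed.

Lemma blockdiagV c y z : inverse_mx y z -> blockdiag c y -> blockdiag c z.
Proof. by move=> yz /blockdiagP Hy; apply/blockdiagP => a; apply: separatesV yz _. Qed.

Lemma blockdiag_sep c P y : (forall p q, c p = c q -> P p = P q) ->
  blockdiag c y -> separates P y.
Proof. by move=> cP H p q Hpq; apply: H; apply: contraNneq Hpq => /cP->. Qed.

Lemma refines_blockdiag c' c y : refines c' c -> blockdiag c' y -> blockdiag c y.
Proof. by move=> r H p q cpq; apply: H; apply: contraNneq cpq => /r->. Qed.

Lemma dpart1 P : dpart P 1%:M = 1%:M.
Proof. by apply/matrixP => p q; rewrite !mxE if_same. Qed.

Lemma eq_dpart P Q y : P =1 Q -> dpart P y = dpart Q y.
Proof. by move=> PQ; apply/matrixP => p q; rewrite !mxE !PQ. Qed.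

Lemma dpart_indic P y : dpart P y = indic_mx P *m y *m indic_mx P + (1%:M - indic_mx P).
Proof.
apply/matrixP => p q; rewrite [RHS]mxE indic_mul mul_indic !mxE.
case: eqVneq => [<-|_]; case: (P p) => /=; rewrite ?subrr ?subr0 ?addr0 ?add0r //.
by case: (P q).
Qed.

Lemma indic_idem P : indic_mx P *m indic_mx P = indic_mx P.
Proof. by apply/matrixP => p q; rewrite mul_indic mxE; case: (P p); rewrite ?andbF. Qed.

Lemma dpart_sep P y : separates P y -> dpart P y = indic_mx P *m y + (1%:M - indic_mx P).
Proof. by move=> /separatesP Hy; rewrite dpart_indic -mulmxA -Hy mulmxA indic_idem. Qed.

Lemma dpartM P y z : separates P y -> separates P z ->
  dpart P (y *m z) = dpart P y *m dpart P z.
Proof.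
move=> Hy Hz; rewrite !dpart_sep //; last exact: separatesM.
move/separatesP: Hy => Hy; set E := indic_mx P.
have E1 : (1%:M - E) *m (1%:M - E) = 1%:M - E.
  by rewrite mulmxBl mul1mx mulmxBr mulmx1 indic_idem subrr subr0.
have E2 : (1%:M - E) *m E = 0 by rewrite mulmxBl mul1mx indic_idem subrr.
have E3 : E *m (1%:M - E) = 0 by rewrite mulmxBr mulmx1 indic_idem subrr.
move: (1%:M - E) E1 E2 E3 => U E1 E2 E3.
rewrite mulmxDl !mulmxDr E1 !mulmxA E2 mul0mx add0r.
by rewrite Hy -[_ *m E *m E]mulmxA indic_idem -(mulmxA y E U) E3 mulmx0 addr0.
Qed.

Lemma dpartU P Q y : (forall p, ~~ (P p && Q p)) -> separates P y -> separates Q y ->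
  dpart (fun p => P p || Q p) y = dpart P y *m dpart Q y.
Proof.
move=> PQ HP HQ.
have HPQ : separates (fun p => P p || Q p) y.
  move=> p q H; case: (eqVneq (P p) (P q)) => [e|/HP//].
  by apply: HQ; apply: contraNneq H => ->; rewrite e.
have EU : indic_mx (fun p => P p || Q p) = indic_mx P + indic_mx Q.
  apply/matrixP => p q; rewrite !mxE; have := PQ p.
  by case: (p == q); case: (P p); case: (Q p); rewrite //= ?addr0 ?add0r.
have EPQ : indic_mx P *m indic_mx Q = 0.
  apply/matrixP => p q; rewrite mul_indic !mxE; have := PQ p.
  by case: (P p); case: (Q p); rewrite //= andbF.
rewrite !dpart_sep // EU; move/separatesP: HP => HP.
have PyQ : indic_mx P *m y *m indic_mx Q = 0 by rewrite HP -mulmxA EPQ mulmx0.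
have -> : 1%:M - (indic_mx P + indic_mx Q) = (1%:M - indic_mx P) *m (1%:M - indic_mx Q).
  by rewrite mulmxBl mul1mx mulmxBr mulmx1 EPQ subr0 opprD addrA addrAC.
have f : (1%:M - indic_mx P) *m (indic_mx Q *m y) = indic_mx Q *m y.
  by rewrite mulmxBl mul1mx mulmxA EPQ mul0mx subr0.
have e : indic_mx P *m y *m (1%:M - indic_mx Q) = indic_mx P *m y.
  by rewrite mulmxBr mulmx1 PyQ subr0.
rewrite (mulmxDl (indic_mx P)); move: (1%:M - indic_mx P) (1%:M - indic_mx Q) f e => U V f e.
by rewrite mulmxDl !mulmxDr e f mulmxA PyQ mul0mx add0r addrA.
Qed.

Lemma GL_dpart P y : GL y -> separates P y -> GL (dpart P y).
Proof.
case=> z yz Hy; have Hz := separatesV yz Hy; exists (dpart P z); case: yz => yz zy.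
by split; rewrite -dpartM // ?yz ?zy dpart1.
Qed.

Lemma mge_dpart N P y : mge N y -> mge N (1%:M : 'M[A]_m) -> mge N (dpart P y).
Proof.
move=> Hy H1 p q i; rewrite mxE; case: ifP => _; first exact: Hy.
by have := H1 p q i; rewrite mxE.
Qed.

Lemma GL_row g p : GL g -> exists q, g p q != 0.
Proof.
case=> h [gh _]; apply: contrapT => /forallNP H.
have /matrixP/(_ p p) := gh; rewrite !mxE eqxx big1 => [/eqP|q _].
  by rewrite eq_sym oner_eq0.
by have /negP := H q; rewrite negbK => /eqP->; rewrite mul0r.
Qed.

Lemma GL_col g q : GL g -> exists p, g p q != 0.
Proof.
case=> h [_ hg]; apply: contrapT => /forallNP H.
have /matrixP/(_ q q) := hg; rewrite !mxE eqxx big1 => [/eqP|p _].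
  by rewrite eq_sym oner_eq0.
by have /negP := H p; rewrite negbK => /eqP->; rewrite mulr0.
Qed.

(* g maps the c-homogeneous parts of A^m to the c2-homogeneous ones. *)
Definition transports c c2 g := forall p q, g p q != 0 -> c2 p = c q.

Lemma transports_indic c c2 g a : transports c c2 g ->
  g *m indic_mx (fun p => c p == a) = indic_mx (fun p => c2 p == a) *m g.
Proof.
move=> H; apply/matrixP => p q; rewrite mul_indic indic_mul.
case: (eqVneq (g p q) 0) => [->|/H->//]; by rewrite !if_same.
Qed.

End Blocks.

Section Modulus.
Import Order.TTheory GRing.Theory Num.Theory.
Local Open Scope ring_scope.
Context {R : realType} {F : localField} {A : divAlg F} {m : nat}.
Implicit Types (P Q : pred 'I_m) (c : 'I_m -> 'I_m) (y z g h : 'M[A]_m).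
Local Notation absdet := (@absdet R F A _).
Local Notation sqrt_modulus := (@sqrt_modulus R F A m).

Definition below c c' (a : 'I_m) :=
  #|[pred q | [exists p, (c' p == a) && (c p == c q)] & (a < c' q)%N]|.
Definition above c c' (a : 'I_m) :=
  #|[pred q | [exists p, (c' p == a) && (c p == c q)] & (c' q < a)%N]|.
Definition mod_exp c c' a : R := ((below c c' a)%:R - (above c c' a)%:R) / 2%:R.

Definition mod_factor c c' y a :=
  powR (absdet (dpart (fun p => c' p == a) y)) (mod_exp c c' a).

Lemma sqrt_modulusE c c' y : sqrt_modulus c c' y = \prod_a mod_factor c c' y a.
Proof. by []. Qed.

Lemma absdet_ge0 y : 0 <= absdet y.
Proof.
by rewrite /Defs.absdet /labs; case: ifP => // _; rewrite exprz_ge0.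
Qed.

Lemma sqrt_modulusM c c' y z : blockdiag c' y -> blockdiag c' z ->
  sqrt_modulus c c' (y *m z) = sqrt_modulus c c' y * sqrt_modulus c c' z.
Proof.
move=> /blockdiagP Hy /blockdiagP Hz; rewrite !sqrt_modulusE -big_split /=.
by apply: eq_bigr => a _; rewrite /mod_factor dpartM // absdetM powRM ?absdet_ge0.
Qed.

Lemma sqrt_modulus_eq1 c c' y :
  (forall a, absdet (dpart (fun p => c' p == a) y) = 1) -> sqrt_modulus c c' y = 1.
Proof. by move=> H; rewrite sqrt_modulusE big1 // => a _; rewrite /mod_factor H powR1. Qed.

Lemma sqrt_modulus1 c c' : sqrt_modulus c c' 1%:M = 1.
Proof. by apply: sqrt_modulus_eq1 => a; rewrite dpart1 absdet1. Qed.

Lemma sqrt_modulus_gt0 c c' y : GL y -> blockdiag c' y -> 0 < sqrt_modulus c c' y.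
Proof.
move=> Gy /blockdiagP Hy; rewrite sqrt_modulusE prodr_gt0 // => a _.
by rewrite powR_gt0 // absdet_gt0 //; apply: GL_dpart.
Qed.

(** Each diagonal block of a bounded group runs over a bounded group, on which [absdet] is 1. *)
Lemma sqrt_modulus_bounded c c' (H : 'M[A]_m -> Prop) :
  (forall h, H h -> blockdiag c' h) ->
  (forall h h', H h -> H h' -> H (h *m h')) ->
  (forall h, H h -> exists2 h', H h' & h *m h' = 1%:M) ->
  (exists N, forall h, H h -> mge N h) ->
  forall h, H h -> sqrt_modulus c c' h = 1.
Proof.
move=> Hc HM HV [N HN] h Hh; apply: sqrt_modulus_eq1 => a.
pose P p := c' p == a; have HP k : H k -> separates P k by move=> /Hc/blockdiagP; apply.
apply: (@absdet_bounded R F A m (fun x => exists2 k, H k & x = dpart P k)); last by exists h.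
- by move=> _ _ [k Hk ->] [k' Hk' ->]; exists (k *m k'); [exact: HM|rewrite dpartM //; exact: HP].
- move=> _ [k Hk ->]; have [k' Hk' kk'] := HV k Hk.
  exists (dpart P k'); first by exists k'.
  by rewrite -dpartM ?kk' ?dpart1 //; exact: HP.
- have [M HM1] := @mge_ex F A m 1%:M; exists (Num.min N M) => _ [k Hk ->].
  apply: mge_dpart; [apply: mgeW (HN _ Hk)|apply: mgeW HM1]; by rewrite ge_min lexx ?orbT.
Qed.

Lemma sqrt_modulus_unitriangular c c' y (rk : 'I_m -> nat) :
  (forall p, y p p = 1) -> (forall p q, p != q -> y p q != 0 -> (rk p < rk q)%N) ->
  sqrt_modulus c c' y = 1.
Proof.
move=> y1 ylt; apply: sqrt_modulus_eq1 => a; apply: (absdet_unitriangular (rk := rk)).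
  by move=> p; rewrite mxE y1 eqxx if_same.
move=> p q pq; rewrite mxE; case: ifP => _; first exact: ylt.
by rewrite (negPf pq) eqxx.
Qed.

Lemma dpart_empty P y : (forall p, ~~ P p) -> dpart P y = 1%:M.
Proof. by move=> H; apply/matrixP => p q; rewrite !mxE (negPf (H p)). Qed.

(** The least index of each colour class. It depends only on the partition, so it serves to compare
    products over colours for two colourings that name the same classes differently. *)
Definition canonical c p := [forall q, (c q == c p) ==> (p <= q)%N].

Lemma prod_canonical c (f : 'I_m -> R) : (forall a, (forall p, c p != a) -> f a = 1) ->
  \prod_a f a = \prod_(p | canonical c p) f (c p).
Proof.
move=> f1; rewrite [RHS](partition_big c xpredT) //=; apply: eq_bigr => a _.
case: (boolP [exists p, c p == a]) => [/existsP[p0 cp0]|]; last first.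
  rewrite negb_exists => /forallP H; rewrite f1 // big_pred0 // => p.
  by rewrite (negPf (H p)) andbF.
case: (arg_minnP (fun p => val p) (P := fun p => c p == a) cp0) => p /eqP cp pmin.
rewrite (big_pred1 p) ?cp // => q; rewrite /canonical /=.
apply/andP/eqP => [[/forallP H /eqP cq]|->]; last first.
  by split; [apply/forallP => r; apply/implyP; rewrite cp; exact: pmin|exact/eqP].
apply/val_inj/eqP; rewrite eqn_leq pmin ?cq // andbT.
by have := H p; rewrite cp cq eqxx.
Qed.

Lemma eq_sqrt_modulus c1 c1' c2 c2' y :
  (forall p q, (c1 p == c1 q) = (c2 p == c2 q)) ->
  (forall p q, (c1' p == c1' q) = (c2' p == c2' q)) ->
  (forall p q, c1 p = c1 q -> (c1' p < c1' q)%N = (c2' p < c2' q)%N) ->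
  sqrt_modulus c1 c1' y = sqrt_modulus c2 c2' y.
Proof.
move=> e e' lt; rewrite !sqrt_modulusE.
have f1 c c' a : (forall p, c' p != a) -> mod_factor c c' y a = 1.
  by move=> H; rewrite /mod_factor (dpart_empty y H) absdet1 powR1.
have E1 := prod_canonical (f1 c1 c1').
have E2 := prod_canonical (f1 c2 c2').
apply: (etrans E1).
apply: (etrans _ (esym E2)).
apply: eq_big => [p|p _]; first by apply: eq_forallb => q; rewrite e'.
have E q : [exists p0, (c1' p0 == c1' p) && (c1 p0 == c1 q)] =
           [exists p0, (c2' p0 == c2' p) && (c2 p0 == c2 q)].
  by apply: eq_existsb => r; rewrite e e'.
have lt' p' r q : c1' r = c1' p' -> c2' r = c2' p' -> c1 r = c1 q ->
    ((c1' p' < c1' q)%N = (c2' p' < c2' q)%N) * ((c1' q < c1' p')%N = (c2' q < c2' p')%N).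
  by move=> <- <- crq; split; apply: lt.
rewrite /mod_factor; congr powR.
  by congr (absdet _); apply: eq_dpart => q; rewrite /= e'.
rewrite /mod_exp /below /above; congr ((_%:R - _%:R) / _).
  apply: eq_card => q; rewrite !inE E; apply: andb_id2l => /existsP[r /andP[/eqP r1 /eqP r2]].
  have r1' : c1' r = c1' p by apply/eqP; rewrite e' r1 eqxx.
  have r2' : c1 r = c1 q by apply/eqP; rewrite e r2 eqxx.
  exact: (lt' p r q r1' r1 r2').1.
apply: eq_card => q; rewrite !inE E; apply: andb_id2l => /existsP[r /andP[/eqP r1 /eqP r2]].
have r1' : c1' r = c1' p by apply/eqP; rewrite e' r1 eqxx.
have r2' : c1 r = c1 q by apply/eqP; rewrite e r2 eqxx.
exact: (lt' p r q r1' r1 r2').2.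
Qed.

Lemma powR_prod (I : Type) (s : seq I) (P : pred I) (f : I -> R) e :
  (forall i, 0 <= f i) -> powR (\prod_(i <- s | P i) f i) e = \prod_(i <- s | P i) powR (f i) e.
Proof.
move=> f0; elim: s => [|i s IH]; first by rewrite !big_nil powR1.
rewrite !big_cons; case: ifP => // _; rewrite powRM ?IH //.
by apply: prodr_ge0 => j _; apply: f0.
Qed.

Lemma absdet_dpart_split c (s : seq 'I_m) y : uniq s -> blockdiag c y ->
  absdet (dpart (fun p => c p \in s) y) = \prod_(a <- s) absdet (dpart (fun p => c p == a) y).
Proof.
move=> us Hy; elim: s us => [_|a s IH /= /andP[as_ us]].
  by rewrite big_nil dpart_empty ?absdet1.
rewrite big_cons -IH // -absdetM -dpartU.
- by congr (absdet _); apply: eq_dpart => p; rewrite /= inE.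
- by move=> p; apply: contra as_ => /andP[/eqP<-].
- by apply: blockdiag_sep Hy => p q ->.
- by apply: blockdiag_sep Hy => p q ->.
Qed.

(** The order being lexicographic, the indices of greater colour for [c'] are those of greater
    colour for [c], together with those of greater [c']-colour in the same [c]-class. Hence the
    exponents add up colour by colour. *)
Lemma sqrt_modulus_trans c0 c c' y : (forall p q, c0 p = c0 q) -> refines c' c ->
  (forall p q, (c p < c q)%N -> (c' p < c' q)%N) -> GL y -> blockdiag c' y ->
  sqrt_modulus c0 c' y = sqrt_modulus c0 c y * sqrt_modulus c c' y.
Proof.
move=> c0c ref lex Gy Hy; rewrite !sqrt_modulusE.
(* [S b] is the set of [c']-colours occurring in the [c]-class b. Both sides become products over a
   of powers of [D a]. *)
pose S b a := [exists p, (c' p == a) && (c p == b)].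
pose D a := absdet (dpart (fun p => c' p == a) y).
have D1 a : (forall p, c' p != a) -> D a = 1.
  by move=> H; rewrite /D (dpart_empty y H) absdet1.
have Db b : absdet (dpart (fun p => c p == b) y) = \prod_(a | S b a) D a.
  have eP : (fun p => c p == b) =1 (fun p => c' p \in enum (S b)).
    move=> p; rewrite /= mem_enum; apply/idP/existsP => [cp|[q /andP[/eqP cq /eqP<-]]].
      by exists p; rewrite eqxx.
    by rewrite (ref _ _ cq).
  rewrite (eq_dpart y eP) absdet_dpart_split ?enum_uniq // big_enum_cond /=.
  by apply: eq_bigl => a; rewrite andbT.
under [X in _ = X * _]eq_bigr => b _.
  rewrite /mod_factor Db powR_prod; last by move=> a; apply: absdet_ge0.
  over.
rewrite (exchange_big_dep xpredT) //= -big_split /=; apply: eq_bigr => a _.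
rewrite /mod_factor -/(D a).
case: (boolP [exists p, c' p == a]) => [/existsP[p /eqP cp]|]; last first.
  rewrite negb_exists => /forallP H; by rewrite D1 // !powR1 mulr1 big1.
rewrite (big_pred1 (c p)) => [|b]; last first.
  apply/existsP/eqP => [[q /andP[/eqP cq /eqP<-]]|->].
    by apply: ref; rewrite cq cp.
  by exists p; rewrite cp !eqxx.
have D0 : 0 < D a by rewrite absdet_gt0 //; apply: GL_dpart => //; move/blockdiagP: Hy.
rewrite -powRD; last by rewrite (gt_eqF D0) implybT.
congr powR; rewrite /mod_exp.
have ex0 (cc : 'I_m -> 'I_m) b r : cc r = b ->
    forall q, [exists p, (cc p == b) && (c0 p == c0 q)] = true.
  by move=> cr q; apply/existsP; exists r; rewrite cr (c0c r q) !eqxx.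
have exa q : [exists p, (c' p == a) && (c p == c q)] = (c q == c p).
  apply/existsP/eqP => [[r /andP[/eqP cr /eqP <-]]|cq]; first by apply: ref; rewrite cr cp.
  by exists p; rewrite cp cq !eqxx.
have lt_cp q : (c' p < c' q)%N -> (c p <= c q)%N.
  by move=> H; rewrite leqNgt; apply: contraTN H => /lex; rewrite -leqNgt => /ltnW.
have lt_cq q : (c' q < c' p)%N -> (c q <= c p)%N.
  by move=> H; rewrite leqNgt; apply: contraTN H => /lex; rewrite -leqNgt => /ltnW.
have -> : below c0 c' a = (below c0 c (c p) + below c c' a)%N.
  rewrite /below -!sum1_card (bigID (fun q => (c p < c q)%N)) /=; congr addn.
    apply: eq_bigl => q; rewrite !inE (ex0 c' a p cp) (ex0 c (c p) p erefl) /= -cp.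
    by apply: andb_idl => /lex.
  apply: eq_bigl => q; rewrite !inE (ex0 c' a p cp) exa /= -cp andbC.
  case: (ltnP (c' p)) => [lt|]; rewrite ?andbF ?andbT //.
  by rewrite -leqNgt -val_eqE /= eqn_leq lt_cp ?andbT.
have -> : above c0 c' a = (above c0 c (c p) + above c c' a)%N.
  rewrite /above -!sum1_card (bigID (fun q => (c q < c p)%N)) /=; congr addn.
    apply: eq_bigl => q; rewrite !inE (ex0 c' a p cp) (ex0 c (c p) p erefl) /= -cp.
    by apply: andb_idl => /lex.
  apply: eq_bigl => q; rewrite !inE (ex0 c' a p cp) exa /= -cp andbC.
  case: (ltnP (c' q)) => [lt|]; rewrite ?andbF ?andbT //.
  by rewrite -leqNgt -val_eqE /= eqn_leq lt_cq.
by rewrite !natrD -mulrDl opprD addrACA.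
Qed.

(** Blocks of the same colour are conjugate under g, and the index counts in the exponents agree by
    [GL_card]. *)
Lemma sqrt_modulus_conj c0 c0' c c2 g h y :
  (forall p q, c0 p = c0 q) -> (forall p q, c0' p = c0' q) ->
  inverse_mx g h -> transports c c2 g ->
  sqrt_modulus c0' c2 (g *m y *m h) = sqrt_modulus c0 c y.
Proof.
move=> e0 e0' gh tr; rewrite !sqrt_modulusE; apply: eq_bigr => a _.
have Gg := inverse_mx_GL gh; case: (gh) => gh1 hg1.
rewrite /mod_factor; congr powR.
  rewrite -[RHS](absdet_conj _ gh); congr (absdet _); rewrite !dpart_indic.
  have -> : indic_mx (fun p => c2 p == a) = g *m indic_mx (fun p => c p == a) *m h.
    by rewrite (transports_indic a tr) -mulmxA gh1 mulmx1.
  rewrite mulmxDr mulmxDl mulmxBr mulmxBl mulmx1 gh1; congr (_ + _).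
  by rewrite !mulmxA -(mulmxA _ h g) hg1 mulmx1 -(mulmxA _ h g) hg1 mulmx1.
have E p q : [exists r, (c2 r == a) && (c0' r == c0' p)] =
             [exists r, (c r == a) && (c0 r == c0 q)].
  apply/existsP/existsP => -[r /andP[cr _]].
    have [s gs] := GL_row r Gg; exists s; rewrite (e0 s q) eqxx andbT.
    by rewrite -(tr r s gs).
  have [s gs] := GL_col r Gg; exists s; rewrite (e0' s p) eqxx andbT.
  by rewrite (tr s r gs).
rewrite /mod_exp; congr ((_%:R - _%:R) / _).
  by apply: (GL_card Gg) => p q gpq; rewrite /= (E p q) (tr p q gpq).
by apply: (GL_card Gg) => p q gpq; rewrite /= (E p q) (tr p q gpq).
Qed.

End Modulus.

(** * Unipotent and Levi subgroups *)

Section Unipotent.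
Import Order.TTheory GRing.Theory Num.Theory.
Local Open Scope ring_scope.
Context {F : localField} {A : divAlg F} {m : nat}.
Implicit Types (c : 'I_m -> 'I_m) (y z g h n l : 'M[A]_m).

Definition uni_rel c c' : rel 'I_m := [rel p q | (c p == c q) && (c' p < c' q)%N].

Definition uni c c' n := forall p q, ~~ uni_rel c c' p q -> n p q = (p == q)%:R.

Lemma uni_rel_trans c c' : transitive (uni_rel c c').
Proof.
move=> q p s /andP[/eqP pq lpq] /andP[/eqP qs lqs].
by rewrite /uni_rel /= pq qs eqxx (ltn_trans lpq lqs).
Qed.

Lemma uni_relxx c c' p : uni_rel c c' p p = false.
Proof. by rewrite /uni_rel /= ltnn andbF. Qed.

Definition strict c c' y := forall p q, ~~ uni_rel c c' p q -> y p q = 0.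

Lemma uniP c c' n : uni c c' n <-> strict c c' (n - 1%:M).
Proof.
split=> H p q /H; rewrite !mxE; first by move->; rewrite subrr.
by move/eqP; rewrite subr_eq0 => /eqP.
Qed.

Lemma strictM c c' y z : strict c c' y -> strict c c' z -> strict c c' (y *m z).
Proof.
move=> Hy Hz p q Hpq; rewrite mxE big1 // => s _.
case: (boolP (uni_rel c c' p s)) => [ps|/Hy->]; last by rewrite mul0r.
case: (boolP (uni_rel c c' s q)) => [sq|/Hz->]; last by rewrite mulr0.
by case/negP: Hpq; exact: uni_rel_trans ps sq.
Qed.

Lemma strictD c c' y z : strict c c' y -> strict c c' z -> strict c c' (y + z).
Proof. by move=> Hy Hz p q H; rewrite mxE Hy // Hz // addr0. Qed.

Lemma uni1 c c' : uni c c' 1%:M.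
Proof. by move=> p q _; rewrite mxE. Qed.

Lemma uniM c c' n n' : uni c c' n -> uni c c' n' -> uni c c' (n *m n').
Proof.
rewrite !uniP => Hn Hn'.
have -> : n *m n' - 1%:M = (n - 1%:M) *m (n' - 1%:M) + ((n - 1%:M) + (n' - 1%:M)).
  move: (n - 1%:M) (n' - 1%:M) (subrK 1%:M n) (subrK 1%:M n') => u v <- <-.
  by rewrite mulmxDl mul1mx mulmxDr mulmx1 -!addrA addrN addr0.
by apply: strictD; [exact: strictM|exact: strictD].
Qed.

(* 1 - n is nilpotent, and the inverse is the sum of its powers. *)
Lemma uniV c c' n : uni c c' n -> exists n', uni c c' n' /\ inverse_mx n n'.
Proof.
rewrite uniP => Hn; pose X := 1%:M - n.
have HX : strict c c' X by move=> p q /Hn; rewrite !mxE -opprB => /eqP; rewrite oppr_eq0 => /eqP.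
pose pw k := iter k (mulmx X) 1%:M.
have pwC k : pw k *m X = X *m pw k.
  by elim: k => [|k IH] /=; rewrite ?mulmx1 ?mul1mx // -mulmxA IH.
have pwS k : strict c c' (pw k.+1).
  elim: k => [|k IH]; first by rewrite /pw /= mulmx1.
  exact: strictM.
have pw_lt k p q : pw k p q != 0 -> (c' p + k <= c' q)%N.
  elim: k p => [|k IH] p.
    by rewrite mxE addn0; case: (eqVneq p q) => [->//|_]; rewrite eqxx.
  apply: contra_neqT => Hlt; rewrite /pw /= mxE big1 // => s _.
  case: (boolP (uni_rel c c' p s)) => [/andP[_ ps]|/HX->]; last by rewrite mul0r.
  case: (eqVneq (pw k s q) 0) => [e|/IH le]; first by rewrite -/(pw k) e mulr0.
  by case/negP: Hlt; rewrite addnS -addSn; apply: leq_trans le; rewrite leq_add2r.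
have pwm : pw m = 0.
  apply/matrixP => p q; rewrite mxE; apply/eqP; apply: contraT => /pw_lt H.
  by have := leq_trans (leq_addl _ _) H; rewrite leqNgt ltn_ord.
pose S k := \sum_(i < k) pw i.
have telS k : n *m S k = 1%:M - pw k.
  have -> : n = 1%:M - X by rewrite opprB addrC subrK.
  elim: k => [|k IH]; first by rewrite /S big_ord0 mulmx0 subrr.
  rewrite /S big_ord_recr mulmxDr -/(S k) IH mulmxBl mul1mx /=.
  by rewrite addrA subrK.
have telS' k : S k *m n = 1%:M - pw k.
  have -> : n = 1%:M - X by rewrite opprB addrC subrK.
  elim: k => [|k IH]; first by rewrite /S big_ord0 mul0mx subrr.
  rewrite /S big_ord_recr mulmxDl -/(S k) IH mulmxBr mulmx1 /= pwC.
  by rewrite addrA subrK.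
exists (S m); split; last by split; rewrite ?telS ?telS' pwm subr0.
have SS k : strict c c' (S k.+1 - 1%:M).
  elim: k => [|k IH]; first by move=> p q _; rewrite /S big_ord1 subrr mxE.
  rewrite /S big_ord_recr addrAC; apply: strictD => //; exact: pwS.
apply/uniP => p; have -> : S m = S m.-1.+1 by rewrite prednK // (leq_ltn_trans _ (ltn_ord p)).
exact: SS.
Qed.

Lemma uni_conj c c' y z n : refines c' c -> inverse_mx y z -> blockdiag c' y ->
  uni c c' n -> uni c c' (y *m n *m z).
Proof.
move=> ref yz Hy; rewrite !uniP => Hn; have Hz := blockdiagV yz Hy.
have -> : y *m n *m z - 1%:M = y *m (n - 1%:M) *m z.
  by case: yz => yz _; rewrite mulmxBr mulmx1 mulmxBl yz.
move=> p q Hpq; rewrite mxE big1 // => u _.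
case: (eqVneq (c' u) (c' q)) => [uq|/Hz->]; last by rewrite mulr0.
rewrite mxE big1 ?mul0r // => v _.
case: (eqVneq (c' p) (c' v)) => [pv|/Hy->]; last by rewrite mul0r.
rewrite Hn ?mulr0 //; apply: contra Hpq; rewrite /uni_rel /=.
by rewrite (ref _ _ uq) (ref _ _ pv) uq pv.
Qed.

Lemma uni_blockdiag c c' n : uni c c' n -> blockdiag c n.
Proof.
move=> Hn p q cpq; rewrite Hn; first by case: (eqVneq p q) cpq => // ->; rewrite eqxx.
by rewrite /uni_rel /= (negPf cpq).
Qed.

Lemma uni_GL c c' n : uni c c' n -> GL n.
Proof. by move=> /uniV[n' [_ H]]; exact: inverse_mx_GL H. Qed.

(** This recovers the Levi component from a product n y; the bound on stabilizers rests on it. *)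
Lemma uni_mul_block c0 c n y p q : uni c0 c n -> blockdiag c y -> c p = c q ->
  (n *m y) p q = y p q.
Proof.
move=> Hn Hy cpq; rewrite mxE (bigD1 p) //= Hn ?uni_relxx // eqxx mul1r.
rewrite big1 ?addr0 // => u up; case: (eqVneq (c u) (c q)) => [uq|/Hy->]; last by rewrite mulr0.
rewrite Hn; first by rewrite eq_sym (negPf up) mul0r.
by rewrite /uni_rel /= cpq -uq ltnn andbF.
Qed.

(** The parabolic subgroup of [c'] lies in that of [c]; refinement alone gives this only for the
    Levi subgroups. *)
Definition lexicographic c c' := refines c' c /\ forall p q, (c p < c q)%N -> (c' p < c' q)%N.

Lemma uni_sub c0 c c' n : (forall p q, c0 p = c0 q) -> lexicographic c c' ->
  uni c0 c n -> uni c0 c' n.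
Proof.
move=> c0c [_ lex] Hn p q Hpq; apply: Hn; apply: contra Hpq.
by rewrite /uni_rel /= (c0c p q) eqxx; exact: lex.
Qed.

Lemma uni_decomp c0 c c' n : (forall p q, c0 p = c0 q) -> lexicographic c c' ->
  uni c0 c' n -> exists n1 n2, [/\ uni c0 c n1, uni c c' n2 & n = n1 *m n2].
Proof.
move=> c0c [ref lex] Hn.
(* The part of [n] in the diagonal blocks of [c]. Dividing by it turns these blocks into the
   identity, and below them [n] vanishes by [lex]. *)
pose n2 : 'M[A]_m := \matrix_(p, q) if c p == c q then n p q else 0.
have H2 : uni c c' n2.
  move=> p q Hpq; rewrite mxE; case: ifP => cpq.
    by apply: Hn; apply: contra Hpq; rewrite /uni_rel /= cpq => /andP[].
  by case: (eqVneq p q) cpq => // ->; rewrite eqxx.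
have [n2' [H2' n22]] := uniV H2.
exists (n *m n2'), n2; split=> //; last by case: n22 => _ e; rewrite -mulmxA e mulmx1.
have B2 := uni_blockdiag H2'.
move=> p q Hpq; rewrite mxE.
have {Hpq} : (c q <= c p)%N by move: Hpq; rewrite /uni_rel /= (c0c p q) eqxx -leqNgt.
rewrite leq_eqVlt => /orP[/eqP/val_inj cqp|cqp].
  have /matrixP/(_ p q) : n2 *m n2' = 1%:M by case: n22.
  rewrite !mxE => <-; apply: eq_bigr => u _; rewrite mxE.
  by case: (eqVneq (c p) (c u)) => // cpu; rewrite B2 ?mulr0 // cqp eq_sym.
rewrite big1 => [|u _]; first by case: (eqVneq p q) cqp => // ->; rewrite ltnn.
case: (eqVneq (c u) (c q)) => [uq|/B2->]; last by rewrite mulr0.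
have cup : (c u < c p)%N by rewrite uq.
rewrite Hn; first by case: (eqVneq p u) cup => [->|_ _]; rewrite ?ltnn ?mul0r.
by rewrite /uni_rel /= (c0c p u) eqxx -leqNgt ltnW // lex.
Qed.

End Unipotent.

Section LeviGroup.
Import Order.TTheory GRing.Theory Num.Theory.
Local Open Scope ring_scope.
Context {F : localField} {A : divAlg F} {m : nat}.
Implicit Types (c : 'I_m -> 'I_m) (x xi y z g h n l : 'M[A]_m).

Lemma frameM x xi g h : inverse_mx x xi -> xi *m (g *m h) *m x = (xi *m g *m x) *m (xi *m h *m x).
Proof. by case=> xxi _; rewrite !mulmxA -(mulmxA _ x xi) xxi mulmx1. Qed.

Lemma frame1 x xi : inverse_mx x xi -> xi *m 1%:M *m x = 1%:M.
Proof. by case=> _ e; rewrite mulmx1. Qed.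

Lemma frameV x xi g h : inverse_mx x xi -> inverse_mx g h ->
  inverse_mx (xi *m g *m x) (xi *m h *m x).
Proof. by move=> e [gh hg]; split; rewrite -frameM // ?gh ?hg frame1. Qed.

Lemma frameK x xi g : inverse_mx x xi -> x *m (xi *m g *m x) *m xi = g.
Proof. by case=> e _; rewrite !mulmxA e mul1mx -mulmxA e mulmx1. Qed.

Lemma GL_frame x xi g : inverse_mx x xi -> GL (xi *m g *m x) <-> GL g.
Proof.
move=> e; split=> -[h gh]; last by exists (xi *m h *m x); exact: frameV.
rewrite -(frameK g e); exists (x *m h *m xi).
by have := frameV (inverse_mxC e) gh.
Qed.

Lemma levi1 c x xi : inverse_mx x xi -> levi c x xi 1%:M.
Proof. by move=> e; split; [exact: GL1|rewrite frame1 //; exact: blockdiag1]. Qed.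

Lemma leviM c x xi g h : inverse_mx x xi -> levi c x xi g -> levi c x xi h ->
  levi c x xi (g *m h).
Proof.
move=> e [Gg Hg] [Gh Hh]; split; first exact: GLM.
by rewrite frameM //; apply: blockdiagM.
Qed.

Lemma leviV c x xi g h : inverse_mx x xi -> inverse_mx g h -> levi c x xi g -> levi c x xi h.
Proof.
move=> e gh [Gg Hg]; split; first exact: inverse_mx_GL (inverse_mxC gh).
exact: blockdiagV (frameV e gh) Hg.
Qed.

Lemma levi_const c x xi h : (forall p q, c p = c q) -> levi c x xi h <-> GL h.
Proof. by move=> cc; split=> [[]//|Gh]; split=> // p q; rewrite (cc p q) eqxx. Qed.

Lemma levi_refines c' c x xi h : refines c' c -> levi c' x xi h -> levi c x xi h.
Proof. by move=> r [Gh Hh]; split=> //; apply: refines_blockdiag r Hh. Qed.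

Lemma unipE c c' x xi h : unip c c' x xi h = uni c c' (xi *m h *m x).
Proof. by []. Qed.

Lemma unip1 c c' x xi : inverse_mx x xi -> unip c c' x xi 1%:M.
Proof. by move=> e; rewrite unipE frame1 //; exact: uni1. Qed.

Lemma unipM c c' x xi g h : inverse_mx x xi -> unip c c' x xi g -> unip c c' x xi h ->
  unip c c' x xi (g *m h).
Proof. by move=> e; rewrite !unipE frameM //; exact: uniM. Qed.

Lemma unipV c c' x xi n : inverse_mx x xi -> unip c c' x xi n ->
  exists2 n', unip c c' x xi n' & inverse_mx n n'.
Proof.
move=> e /uniV[n' [Hn' nn']]; exists (x *m n' *m xi).
  by rewrite unipE (frameK n' (inverse_mxC e)).
by rewrite -(frameK n e); exact: (frameV (inverse_mxC e) nn').
Qed.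

Lemma unip_conj c c' x xi l l' n : inverse_mx x xi -> refines c' c -> inverse_mx l l' ->
  levi c' x xi l -> unip c c' x xi n -> unip c c' x xi (l *m n *m l').
Proof.
move=> e ref ll' [_ Hl] Hn; rewrite unipE (frameM _ _ e) (frameM _ _ e).
exact: (uni_conj ref (frameV e ll') Hl).
Qed.

Lemma unip_GL c c' x xi n : inverse_mx x xi -> unip c c' x xi n -> GL n.
Proof. by move=> e /uni_GL; rewrite GL_frame. Qed.

Lemma unip_levi c c' x xi n : inverse_mx x xi -> unip c c' x xi n -> levi c x xi n.
Proof. by move=> e Hn; split; [exact: unip_GL Hn|exact: uni_blockdiag Hn]. Qed.

End LeviGroup.

(** * Parabolic induction *)

Section LinearOn.
Import Order.TTheory GRing.Theory Num.Theory.
Local Open Scope ring_scope.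
Context {R : realType}.
Local Notation C := R[i].
Implicit Types (U V : lmodType C).

Lemma subspaceD U (W : U -> Prop) u v : subspace W -> W u -> W v -> W (u + v).
Proof. by move=> [_ H] Wu Wv; rewrite -[u]scale1r; exact: H. Qed.

Lemma subspaceZ U (W : U -> Prop) a u : subspace W -> W u -> W (a *: u).
Proof. by move=> [W0 H] Wu; rewrite -[_ *: _]addr0; exact: H. Qed.

Lemma subspace_sum U (W : U -> Prop) (s : seq U) : subspace W ->
  (forall v, v \in s -> W v) -> W (\sum_(v <- s) v).
Proof.
move=> sW; elim: s => [|u s IH] Hs; first by rewrite big_nil; case: sW.
rewrite big_cons; apply: subspaceD => //; first by apply: Hs; rewrite inE eqxx.
by apply: IH => v vs; apply: Hs; rewrite inE vs orbT.
Qed.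

Lemma linear_onD U V (W : U -> Prop) (f : U -> V) u v : linear_on W f -> W u -> W v ->
  f (u + v) = f u + f v.
Proof. by move=> H Wu Wv; rewrite -[u in LHS]scale1r H // scale1r. Qed.

Lemma linear_on0 U V (W : U -> Prop) (f : U -> V) : subspace W -> linear_on W f -> f 0 = 0.
Proof.
by move=> [W0 _] H; apply: (addrI (f 0)); rewrite -(linear_onD H) // !addr0.
Qed.

Lemma linear_onZ U V (W : U -> Prop) (f : U -> V) a u : subspace W -> linear_on W f ->
  W u -> f (a *: u) = a *: f u.
Proof.
move=> sW H Wu; have W0 : W 0 by case: sW.
by rewrite -[_ *: u]addr0 H // (linear_on0 sW H) addr0.
Qed.

Lemma linear_on_sum U V (W : U -> Prop) (f : U -> V) (s : seq U) : subspace W ->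
  linear_on W f -> (forall v, v \in s -> W v) -> f (\sum_(v <- s) v) = \sum_(v <- s) f v.
Proof.
move=> sW H; elim: s => [|u s IH] Hs; first by rewrite !big_nil (linear_on0 sW H).
have Hs' v : v \in s -> W v by move=> vs; apply: Hs; rewrite inE vs orbT.
rewrite !big_cons (linear_onD H) ?IH //; first by apply: Hs; rewrite inE eqxx.
exact: subspace_sum.
Qed.

End LinearOn.

Section Induction.
Import Order.TTheory GRing.Theory Num.Theory.
Local Open Scope ring_scope.
Context {R : realType} {F : localField} {A : divAlg F} {m : nat}.
Local Notation C := R[i].
Implicit Types (c : 'I_m -> 'I_m) (x xi y z g h n l k : 'M[A]_m) (s t : prerep R A m).

Lemma smooth_subrep (L : 'M[A]_m -> Prop) s (W : psp s -> Prop) :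
  smooth_rep L s -> subrep L W -> smooth_rep L (Prerep W (@pact _ _ _ _ s)).
Proof.
move=> [sub lin one mul sm] [sW Wp WL]; split=> /=.
- exact: sW.
- move=> h Lh; split=> [a u v Wu Wv|u]; last exact: WL.
  by have [H _] := lin h Lh; apply: H; exact: Wp.
- by move=> u /Wp; exact: one.
- by move=> h h' u Lh Lh' /Wp; exact: mul.
- by move=> u /Wp; exact: sm.
Qed.

Lemma full_subrep (L : 'M[A]_m -> Prop) s : smooth_rep L s -> subrep L (@pcar _ _ _ _ s).
Proof.
by move=> [sub lin _ _ _]; split=> // h u Lh; have [_] := lin h Lh; exact.
Qed.

(** In the induction in stages, a subrepresentation of an induced representation is itself the
    inducing representation, so its smoothness is required by the lifting argument. *)
Lemma parind_smooth c c' x xi s : inverse_mx x xi -> refines c' c ->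
  smooth_rep (levi c' x xi) s -> smooth_rep (levi c x xi) (parind c c' x xi s).
Proof.
move=> xxi ref [sub lin one mul sm].
have lin0 l : levi c' x xi l -> pact l (0 : psp s) = 0.
  by move=> Ll; have [H _] := lin l Ll; exact: linear_on0 sub H.
split=> /=.
- split=> [|a u v [u0 up uP [Nu Hu]] [v0 vp vP [Nv Hv]]].
    split=> //; first by move=> g; case: sub.
    + by move=> n l g _ Ll _; rewrite lin0 ?scaler0.
    + by exists 0.
  have E g : (a *: u + v) g = a *: u g + v g by [].
  split.
  + by move=> g Lg; rewrite E u0 // v0 // scaler0 addr0.
  + by move=> g; rewrite E; apply: sub.2.
  + move=> n l g Un Ll Lg; rewrite !E uP // vP //.
    have [H _] := lin l Ll; rewrite H // scalerDr !scalerA; congr (_ *: _ + _).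
    by rewrite mulrC.
  + exists (Num.max Nu Nv) => k g Lk Kk Lg; rewrite !E Hu ?Hv //.
      by apply: congrW Kk; rewrite le_max lexx orbT.
    by apply: congrW Kk; rewrite le_max lexx.
- move=> h Lh; split=> [a u v _ _ //|u [u0 up uP [N HN]]].
  have [h' hh'] := Lh.1; have Lh' := leviV xxi hh' Lh.
  have Lgh g : levi c x xi (g *m h) -> levi c x xi g.
    move=> H; have := leviM xxi H Lh'; rewrite -mulmxA; case: hh' => -> _.
    by rewrite mulmx1.
  split.
  + by move=> g Lg; apply: u0 => /Lgh.
  + by move=> g; exact: up.
  + by move=> n l g Un Ll Lg; rewrite -mulmxA uP //; apply: leviM.
  + have [N' HN'] := congr_conj (inverse_mxC hh') N.
    exists N' => k g Lk Kk Lg.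
    have -> : g *m k *m h = (g *m h) *m (h' *m k *m h).
      by rewrite !mulmxA -(mulmxA g h h'); case: hh' => -> _; rewrite mulmx1.
    apply: HN; [|exact: HN'|exact: leviM].
    by apply: leviM => //; apply: leviM.
- by move=> u _; apply/funext => g; rewrite mulmx1.
- by move=> h h' u _ _ _; apply/funext => g; rewrite mulmxA.
- move=> u [u0 _ _ [N HN]]; exists N => h Lh Kh; apply/funext => g.
  case: (pselect (levi c x xi g)) => [Lg|nLg]; first exact: HN.
  rewrite !u0 // => H; apply: nLg; have [h' hh'] := Lh.1.
  have := leviM xxi H (leviV xxi hh' Lh); rewrite -mulmxA; case: hh' => -> _.
  by rewrite mulmx1.
Qed.

End Induction.

(** * Lifting induced functions along a surjection of inducing representations *)

Section Lifting.
Import Order.TTheory GRing.Theory Num.Theory.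
Local Open Scope ring_scope.
Context {R : realType} {F : localField} {A : divAlg F} {m : nat}.
Local Notation C := R[i].
Variables (c0 c : 'I_m -> 'I_m) (x xi : 'M[A]_m).
Hypothesis c0c : forall p q, c0 p = c0 q.
Hypothesis xxi : inverse_mx x xi.
Local Notation L := (levi c x xi).
Local Notation U := (unip c0 c x xi).

Definition half_mod (l : 'M[A]_m) : C := ((sqrt_modulus c0 c (xi *m l *m x) : R)%:C)%C.

Lemma half_modM l l' : L l -> L l' -> half_mod (l *m l') = half_mod l * half_mod l'.
Proof.
by move=> [_ Ll] [_ Ll']; rewrite /half_mod frameM // sqrt_modulusM // rmorphM.
Qed.

Lemma half_mod_neq0 l : L l -> half_mod l != 0.
Proof.
move=> [Gl Ll]; rewrite /half_mod fmorph_eq0 gt_eqF // sqrt_modulus_gt0 //.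
by rewrite GL_frame.
Qed.

(* The elements of L through which the stabilizer of the point P g in the
   right congruence coset g K_N acts. *)
Definition stab N (g l : 'M[A]_m) :=
  L l /\ exists n k, [/\ U n, congr_nbhd N k & n *m l *m g = g *m k].

Lemma c_refines_c0 : refines c c0. Proof. by move=> p q _; exact: c0c. Qed.

Section Stabilizer.
Variables (N : int) (g : 'M[A]_m).
Hypothesis Gg : GL g.
Hypothesis KM : forall k k' : 'M[A]_m, congr_nbhd N k -> congr_nbhd N k' -> congr_nbhd N (k *m k').
Hypothesis KV : forall k k' : 'M[A]_m, congr_nbhd N k -> inverse_mx k k' -> congr_nbhd N k'.
Local Notation stab := (stab N g).

Lemma stab1 : stab 1%:M.
Proof.
split; first exact: levi1.
by exists 1%:M, 1%:M; split; [exact: unip1|exact: congr_nbhd1|rewrite !mul1mx mulmx1].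
Qed.

Lemma stabM l l' : stab l -> stab l' -> stab (l *m l').
Proof.
move=> [Ll [n [k [Un Kk e]]]] [Ll' [n' [k' [Un' Kk' e']]]]; split; first exact: leviM.
have [li lli] := Ll.1.
exists (n *m (l *m n' *m li)), (k *m k'); split; [|exact: KM|].
  by apply: unipM => //; apply: unip_conj lli Ll Un' => //; exact: c_refines_c0.
have -> : n *m (l *m n' *m li) *m (l *m l') *m g = n *m l *m (n' *m l' *m g).
  by rewrite !mulmxA -(mulmxA _ li l); case: lli => _ ->; rewrite mulmx1.
by rewrite e' mulmxA e mulmxA.
Qed.

Lemma stabV l l' : inverse_mx l l' -> stab l -> stab l'.
Proof.
move=> ll' [Ll [n [k [Un Kk e]]]]; have Ll' := leviV xxi ll' Ll; split=> //.
have [n' Un' nn'] := unipV xxi Un; have [k' kk'] := Kk.1.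
exists (l' *m n' *m l), k'; split; [|exact: KV Kk kk'|].
  by apply: (unip_conj (xi := xi) _ _ (inverse_mxC ll') Ll' Un') => //; exact: c_refines_c0.
have [kk1 _] := kk'; have [ll1 ll2] := ll'; have [_ nn2] := nn'.
have eg : g = n *m l *m g *m k' by rewrite e -mulmxA kk1 mulmx1.
rewrite -(mulmxA (l' *m n') l l') ll1 mulmx1 {1}eg !mulmxA.
by rewrite -(mulmxA l' n' n) nn2 mulmx1 ll2 mul1mx.
Qed.

(** The product n l = g k g^-1 stays in a bounded set, and has the same diagonal blocks as l. *)
Lemma stab_bounded : exists B, forall l, stab l -> mge B (xi *m l *m x).
Proof.
have [gi ggi] := Gg; have [e Me] := @mgeM F A m.
have [B1 HB1] := @congr_bounded F A m N.
have [B2 HB2] := mge_ex (xi *m g); have [B3 HB3] := mge_ex (gi *m x).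
exists (B2 + B1 - e + B3 - e) => l [[Gl Ll] [n [k [Un Kk eq]]]] p q i.
case: (eqVneq (c p) (c q)) => [cpq|cpq]; last by rewrite Ll // linear0 vge0.
rewrite -(uni_mul_block Un Ll cpq) -frameM //.
have -> : n *m l = g *m k *m gi by rewrite -eq -mulmxA; case: ggi => -> _; rewrite mulmx1.
have -> : xi *m (g *m k *m gi) *m x = (xi *m g) *m k *m (gi *m x) by rewrite !mulmxA.
exact: (Me _ _ _ _ (Me _ _ _ _ HB2 (HB1 k Kk)) HB3).
Qed.

(** The stabilizer is a bounded group, so [sqrt_modulus_bounded] applies to its conjugate by [x]. *)
Lemma stab_half_mod l : stab l -> half_mod l = 1.
Proof.
move=> Sl; rewrite /half_mod.
rewrite (@sqrt_modulus_bounded R F A m c0 c (fun y => exists2 l, stab l & y = xi *m l *m x)) //.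
- by move=> _ [l' [[_ Ll'] _] ->].
- move=> _ _ [l1 S1 ->] [l2 S2 ->]; exists (l1 *m l2); last by rewrite frameM.
  exact: stabM.
- move=> _ [l1 S1 ->]; have [l2 ll2] := S1.1.1; exists (xi *m l2 *m x).
    by exists l2 => //; exact: (stabV ll2).
  by case: (frameV xxi ll2).
- by have [B HB] := stab_bounded; exists B => _ [l1 S1 ->]; exact: HB.
- by exists l.
Qed.

(* w is the average of the orbit of w0, which is finite since the stabilizer is
   bounded and a bounded set of matrices is finite modulo a lattice. *)
Lemma invariant_lift (s t : prerep R A m) (f : psp s -> psp t) w0 :
  smooth_rep L s -> linear_on (@pcar _ _ _ _ s) f ->
  (forall l u, L l -> pcar u -> f (pact l u) = pact l (f u)) ->
  pcar w0 -> (forall l, stab l -> pact l (f w0) = f w0) ->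
  exists w, [/\ pcar w, f w = f w0 & forall l, stab l -> pact l w = w].
Proof.
move=> [sub lin one mul sm] flin feq pw0 fw0.
have [N' HN'] := sm w0 pw0.
have LS l : stab l -> L l by case.
have [B HB] := stab_bounded.
have [e Me] := @mgeM F A m; have [B1 HB1] := mge_ex x; have [B2 HB2] := mge_ex xi.
(* li l' - 1 is a product of four factors, of levels B1, B, y and B2. Three multiplications cost [e]
   each, so this [y] yields level N'. *)
pose y := N' - B1 - B - B2 + e + e + e.
have [I [dig Hd]] := @digits_mx F A m B y.
have orbP l l' : stab l -> stab l' -> dig (xi *m l *m x) = dig (xi *m l' *m x) ->
    pact l' w0 = pact l w0.
  move=> Sl Sl' edig; have [li lli] := Sl.1.1.
  have Sli := stabV lli Sl.
  have -> : l' = l *m (li *m l') by rewrite mulmxA; case: lli => -> _; rewrite mul1mx.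
  have Lq : L (li *m l') by apply: leviM => //; apply: LS.
  suff Kq : congr_nbhd N' (li *m l') by rewrite (mul _ _ _ (LS l Sl) Lq pw0) (HN' _ Lq Kq).
  split; first exact: Lq.1.
  have -> : li *m l' - 1%:M = x *m (xi *m li *m x) *m (xi *m l' *m x - xi *m l *m x) *m xi.
    rewrite -mulmxBl -mulmxBr.
    rewrite -(mulmxA x) -(frameM _ _ xxi) (frameK _ xxi) mulmxBr.
    by case: lli => _ ->.
  have Hdd := Hd _ _ (HB _ Sl') (HB _ Sl) (esym edig).
  have := Me _ _ _ _ (Me _ _ _ _ (Me _ _ _ _ HB1 (HB _ Sli)) Hdd) HB2.
  by apply: mgeW; rewrite /y; clear; lia.
have wpos l : L l -> pcar (pact l w0) by move=> Ll; have [_] := lin l Ll; exact.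
(* One orbit vector for each digit value, which makes the orbit finite. The default [w0] is an orbit
   vector as well. *)
pose fd (d : I) : psp s := if pselect (exists2 l, stab l & dig (xi *m l *m x) = d) is left H
  then pact (projT1 (cid2 H)) w0 else w0.
pose O := undup [seq fd d | d <- enum I].
have OP v : v \in O <-> exists2 l, stab l & v = pact l w0.
  rewrite mem_undup; split=> [/mapP[d _ ->]|[l Sl ->]].
    rewrite /fd; case: pselect => [H|_]; last by exists 1%:M; [exact: stab1|rewrite one].
    by case: (cid2 H) => l Sl _ /=; exists l.
  apply/mapP; exists (dig (xi *m l *m x)); first by rewrite mem_enum.
  rewrite /fd; case: pselect => [H|[]]; last by exists l.
  by case: (cid2 H) => l' Sl' el' /=; apply: orbP.
have Opcar v : v \in O -> pcar v by move=> /OP[l Sl ->]; apply/wpos/LS.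
have act_perm l : stab l -> perm_eq [seq pact l v | v <- O] O.
  move=> Sl; have [li lli] := Sl.1.1; have Sli := stabV lli Sl.
  have actK v : v \in O -> pact li (pact l v) = v.
    move=> /Opcar pv; rewrite -mul //; [|exact: LS|exact: LS].
    by case: lli => _ ->; rewrite one.
  apply: uniq_perm; last 2 [exact: undup_uniq].
  - rewrite map_inj_in_uniq ?undup_uniq // => v v' Ov Ov' evv.
    by rewrite -[v]actK // -[v']actK // evv.
  move=> v; apply/mapP/idP => [[u /OP[l1 S1 ->] ->]|/OP[l1 S1 ->]].
    apply/OP; exists (l *m l1); first exact: stabM.
    by rewrite mul //; exact: LS.
  exists (pact (li *m l1) w0); last first.
    rewrite -mul //; [|exact: LS|apply: leviM => //; exact: LS].
    by rewrite mulmxA; case: lli => -> _; rewrite mul1mx.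
  by apply/OP; exists (li *m l1) => //; exact: stabM.
have sz0 : (size O)%:R != 0 :> C.
  rewrite pnatr_eq0 size_eq0; apply/eqP => O0.
  have : w0 \in O by apply/OP; exists 1%:M; [exact: stab1|rewrite one].
  by rewrite O0.
have pS : pcar (\sum_(v <- O) v) by apply: subspace_sum.
exists ((size O)%:R^-1 *: \sum_(v <- O) v); split.
- exact: subspaceZ.
- rewrite (linear_onZ _ sub flin) // (linear_on_sum sub flin) //.
  have -> : \sum_(v <- O) f v = \sum_(v <- O) f w0.
    rewrite big_seq [RHS]big_seq; apply: eq_bigr => v /OP[l Sl ->].
    by rewrite feq ?fw0 //; exact: LS.
  by rewrite big_const_seq count_predT iter_addr_0 -[f w0 *+ _]scaler_nat scalerA mulVf // scale1r.
- move=> l Sl; have [lin_l _] := lin l (LS _ Sl).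
  rewrite (linear_onZ _ sub lin_l) // (linear_on_sum sub lin_l) //; congr (_ *: _).
  by rewrite -(big_map (pact l) xpredT id); apply: perm_big; exact: act_perm.
Qed.

End Stabilizer.

(* psi is determined by its values at representatives of the double cosets
   P g K_N, which can be any lifts fixed by the stabilizers. *)
Lemma parind_lift (s t : prerep R A m) (f : psp s -> psp t) :
  smooth_rep L s -> linear_on (@pcar _ _ _ _ s) f ->
  (forall l u, L l -> pcar u -> f (pact l u) = pact l (f u)) ->
  (forall v, pcar v -> exists2 u, pcar u & f u = v) ->
  forall phi, @pcar _ _ _ _ (parind c0 c x xi t) phi ->
  exists2 psi, @pcar _ _ _ _ (parind c0 c x xi s) psi & forall g, f (psi g) = phi g.
Proof.
move=> ss flin feq fsurj phi [phi0 phip phiP [N1 HN1]].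
have [sub lin one mul sm] := ss.
have [N2 HN2] := @congr_nbhd_group F A m.
pose N := Num.max N1 N2.
have [KM KV] :
  (forall k k' : 'M[A]_m, congr_nbhd N k -> congr_nbhd N k' -> congr_nbhd N (k *m k')) /\
  (forall k k' : 'M[A]_m, congr_nbhd N k -> inverse_mx k k' -> congr_nbhd N k').
  by apply: HN2; rewrite le_max lexx orbT.
have cref : refines c c0 := c_refines_c0.
pose E (g g' : 'M[A]_m) := exists n l k, [/\ U n, L l, congr_nbhd N k & g = n *m l *m g' *m k].
have Erefl g : E g g.
  exists 1%:M, 1%:M, 1%:M; split; [exact: unip1|exact: levi1|exact: congr_nbhd1|].
  by rewrite !mul1mx mulmx1.
have Emul n l g g' : U n -> L l -> E g g' -> E (n *m l *m g) g'.
  move=> Un Ll [n' [l' [k [Un' Ll' Kk ->]]]]; have [li lli] := Ll.1.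
  exists (n *m (l *m n' *m li)), (l *m l'), k; split=> //.
  - by apply: unipM => //; exact: unip_conj lli Ll Un'.
  - exact: leviM.
  - by rewrite !mulmxA -(mulmxA _ li l); case: lli => _ ->; rewrite mulmx1.
have Etrans g g' g'' : E g g' -> E g' g'' -> E g g''.
  move=> [n [l [k [Un Ll Kk ->]]]] Eg.
  have [n' [l' [k' [Un' Ll' Kk' ->]]]] := Emul _ _ _ _ Un Ll Eg.
  by exists n', l', (k' *m k); split=> //; [exact: KM|rewrite !mulmxA].
have Esym g g' : E g g' -> E g' g.
  move=> [n [l [k [Un Ll Kk eg]]]]; have [n' Un' nn'] := unipV xxi Un.
  have [l' ll'] := Ll.1; have Ll' := leviV xxi ll' Ll.
  have [k' kk'] := Kk.1.
  exists (l' *m n' *m l), l', k'; split=> //; last 1 first.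
  - rewrite eg -!mulmxA; case: kk' => -> _; rewrite mulmx1.
    rewrite (mulmxA l l'); case: (ll') => -> _; rewrite mul1mx.
    rewrite (mulmxA n' n); case: nn' => _ ->; rewrite mul1mx mulmxA.
    by case: ll' => _ ->; rewrite mul1mx.
  - exact: unip_conj (inverse_mxC ll') Ll' Un'.
  - exact: KV Kk kk'.
(* The result of [choose] depends on the predicate and not on the starting point, so [rep] is
   constant on each class of [E]. *)
pose rep (g : 'M[A]_m) := choose (fun g' => `[< E g g' >]) g.
have repE g : E g (rep g).
  by apply/asboolP; apply: (@chooseP _ (fun g' => `[< E g g' >])); apply/asboolP.
have rep_eq g g' : E g g' -> rep g = rep g'.
  move=> Egg'; rewrite /rep.
  have eP : (fun h => `[< E g h >]) =1 (fun h => `[< E g' h >]).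
    move=> h; apply/asbool_equiv_eq; split=> H; last exact: Etrans Egg' H.
    exact: Etrans (Esym _ _ Egg') H.
  rewrite (eq_choose eP); apply: choose_id; apply/asboolP => //.
  exact: Esym.
have GLE g g' : E g g' -> GL g -> GL g'.
  move=> /Esym[n [l [k [Un Ll Kk ->]]]] Gg; apply: GLM Kk.1; apply: GLM Gg.
  by apply: GLM Ll.1; exact: unip_GL Un.
have L0 g : GL g <-> levi c0 x xi g by rewrite levi_const.
have /choice[w wP] : forall g, exists w, GL g ->
    [/\ pcar w, f w = phi g & forall l, stab N g l -> pact l w = w].
  move=> g; case: (pselect (GL g)) => [Gg|nG]; last by exists 0.
  have [w0 pw0 fw0] := fsurj _ (phip g).
  have [|w [pw fw Hw]] := invariant_lift Gg KM KV ss flin feq pw0; last first.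
    by exists w => _; split=> //; rewrite fw.
  (* From n l g = g k one gets phi g = phi (g k) = delta^(1/2)(l) l (phi g), where the modulus is 1:
     the values of phi satisfy the invariance that the lift needs. *)
  move=> l Sl; have [Ll [n [k [Un Kk e]]]] := Sl.
  rewrite fw0; have := phiP n l g Un Ll ((L0 g).1 Gg).
  rewrite -/(half_mod l) (stab_half_mod Gg KM KV Sl) scale1r => <-.
  rewrite e HN1 //; [exact/L0/Kk.1| |exact/L0].
  by apply: congrW Kk; rewrite le_max lexx.
pose ta l v : psp s := half_mod l *: pact l v.
(* Any decomposition of g dictates the value there. Two decompositions differ by li l', an element
   of the stabilizer at [rep g], and this fixes the chosen lift. *)
have /choice[psi psiP] : forall g, exists v, (~ GL g -> v = 0) /\
    (GL g -> forall n l k, U n -> L l -> congr_nbhd N k -> g = n *m l *m rep g *m k ->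
       v = ta l (w (rep g))).
  move=> g; case: (pselect (GL g)) => [Gg|nG]; last by exists 0; split.
  have [n [l [k [Un Ll Kk eg]]]] := repE g.
  exists (ta l (w (rep g))); split=> // _ n' l' k' Un' Ll' Kk' eg'.
  have Gr := GLE _ _ (repE g) Gg.
  have [li lli] := Ll.1; have Lli := leviV xxi lli Ll.
  have Llil : L (li *m l') by exact: leviM.
  have [ni Uni nni] := unipV xxi Un; have [k'i kki] := Kk'.1.
  have Sq : stab N (rep g) (li *m l').
    split; first exact: leviM.
    exists (li *m (ni *m n') *m l), (k *m k'i); split.
    - by apply: (unip_conj (xi := xi) _ _ (inverse_mxC lli) Lli) => //; exact: unipM.
    - by apply: KM => //; exact: KV kki.
    have e1 : n' *m l' *m rep g = n *m l *m rep g *m (k *m k'i).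
      have e2 : n' *m l' *m rep g *m k' = n *m l *m rep g *m k by rewrite -eg' -eg.
      by rewrite [RHS]mulmxA -e2 -[RHS]mulmxA; case: kki => -> _; rewrite mulmx1.
    rewrite -(mulmxA _ l) (mulmxA l li); case: (lli) => -> _; rewrite mul1mx.
    rewrite -!mulmxA (mulmxA n') e1 !mulmxA -(mulmxA li ni); case: nni => _ ->.
    by rewrite mulmx1; case: (lli) => _ ->; rewrite mul1mx.
  have [pw _ wS] := wP _ Gr.
  have -> : l' = l *m (li *m l') by rewrite mulmxA; case: lli => -> _; rewrite mul1mx.
  rewrite /ta half_modM // (stab_half_mod Gr KM KV Sq) mulr1.
  by rewrite (mul _ _ _ Ll Llil pw) (wS _ Sq).
have psi_ex g : GL g -> exists n l k, [/\ U n, L l, congr_nbhd N k, g = n *m l *m rep g *m k &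
    psi g = ta l (w (rep g))].
  move=> Gg; have [n [l [k [Un Ll Kk eg]]]] := repE g.
  by exists n, l, k; split=> //; apply: (psiP g).2 eg.
have wG g : GL g -> [/\ pcar (w (rep g)), f (w (rep g)) = phi (rep g)
    & forall l, stab N (rep g) l -> pact l (w (rep g)) = w (rep g)].
  by move=> Gg; apply: wP; apply: GLE (repE g) Gg.
have pact_pcar l (v : psp s) : L l -> pcar v -> pcar (pact l v).
  by move=> Ll pv; have [_ H] := lin l Ll; exact: H.
exists psi.
  split.
  - by move=> g nL; apply: (psiP g).1 => /L0.
  - move=> g; case: (pselect (GL g)) => [Gg|nG]; last by rewrite (psiP g).1 //; case: sub.
    have [n [l [k [_ Ll _ _ ->]]]] := psi_ex g Gg; have [pw _ _] := wG g Gg.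
    by apply: subspaceZ => //; apply: pact_pcar.
  - move=> n l g Un Ll /L0 Gg.
    have [n' [l' [k [Un' Ll' Kk eg ->]]]] := psi_ex g Gg.
    have [li lli] := Ll.1.
    have er : rep (n *m l *m g) = rep g by apply: rep_eq; exact: Emul.
    have Gnlg : GL (n *m l *m g) by apply: GLM Gg; apply: GLM Ll.1; exact: unip_GL Un.
    rewrite ((psiP _).2 Gnlg (n *m (l *m n' *m li)) (l *m l') k) //; first last.
    + rewrite er {1}eg !mulmxA -(mulmxA _ li l); case: lli => _ ->; by rewrite mulmx1.
    + exact: leviM.
    + by apply: unipM => //; exact: unip_conj lli Ll Un'.
    rewrite er /ta half_modM // -scalerA; congr (_ *: _).
    have [pw _ _] := wG g Gg; rewrite mul //.
    have [linl _] := lin l Ll; rewrite (linear_onZ _ sub linl) //.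
    exact: pact_pcar.
  - exists N => k g _ Kk /L0 Gg.
    have er : rep (g *m k) = rep g.
      apply: rep_eq; exists 1%:M, 1%:M, k; split=> //; [exact: unip1|exact: levi1|].
      by rewrite !mul1mx.
    have [n' [l' [k' [Un' Ll' Kk' eg ->]]]] := psi_ex g Gg.
    rewrite ((psiP _).2 _ n' l' (k' *m k)) ?er //; first exact: GLM Gg Kk.1.
      exact: KM.
    by rewrite {1}eg !mulmxA.
move=> g; case: (pselect (GL g)) => [Gg|nG]; last first.
  rewrite (psiP g).1 // (linear_on0 sub flin) phi0 // => /L0; exact: nG.
have [n [l [k [Un Ll Kk eg ->]]]] := psi_ex g Gg; have [pw fw _] := wG g Gg.
have Gr := GLE _ _ (repE g) Gg.
rewrite /ta (linear_onZ _ sub flin); last exact: pact_pcar.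
rewrite feq // fw -(phiP n l _ Un Ll ((L0 _).1 Gr)).
have KN1 : congr_nbhd N1 k by apply: congrW Kk; rewrite le_max lexx.
have Lr : levi c0 x xi (n *m l *m rep g).
  by apply/L0; apply: GLM Gr; apply: GLM Ll.1; exact: unip_GL Un.
by rewrite [in RHS]eg (HN1 _ _ ((L0 _).1 Kk.1) KN1 Lr).
Qed.

End Lifting.

(** * Induction in stages *)

Section Stages.
Import Order.TTheory GRing.Theory Num.Theory.
Local Open Scope ring_scope.
Context {R : realType} {F : localField} {A : divAlg F} {m : nat}.
Local Notation C := R[i].
Variables (c0 c c' : 'I_m -> 'I_m) (x xi : 'M[A]_m).
Hypothesis c0c : forall p q, c0 p = c0 q.
Hypothesis lex : lexicographic c c'.
Hypothesis xxi : inverse_mx x xi.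
Local Notation L := (levi c x xi).
Local Notation delta := (@half_mod R F A m c0 c x xi).

Lemma unip_decomp n : unip c0 c' x xi n ->
  exists n1 n2, [/\ unip c0 c x xi n1, unip c c' x xi n2 & n = n1 *m n2].
Proof.
move=> /(uni_decomp c0c lex)[y1 [y2 [H1 H2 e]]].
exists (x *m y1 *m xi), (x *m y2 *m xi); split.
- by rewrite unipE (frameK y1 (inverse_mxC xxi)).
- by rewrite unipE (frameK y2 (inverse_mxC xxi)).
by rewrite -(frameM _ _ (inverse_mxC xxi)) -e frameK.
Qed.

Lemma half_mod_unip n : unip c c' x xi n -> delta n = 1.
Proof.
move=> Hn; rewrite /half_mod (@sqrt_modulus_unitriangular R F A m c0 c _ (fun p => c' p)) //.
  by move=> p; rewrite Hn ?uni_relxx ?eqxx // ltnn andbF.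
move=> p q pq; apply: contra_neqT => npq; rewrite Hn ?(negPf pq) //.
by apply: contra npq => /andP[].
Qed.

(* [hat u g l] is delta_P(l)^(-1/2) u(l g): induction in stages identifies u with
   g |-> hat u g. *)
Lemma parind_stages (s t p : prerep R A m) (W : psp (parind c c' x xi s) -> Prop) :
  smooth_rep (levi c' x xi) s -> subrep L W -> image_of L t W ->
  quotient_rep (@GL F A m) (parind c0 c x xi t) p ->
  subquotient (@GL F A m) (parind c0 c' x xi s) p.
Proof.
move=> ss subW [f [flin fpcar fsurj feq]] [q [qlin qpcar qsurj qeq]].
have [ref lt_c] := lex.
have ref0 : refines c c0 := c_refines_c0 c0c.
have ref0' : refines c' c0 by move=> ? ? _; exact: c0c.
have sind := parind_smooth xxi ref ss.
have ssW := smooth_subrep sind subW.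
have sind0 := parind_smooth xxi ref0' ss.
have [subs lins ones _ _] := ss.
have [sW Wp WL] := subW.
have W0 : W 0 by case: sW.
have L0 g : GL g <-> levi c0 x xi g by rewrite levi_const.
pose hat (u : 'M[A]_m -> psp s) (g l : 'M[A]_m) : psp s :=
  if pselect (L l) then (delta l)^-1 *: u (l *m g) else 0.
have hatL u g l : L l -> hat u g l = (delta l)^-1 *: u (l *m g).
  by rewrite /hat; case: pselect.
have hatN u g l : ~ L l -> hat u g l = 0 by rewrite /hat; case: pselect.
have hat_lin a u v g : hat (a *: u + v) g = a *: hat u g + hat v g.
  apply/funext => l; case: (pselect (L l)) => [Ll|nL].
    rewrite [RHS](_ : _ = a *: hat u g l + hat v g l) // !hatL //.
    by rewrite scalerDr !scalerA [a * _]mulrC.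
  by rewrite [RHS](_ : _ = a *: hat u g l + hat v g l) // !hatN // scaler0 addr0.
have hat0 g : hat 0 g = 0.
  by have := hat_lin (-1) 0 0 g; rewrite !scaleN1r !addNr.
have hat_act h u g : hat (fun k => u (k *m h)) g = hat u (g *m h).
  apply/funext => l; case: (pselect (L l)) => [Ll|nL]; last by rewrite !hatN.
  by rewrite !hatL // mulmxA.
have GLl g l : L l -> GL (l *m g) -> GL g.
  move=> Ll [h [h1 h2]]; have [li lli] := Ll.1; exists (h *m l); split; last first.
    by rewrite -mulmxA.
  have -> : g = li *m (l *m g) by rewrite mulmxA; case: lli => _ ->; rewrite mul1mx.
  by rewrite !mulmxA -(mulmxA li) -(mulmxA li) h1 mulmx1; case: lli.
have hat_off u g : (forall g, ~ levi c0 x xi g -> u g = 0) -> ~ GL g -> hat u g = 0.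
  move=> u0 nG; apply/funext => l; case: (pselect (L l)) => [Ll|nL]; last by rewrite hatN.
  by rewrite hatL // u0 ?scaler0 // => /L0/(GLl _ _ Ll).
(* The functions whose normalized restrictions to the cosets L g belong to W; on these, f can be
   applied coset by coset. *)
pose W' (u : psp (parind c0 c' x xi s)) := pcar u /\ forall g, W (hat u g).
exists W'.
  split.
  - split=> [|a u v [pu Wu] [pv Wv]].
      by split; [have [[]] := sind0 | move=> g; rewrite hat0].
    split; first by have [[_ H] _ _ _ _] := sind0; apply: H.
    by move=> g; rewrite hat_lin; apply: sW.2.
  - by move=> u [].
  - move=> h u Gh [pu Wu]; split; last by move=> g; rewrite /= hat_act.
    by have [_ H _ _ _] := sind0; have [_] := H h ((L0 h).1 Gh); apply.
pose phi (u : 'M[A]_m -> psp s) (g : 'M[A]_m) : psp t := f (hat u g).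
have phiP u : W' u -> @pcar _ _ _ _ (parind c0 c x xi t) (phi u).
  move=> [[u0 up uP [N HN]] Wu]; split.
  - by move=> g nL; rewrite /phi hat_off ?(linear_on0 sW flin) // => /L0.
  - by move=> g; apply: fpcar.
  - move=> n l g Un Ll Lg; rewrite /phi.
    have -> : hat u (n *m l *m g) = delta l *: @pact _ _ _ _ (parind c c' x xi s) l (hat u g).
      apply/funext => l'.
      rewrite [RHS](_ : _ = delta l *: hat u g (l' *m l)) //.
      case: (pselect (L l')) => [Ll'|nL]; last first.
        rewrite !hatN ?scaler0 // => H; apply: nL; have [li lli] := Ll.1.
        have := leviM xxi H (leviV xxi lli Ll); rewrite -mulmxA; case: lli => -> _.
        by rewrite mulmx1.
      have Lll : L (l' *m l) by exact: leviM.
      rewrite !hatL // scalerA.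
      have [li' lli'] := Ll'.1.
      (* l' normalizes the radical of [c], which is contained in that of [c']; so u is insensitive
         to the first factor. *)
      have -> : l' *m (n *m l *m g) = (l' *m n *m li') *m 1%:M *m (l' *m l *m g).
        by rewrite mulmx1 !mulmxA -(mulmxA _ li' l'); case: lli' => _ ->; rewrite mulmx1.
      rewrite uP; first last.
      + by apply/L0; apply: GLM; [exact: Lll.1|exact/L0].
      + exact: levi1.
      + have := unip_conj xxi ref0 lli' Ll' Un; rewrite !unipE => H.
        exact: uni_sub c0c lex H.
      rewrite frame1 // sqrt_modulus1 scale1r ones // half_modM // invfM mulrCA divff ?mulr1 //.
      exact: half_mod_neq0.
    rewrite (linear_onZ _ sW flin); last exact: WL.
    by rewrite feq.
  - exists N => k g Lk Kk Lg; rewrite /phi; congr f; apply/funext => l.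
    case: (pselect (L l)) => [Ll|nL]; last by rewrite !hatN.
    by rewrite !hatL // mulmxA HN //; apply/L0; apply: GLM Ll.1 _; exact/L0.
exists (fun u => q (phi u)); split.
- move=> a u v Wu Wv.
  have -> : phi (a *: u + v) = a *: phi u + phi v.
    apply/funext => g; rewrite /phi hat_lin flin //; [exact: Wu.2|exact: Wv.2].
  by rewrite qlin //; apply: phiP.
- by move=> u Wu; apply/qpcar/phiP.
- move=> v pv; have [phi0 pphi0 <-] := qsurj v pv.
  (* The source of the surjection is W with the action of the inner induced representation. *)
  have [psi [psi0 psip psiP [N HN]] fpsi] :=
    @parind_lift R F A m c0 c x xi c0c xxi
      (Prerep W (@pact R F A m (parind c c' x xi s))) t f ssW flin feq fsurj phi0 pphi0.
  (* Evaluation at 1 is the inverse of [hat]; this is [hatu] below. *)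
  pose u (g : 'M[A]_m) : psp s := psi g 1%:M.
  have psi_pcar g : @pcar _ _ _ _ (parind c c' x xi s) (psi g) by exact/Wp/psip.
  have pu : @pcar _ _ _ _ (parind c0 c' x xi s) u.
    split.
    + by move=> g nL; rewrite /u psi0.
    + by move=> g; have [_ H _ _] := psi_pcar g; apply: H.
    + move=> n l g /unip_decomp[n1 [n2 [U1 U2 ->]]] Ll Lg; rewrite /u.
      have Ll1 : L l := levi_refines ref Ll.
      have Ln2 : L n2 := unip_levi xxi U2.
      have Ln2l : L (n2 *m l) by exact: leviM.
      have -> : n1 *m n2 *m l *m g = n1 *m (n2 *m l) *m g by rewrite !mulmxA.
      rewrite (psiP n1 (n2 *m l) g U1 Ln2l Lg).
      change ((delta (n2 *m l) *: @pact _ _ _ _ (parind c c' x xi s) (n2 *m l) (psi g)) 1%:M =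
        (sqrt_modulus c0 c' (xi *m l *m x) : R)%:C%C *: pact l (psi g 1%:M)).
      have -> : delta (n2 *m l) = delta l.
        by rewrite half_modM // (half_mod_unip U2) mul1r.
      (* The inner action is right translation, so after evaluation at 1 the element n2 l becomes
         the argument, where equivariance of [psi g] under the radical and Levi of [c'] applies. *)
      change (delta l *: psi g (1%:M *m (n2 *m l)) =
        (sqrt_modulus c0 c' (xi *m l *m x) : R)%:C%C *: pact l (psi g 1%:M)).
      have [_ _ H _] := psi_pcar g.
      rewrite mul1mx -[n2 *m l]mulmx1 H //; last exact: levi1.
      have -> : (sqrt_modulus c0 c' (xi *m l *m x) : R)%:C%C =
          delta l * (sqrt_modulus c c' (xi *m l *m x) : R)%:C%C.
        rewrite (sqrt_modulus_trans c0c ref lt_c) ?rmorphM //; last by case: Ll.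
        by rewrite (GL_frame _ xxi); case: Ll.
      by rewrite scalerA.
    + by exists N => k g Lk Kk Lg; rewrite /u HN.
  have hatu g : hat u g = psi g.
    case: (pselect (GL g)) => [Gg|nG]; last first.
      by rewrite hat_off // ?psi0 // => [/L0 //|g' nL]; rewrite /u psi0.
    apply/funext => l; case: (pselect (L l)) => [Ll|nL]; last first.
      by rewrite hatN //; have [H _ _ _] := psi_pcar g; rewrite H.
    have U1 : unip c0 c x xi 1%:M by exact: unip1.
    have := psiP 1%:M l g U1 Ll ((L0 g).1 Gg); rewrite mul1mx.
    rewrite hatL // /u => ->; rewrite -/(delta l).
    rewrite [LHS](_ : _ = (delta l)^-1 *: (delta l *: psi g (1%:M *m l))) //.
    by rewrite mul1mx scalerA mulVf ?scale1r //; exact: half_mod_neq0.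
  exists u; first by split=> // g; rewrite hatu; exact: psip.
  by congr q; apply/funext => g; rewrite /phi hatu fpsi.
- move=> h u Gh Wu; rewrite -qeq //; last exact: phiP.
  by congr q; apply/funext => g; rewrite /phi /= hat_act.
Qed.

End Stages.

(** * Changing the presentation of a Levi subgroup *)

Section Presentations.
Import Order.TTheory GRing.Theory Num.Theory.
Local Open Scope ring_scope.
Context {R : realType} {F : localField} {A : divAlg F} {m : nat}.
Local Notation C := R[i].
Implicit Types (c : 'I_m -> 'I_m) (x xi y z g h n l : 'M[A]_m).

(** The ambient space and the right translations do not involve the presentation, so only the
    carrier predicates have to be compared. This yields an equality. *)
Lemma eq_parind c1 c1' x1 xi1 c2 c2' x2 xi2 (s : prerep R A m) :
  (forall h, levi c1 x1 xi1 h <-> levi c2 x2 xi2 h) ->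
  (forall h, levi c1' x1 xi1 h <-> levi c2' x2 xi2 h) ->
  (forall h, unip c1 c1' x1 xi1 h <-> unip c2 c2' x2 xi2 h) ->
  (forall h, levi c1' x1 xi1 h ->
     sqrt_modulus c1 c1' (xi1 *m h *m x1) = sqrt_modulus c2 c2' (xi2 *m h *m x2) :> R) ->
  parind c1 c1' x1 xi1 s = parind c2 c2' x2 xi2 s.
Proof.
move=> e e' eu em; rewrite /parind; congr Prerep; apply/funext => f; apply/propext.
split=> -[H1 H2 H3 [N HN]]; split.
- by move=> g H; apply: H1 => /e.
- exact: H2.
- move=> n l g Un Ll Lg; have Ll1 := (e' l).2 Ll.
  by rewrite (H3 n l g ((eu n).2 Un) Ll1 ((e g).2 Lg)) (em l Ll1).
- by exists N => k g /e Lk Kk /e Lg; apply: HN.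
- by move=> g H; apply: H1 => /e.
- exact: H2.
- move=> n l g Un Ll Lg; have Ll1 := (e' l).1 Ll.
  by rewrite (H3 n l g ((eu n).1 Un) Ll1 ((e g).1 Lg)) (em l Ll).
- by exists N => k g /e Lk Kk /e Lg; apply: HN.
Qed.

Definition same_classes c c2 := forall p q, (c p == c q) = (c2 p == c2 q).

Lemma same_classes_levi c c2 x xi h : same_classes c c2 -> levi c x xi h <-> levi c2 x xi h.
Proof. by move=> e; split=> -[Gh H]; split=> // p q; [rewrite -e|rewrite e]; exact: H. Qed.

Lemma parind_relabel c1 c1' c2 c2' x xi (s : prerep R A m) :
  same_classes c1 c2 -> same_classes c1' c2' ->
  (forall p q, c1 p = c1 q -> (c1' p < c1' q)%N = (c2' p < c2' q)%N) ->
  parind c1 c1' x xi s = parind c2 c2' x xi s.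
Proof.
move=> e e' lt; apply: eq_parind.
- by move=> h; exact: same_classes_levi.
- by move=> h; exact: same_classes_levi.
- move=> h; have E p q : uni_rel c1 c1' p q = uni_rel c2 c2' p q.
    by rewrite /uni_rel /= -e; case: (eqVneq (c1 p) (c1 q)) => //= /lt.
  by split=> H p q; [rewrite -[X in ~~ X]E|rewrite -[X in ~~ X]/(uni_rel c1 c1' p q) E]; exact: H.
- by move=> h _; apply: eq_sqrt_modulus.
Qed.

Lemma transports_inv c c2 g h : inverse_mx g h -> transports c c2 g -> transports c2 c h.
Proof.
move=> [gh hg] tr q p hqp; apply/esym.
have /matrixP/(_ q p) : indic_mx (fun p0 => c p0 == c q) *m h =
    h *m indic_mx (fun p0 => c2 p0 == c q).
  rewrite -[LHS]mul1mx -hg -mulmxA (mulmxA g) (transports_indic (c q) tr).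
  by rewrite -!mulmxA gh mulmx1.
rewrite mul_indic indic_mul eqxx; case: eqP => // _ e.
by rewrite e eqxx in hqp.
Qed.

Lemma transports_blockdiag c c2 g h y : inverse_mx g h -> transports c c2 g ->
  blockdiag c y -> blockdiag c2 (g *m y *m h).
Proof.
move=> gh tr /blockdiagP Hy; apply/blockdiagP => a; apply/separatesP.
have /separatesP Ha := Hy a; have tr' := transports_inv gh tr.
rewrite !mulmxA -(transports_indic a tr) -(mulmxA g) Ha.
by rewrite -[RHS]mulmxA (transports_indic a tr') !mulmxA.
Qed.

Lemma transports_uni c0 c0' c c2 g h n :
  (forall p q, c0 p = c0 q) -> (forall p q, c0' p = c0' q) ->
  inverse_mx g h -> transports c c2 g -> uni c0 c n -> uni c0' c2 (g *m n *m h).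
Proof.
move=> e0 e0' gh tr; have tr' := transports_inv gh tr; rewrite !uniP => Hn.
have -> : g *m n *m h - 1%:M = g *m (n - 1%:M) *m h.
  by case: gh => gh _; rewrite mulmxBr mulmx1 mulmxBl gh.
move=> p q Hpq; rewrite mxE big1 // => v _.
case: (eqVneq (h v q) 0) => [->|/tr' hv]; first by rewrite mulr0.
rewrite mxE big1 ?mul0r // => u _.
case: (eqVneq (g p u) 0) => [->|/tr gu]; first by rewrite mul0r.
rewrite Hn ?mulr0 //; apply: contra Hpq; rewrite /uni_rel /=.
by rewrite (e0 u v) (e0' p q) !eqxx gu hv.
Qed.

(** Both presentations describe the same parabolic subgroup: xi2 x1 matches homogeneous parts of
    equal colour, so the order of the blocks is kept. *)
Lemma parind_transport c0 c0' c c2 x1 xi1 x2 xi2 (s : prerep R A m) :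
  (forall p q, c0 p = c0 q) -> (forall p q, c0' p = c0' q) ->
  inverse_mx x1 xi1 -> inverse_mx x2 xi2 -> transports c c2 (xi2 *m x1) ->
  parind c0 c x1 xi1 s = parind c0' c2 x2 xi2 s.
Proof.
move=> e0 e0' x12 x22 tr.
have gh : inverse_mx (xi2 *m x1) (xi1 *m x2) := inverse_mxM (inverse_mxC x22) x12.
have tr' := transports_inv gh tr.
have E h : xi2 *m h *m x2 = (xi2 *m x1) *m (xi1 *m h *m x1) *m (xi1 *m x2).
  by rewrite -!mulmxA (mulmxA x1 xi1) (mulmxA x1 xi1); case: x12 => -> _; rewrite !mul1mx.
have E' h : xi1 *m h *m x1 = (xi1 *m x2) *m (xi2 *m h *m x2) *m (xi2 *m x1).
  by rewrite -!mulmxA (mulmxA x2 xi2) (mulmxA x2 xi2); case: x22 => -> _; rewrite !mul1mx.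
apply: eq_parind.
- by move=> h; rewrite !levi_const.
- move=> h; split=> -[Gh H]; split=> //.
    by rewrite E; exact: transports_blockdiag gh tr H.
  by rewrite E'; exact: transports_blockdiag (inverse_mxC gh) tr' H.
- move=> h; rewrite !unipE; split=> H; rewrite ?E.
    exact: transports_uni e0 e0' gh tr H.
  by rewrite E'; exact: transports_uni e0' e0 (inverse_mxC gh) tr' H.
- by move=> h _; rewrite E; apply/esym/(sqrt_modulus_conj _ e0 e0' gh tr).
Qed.

Lemma scalar_eq (a : A) (u v : A) (t : F) : a != 0 -> t *: a = u * a -> u = t%:A.
Proof.
move=> /da_div Ua e; apply: (mulIr Ua); rewrite -e.
by rewrite mulr_algl.
Qed.

Lemma scalar_eqr (a : A) (u : A) (t : F) : a != 0 -> t *: a = a * u -> u = t%:A.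
Proof.
move=> /da_div Ua e; apply: (mulrI Ua); rewrite -e.
by rewrite mulr_algr.
Qed.

Lemma scalar_inj (t t' : F) : t%:A = t'%:A :> A -> t = t'.
Proof.
by move/eqP; rewrite -subr_eq0 -scalerBl scaler_eq0 oner_eq0 orbF subr_eq0 => /eqP.
Qed.

(* Conjugation by g carries the central element diag(lam o c1) of the first
   Levi subgroup to an element commuting with the second one. *)
Lemma levi_center c1 c2 g h (lam : 'I_m -> F) : inverse_mx g h ->
  (forall y, GL y -> blockdiag c2 y -> blockdiag c1 (h *m y *m g)) ->
  exists mu : 'I_m -> A, (forall p q, c2 p = c2 q -> mu p = mu q) /\
    forall p q, lam (c1 q) *: g p q = mu p * g p q.
Proof.
move=> [gh hg] Hc.
pose z : 'M[A]_m := \matrix_(p, q) if p == q then (lam (c1 p))%:A else 0.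
have zl y p q : (z *m y) p q = lam (c1 p) *: y p q.
  rewrite mxE (bigD1 p) //= mxE eqxx mulr_algl big1 ?addr0 // => u up.
  by rewrite mxE eq_sym (negPf up) mul0r.
have zr y p q : (y *m z) p q = lam (c1 q) *: y p q.
  rewrite mxE (bigD1 q) //= mxE eqxx mulr_algr big1 ?addr0 // => u up.
  by rewrite mxE (negPf up) mulr0.
pose u := g *m z *m h.
have uC y : GL y -> blockdiag c2 y -> u *m y = y *m u.
  move=> Gy By; have B1 := Hc y Gy By.
  have zC : z *m (h *m y *m g) = (h *m y *m g) *m z.
    apply/matrixP => p q; rewrite zl zr; case: (eqVneq (c1 p) (c1 q)) => [->//|/B1->].
    by rewrite !scaler0.
  rewrite /u -[in LHS](mulmx1 y) -gh.
  rewrite -!mulmxA (mulmxA h) (mulmxA (h *m y)) (mulmxA z) zC !mulmxA gh mul1mx.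
  by [].
(* A scalar other than 0 and 1; a diagonal matrix with this entry at p singles out the index p. *)
have [pi [pi0 vpi]] := @lf_unif F.
have pi1 : pi != 1 by apply: contra_eq_neq vpi => ->; rewrite lf_val1.
have udiag p q : p != q -> u p q = 0.
  move=> pq.
  pose d (t : F) : 'M[A]_m := \matrix_(a, b) if a == b then (if a == p then t%:A else 1) else 0.
  have dl t y a b : (d t *m y) a b = (if a == p then t else 1) *: y a b.
    rewrite mxE (bigD1 a) //= mxE eqxx big1 ?addr0 => [|v va].
      by case: (a == p); rewrite ?mulr_algl // mul1r scale1r.
    by rewrite mxE eq_sym (negPf va) mul0r.
  have dr t y a b : (y *m d t) a b = (if b == p then t else 1) *: y a b.
    rewrite mxE (bigD1 b) //= mxE eqxx big1 ?addr0 => [|v va].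
      by case: (b == p); rewrite ?mulr_algr // mulr1 scale1r.
    by rewrite mxE (negPf va) mulr0.
  have dd t t' : t * t' = 1 -> d t *m d t' = 1%:M.
    move=> tt'; apply/matrixP => a b; rewrite dl !mxE.
    by case: eqP => [->|]; case: ifP => _; rewrite ?scaler0 ?scale1r // scalerA tt' scale1r.
  have Gd : GL (d pi) by exists (d pi^-1); split; apply: dd; rewrite ?mulfV ?mulVf.
  have Bd : blockdiag c2 (d pi).
    by move=> a b cab; rewrite mxE; case: (eqVneq a b) cab => // ->; rewrite eqxx.
  have /matrixP/(_ p q) := uC _ Gd Bd; rewrite dl dr eqxx [q == p]eq_sym (negPf pq) scale1r => e.
  have : (1 - pi) *: u p q = 0 by rewrite scalerBl scale1r -e subrr.
  move/eqP; rewrite scaler_eq0 subr_eq0 eq_sym (negPf pi1) /=; exact/eqP.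
(* The diagonal of [u]. Commuting with 1 + [delta_mx p q] forces it to be constant on the classes of
   [c2]. *)
exists (fun p => u p p); split=> [p q cpq|p q].
  case: (eqVneq p q) => [->//|pq].
  have dl y a b : (delta_mx p q *m y) a b = if a == p then y q b else 0.
    rewrite mxE (bigD1 q) //= mxE eqxx andbT big1 ?addr0 => [|v vq].
      by case: (a == p); rewrite ?mul1r ?mul0r.
    by rewrite mxE (negPf vq) andbF mul0r.
  have dr y a b : (y *m delta_mx p q) a b = if b == q then y a p else 0.
    rewrite mxE (bigD1 p) //= mxE eqxx big1 ?addr0 => [|v vq].
      by case: (b == q); rewrite ?mulr1 ?mulr0.
    by rewrite mxE (negPf vq) mulr0.
  have E2 : delta_mx p q *m delta_mx p q = 0 :> 'M[A]_m.
    by apply/matrixP => a b; rewrite dl !mxE [q == p]eq_sym (negPf pq) if_same.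
  have Gd : GL (1%:M + delta_mx p q : 'M[A]_m).
    exists (1%:M - delta_mx p q); split.
      by rewrite mulmxDl mul1mx mulmxBr mulmx1 E2 subr0 subrK.
    by rewrite mulmxDr mulmx1 mulmxBl mul1mx E2 subr0 subrK.
  have Bd : blockdiag c2 (1%:M + delta_mx p q : 'M[A]_m).
    move=> a b cab; rewrite !mxE; case: (eqVneq a b) cab => [->|_ cab]; first by rewrite eqxx.
    rewrite add0r; case: eqP => //= ea; case: eqP => //= eb.
    by rewrite ea eb cpq eqxx in cab.
  have := uC _ Gd Bd; rewrite mulmxDr mulmxDl mulmx1 mul1mx => /addrI/matrixP/(_ p q).
  by rewrite dl dr !eqxx.
have : u *m g = g *m z by rewrite /u -mulmxA hg mulmx1.
move=> /matrixP/(_ p q); rewrite zr => <-.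
rewrite mxE (bigD1 p) //= big1 ?addr0 // => v vp.
by rewrite udiag ?mul0r // eq_sym.
Qed.

(** A nonzero entry g p q forces mu p = lam (c1 q) and nu q = lam (c2 p), so the [c2]-class of p and
    the [c1]-class of q determine each other. The colouring [c3] gives the classes of [c2] the
    colours of [c1], because the order of the colours decides which parabolic subgroup is meant. *)
Lemma levi_frames c1 c2 x1 xi1 x2 xi2 : inverse_mx x1 xi1 -> inverse_mx x2 xi2 ->
  (forall h : 'M[A]_m, levi c1 x1 xi1 h <-> levi c2 x2 xi2 h) ->
  exists c3, same_classes c3 c2 /\ transports c1 c3 (xi2 *m x1).
Proof.
move=> x12 x22 HL; pose g := xi2 *m x1; pose h := xi1 *m x2.
have gh : inverse_mx g h := inverse_mxM (inverse_mxC x22) x12.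
have Gg := inverse_mx_GL gh.
have E y : g *m y *m h = xi2 *m (x1 *m y *m xi1) *m x2 by rewrite !mulmxA.
have E' y : h *m y *m g = xi1 *m (x2 *m y *m xi2) *m x1 by rewrite !mulmxA.
have G12 y : GL y -> blockdiag c1 y -> blockdiag c2 (g *m y *m h).
  move=> Gy By; rewrite E; apply: (proj2 ((HL _).1 _)); split.
    by rewrite (GL_frame _ (inverse_mxC x12)).
  by have := frameK y (inverse_mxC x12) => ->.
have G21 y : GL y -> blockdiag c2 y -> blockdiag c1 (h *m y *m g).
  move=> Gy By; rewrite E'; apply: (proj2 ((HL _).2 _)); split.
    by rewrite (GL_frame _ (inverse_mxC x22)).
  by have := frameK y (inverse_mxC x22) => ->.
have [lam [lam0 lamI]] := @val_distinct F m.
rewrite -/g; clearbody g h.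
have [mu [muc muE]] := levi_center lam gh G21.
have [nu [nuc nuE]] := levi_center lam (inverse_mxC gh) G12.
(* [nuE] is a relation h D2 = N h for the inverse matrix; multiplying by g on both sides carries it
   over to g. *)
have nuE' p q : lam (c2 p) *: g p q = g p q * nu q.
  pose D2 : 'M[A]_m := \matrix_(a, b) if a == b then (lam (c2 a))%:A else 0.
  pose N : 'M[A]_m := \matrix_(a, b) if a == b then nu a else 0.
  have e : h *m D2 = N *m h.
    apply/matrixP => a b; rewrite !mxE (bigD1 b) //= [in RHS](bigD1 a) //= !mxE !eqxx.
    rewrite mulr_algr nuE !big1 // => v va; rewrite mxE.
      by rewrite eq_sym (negPf va) mul0r.
    by rewrite (negPf va) mulr0.
  have : D2 *m g = g *m N.
    case: gh => gh hg; rewrite -[LHS]mul1mx -gh -!mulmxA (mulmxA h) e.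
    by rewrite -(mulmxA N) hg mulmx1.
  move=> /matrixP/(_ p q); rewrite !mxE (bigD1 p) //= [in RHS](bigD1 q) //= !mxE !eqxx.
  rewrite mulr_algl !big1 ?addr0 // => v vp; rewrite mxE.
    by rewrite (negPf vp) mulr0.
  by rewrite eq_sym (negPf vp) mul0r.
have c12 p q p' q' : g p q != 0 -> g p' q' != 0 -> (c2 p == c2 p') = (c1 q == c1 q').
  move=> gpq gpq'; apply/eqP/eqP => [/muc e|/nuc e]; apply: lamI; apply: scalar_inj.
    by rewrite -(scalar_eq (mu p) gpq (muE p q)) e (scalar_eq (mu p) gpq' (muE p' q')).
  by rewrite -(scalar_eqr gpq (nuE' p q)) e (scalar_eqr gpq' (nuE' p' q')).
have /choice[f Hf] : forall p, exists q, g p q != 0 by move=> p; exact: GL_row.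
exists (fun p => c1 (f p)); split=> [p q|p q gpq].
  by rewrite (c12 _ _ _ _ (Hf p) (Hf q)).
by apply/eqP; rewrite -(c12 _ _ _ _ (Hf p) gpq).
Qed.

(** The pair (c, c') is ordered lexicographically through [key]. Keys can exceed m, so each is
    replaced by its rank, which is a colour again since no index counts itself. *)
Lemma lexicographic_refinement c c' : refines c' c -> exists c2, [/\ lexicographic c c2,
  same_classes c' c2 & forall p q, c p = c q -> (c' p < c' q)%N = (c2 p < c2 q)%N].
Proof.
move=> ref; pose key p := (c p * m + c' p)%N.
pose rk p := #|[pred q | (key q < key p)%N]|.
have rk_lt p q : (key p < key q)%N -> (rk p < rk q)%N.
  move=> lt; apply/proper_card/properP; split.
    by apply/subsetP => v; rewrite !inE => /ltn_trans; exact.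
  by exists p; rewrite !inE ?ltnn.
have rk_le p q : (key p <= key q)%N -> (rk p <= rk q)%N.
  by move=> le; apply/subset_leq_card/subsetP => v; rewrite !inE => /leq_trans; exact.
have rk_m p : (rk p < m)%N.
  rewrite -[X in (_ < X)%N]card_ord; apply/proper_card/properP; split; first exact/subsetP.
  by exists p; rewrite ?inE ?ltnn.
have rkE p q : (rk p < rk q)%N = (key p < key q)%N.
  by apply/idP/idP => [|/rk_lt//]; apply: contraTT; rewrite -!leqNgt; exact: rk_le.
have rk_eq p q : (rk p == rk q) = (key p == key q).
  rewrite [LHS]eqn_leq [RHS]eqn_leq (leqNgt (rk p)) (leqNgt (rk q)) (rkE p q) (rkE q p).
  by rewrite -!leqNgt.
have keyE p q : (key p == key q) = (c p == c q) && (c' p == c' q).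
  apply/eqP/andP => [e|[/eqP e /eqP e']]; last by rewrite /key e e'.
  have m0 : (0 < m)%N by apply: leq_ltn_trans (ltn_ord p).
  have := congr1 (divn^~ m) e; have := congr1 (modn^~ m) e.
  rewrite /key /= !modnMDl !modn_small // !divnMDl // !divn_small // !addn0 => e1 e2.
  by split; apply/eqP/val_inj.
have lt_key p q : (c p < c q)%N -> (key p < key q)%N.
  move=> lt; apply: (@leq_trans ((c p).+1 * m)%N).
    by rewrite /key mulSn [X in (_ < X)%N]addnC ltn_add2l.
  by apply: leq_trans (leq_addr _ _); rewrite leq_mul2r lt orbT.
exists (fun p => Ordinal (rk_m p)); split.
- split=> [p q /(congr1 val)/= /eqP|p q /lt_key/rk_lt //].
  by rewrite rk_eq keyE => /andP[/eqP].
- move=> p q; rewrite -[RHS]/(rk p == rk q) rk_eq keyE.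
  by apply/idP/andP => [/eqP e|[]//]; split; apply/eqP => //; exact: ref.
by move=> p q e; rewrite /= rkE /key e ltn_add2l.
Qed.

End Presentations.

(** * Supercuspidal supports of quotients of induced representations *)

Section Support.
Import Order.TTheory GRing.Theory Num.Theory.
Local Open Scope ring_scope.
Context {R : realType} {F : localField} {A : divAlg F} {m : nat}.
Implicit Types (c : 'I_m -> 'I_m) (x xi : 'M[A]_m) (t p : prerep R A m) (y : cuspPair R A m).

Lemma cp_smooth y c x xi : (forall h, cp_levi y h <-> levi c x xi h) ->
  smooth_rep (levi c x xi) (cp_rep y).
Proof.
move=> e; have <- : cp_levi y = levi c x xi by apply/funext => h; apply/propext.
by have [[]] := cp_repP y.
Qed.

Lemma has_support_self y c0 c x xi p : inverse_mx x xi -> (forall i j, c0 i = c0 j) ->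
  (forall h, cp_levi y h <-> levi c x xi h) ->
  quotient_rep (@GL F A m) (parind c0 c x xi (cp_rep y)) p ->
  has_support (@GL F A m) p y.
Proof.
move=> xxi c0c e q; exists c0, c, x, xi; split=> //.
  by move=> h; rewrite levi_const.
exists (@pcar _ _ _ _ (parind c0 c x xi (cp_rep y))) => //.
have -> : @GL F A m = levi c0 x xi by apply/funext => h; apply/propext; rewrite levi_const.
have ref : refines c c0 by move=> i j _; exact: c0c.
exact: full_subrep (parind_smooth xxi ref (cp_smooth e)).
Qed.

(** M comes with two presentations, one from the induction of t and one from its support. In the
    frame of the second, [c3] keeps the block order of the first, so the outer induction is
    unchanged; [c2] keeps the order of [c'] inside each class, so the inner one is unchanged. Now
    [c2] is lexicographic over [c3], and the stages can be composed. *)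
Lemma has_support_trans (M : 'M[A]_m -> Prop) t y c0 c x xi p : inverse_mx x xi ->
  (forall i j, c0 i = c0 j) -> (forall h, M h <-> levi c x xi h) -> has_support M t y ->
  quotient_rep (@GL F A m) (parind c0 c x xi t) p -> has_support (@GL F A m) p y.
Proof.
move=> xxi c0c Mc [c1 [c' [x1 [xi1 [xxi1 Mc1 ref Lc' sq]]]]] q.
have [|c3 [c31 tr]] := @levi_frames F A m c c1 x xi x1 xi1 xxi xxi1.
  by move=> h; rewrite -Mc -Mc1.
have ref3 : refines c' c3 by move=> i j /ref e; apply/eqP; rewrite c31 e.
have [c2 [lex c'2 lt2]] := lexicographic_refinement ref3.
have Lc2 h : cp_levi y h <-> levi c2 x1 xi1 h by rewrite Lc'; exact: same_classes_levi.
exists c0, c2, x1, xi1; split=> //.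
  by move=> h; rewrite levi_const.
have eind : parind c1 c' x1 xi1 (cp_rep y) = parind c3 c2 x1 xi1 (cp_rep y).
  apply: parind_relabel; [by move=> i j; rewrite c31|by []|move=> i j e].
  by apply: lt2; apply/eqP; rewrite c31 e.
have M3 : M = levi c3 x1 xi1.
  apply/funext => h; apply/propext; rewrite Mc1; apply: same_classes_levi => i j.
  by rewrite c31.
move: sq; rewrite eind M3 => -[W subW imW].
apply: (parind_stages c0c lex xxi1 (cp_smooth Lc2) subW imW).
by rewrite -(parind_transport t c0c c0c xxi xxi1 tr).
Qed.

End Support.

(** * External tensor products and Langlands quotients *)

Section SubspaceType.
Import Order.TTheory GRing.Theory Num.Theory.
Local Open Scope ring_scope.
Context {R : realType} {U : lmodType R[i]} {W : U -> Prop}.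

(** The universal property in [factorized] ranges over modules, so a subspace has to become a
    module. The proof [sW] is carried as an argument for the closure instance to be inferred. *)
Definition subspace_pred (sW : subspace W) : {pred U} := fun v => `[< W v >].

Lemma subspace_pred_closed (sW : subspace W) : submod_closed (subspace_pred sW).
Proof.
by case: (sW) => W0 WD; split=> [|a u v /asboolP Wu /asboolP Wv]; apply/asboolP; [|exact: WD].
Qed.

HB.instance Definition _ (sW : subspace W) :=
  GRing.isSubmodClosed.Build R[i] U (subspace_pred sW) (subspace_pred_closed sW).

Record subspace_type (sW : subspace W) := SubspaceElt {
  subspace_val :> U; _ : subspace_val \in subspace_pred sW }.

HB.instance Definition _ (sW : subspace W) := [isSub for @subspace_val sW].
HB.instance Definition _ (sW : subspace W) := [Choice of subspace_type sW by <:].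
HB.instance Definition _ (sW : subspace W) := [SubChoice_isSubLmodule of subspace_type sW by <:].

End SubspaceType.

Section Reindexing.
Variables (k : nat) (s : {perm 'I_k}).

(** The inverse of precomposition with s on dependent families; the cast is along s (s^-1 j) = j. *)
Definition unperm (T : 'I_k -> Type) (v : forall i, T (s i)) (j : 'I_k) : T j :=
  eq_rect (s (s^-1%g j)) T (v (s^-1%g j)) j (permKV s j).

Lemma unpermE T (v : forall i, T (s i)) i : unperm v (s i) = v i.
Proof.
rewrite /unperm; move: (permKV s (s i)); rewrite permK => e.
by rewrite (eq_irrelevance e erefl).
Qed.

(** Goals about all j are reduced to j = s i, where [unpermE] removes the cast. *)
Lemma perm_cover (P : 'I_k -> Prop) : (forall i, P (s i)) -> forall j, P j.
Proof. by move=> H j; rewrite -(permKV s j). Qed.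

Lemma eq_unperm T (v : forall j, T j) : unperm (fun i => v (s i)) = v.
Proof. by apply: functional_extensionality_dep; apply: perm_cover => i; rewrite unpermE. Qed.

Lemma unperm_dfwith T (v : forall i, T (s i)) i (y : T (s i)) :
  unperm (dfwith v y) = dfwith (unperm v) y.
Proof.
apply: functional_extensionality_dep; apply: perm_cover => j; rewrite unpermE.
case: (eqVneq i j) => [e|ij]; first by case: j / e; rewrite !dfwith_in.
by rewrite !dfwith_out ?unpermE // (inj_eq perm_inj).
Qed.

Lemma dfwith_perm T (u : forall j, T j) i (y : T (s i)) :
  (fun j => dfwith u y (s j)) = dfwith (fun j => u (s j)) y.
Proof.
apply: functional_extensionality_dep => j.
case: (eqVneq i j) => [e|ij]; first by case: j / e; rewrite !dfwith_in.
by rewrite !dfwith_out // (inj_eq perm_inj).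
Qed.

End Reindexing.

Section Factorized.
Import Order.TTheory GRing.Theory Num.Theory.
Local Open Scope ring_scope.
Context {R : realType} {F : localField} {A : divAlg F} {r : nat}.
Local Notation C := R[i].
Implicit Types (M : 'M[A]_r -> Prop) (x xi : 'M[A]_r) (t : prerep R A r).

Lemma inj_surj_bij (T1 T2 : Type) (f : T1 -> T2) : injective f ->
  (forall b, exists a, f a = b) -> bijective f.
Proof. by move=> fI /choice[g fg]; exists g => // a; apply: fI. Qed.

Lemma blocks_perm k (s : {perm 'I_k}) (m : 'I_k -> nat) n (idx : forall i, 'I_(m i) -> 'I_n) :
  blocks idx -> blocks (fun i => idx (s i)).
Proof.
move=> bi; have idxI := bij_inj bi; apply: inj_surj_bij.
  move=> [i a] [j b] /= e.
  have /eqP := idxI (Tagged (fun i => 'I_(m i)) a) (Tagged (fun i => 'I_(m i)) b) e.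
  rewrite -tag_eqE /tag_eq /= => /andP[/eqP ij].
  move/perm_inj: ij => ij; case: j / ij b {e} => b.
  by rewrite tagged_asE => /eqP->.
move=> p; have [g gK fK] := bi.
case: (g p) (fK p) => j a; move: j a; apply: (perm_cover (s := s)) => i a e.
by exists (Tagged (fun i => 'I_(m (s i))) a).
Qed.

Lemma blocks_sum k (m : 'I_k -> nat) n (idx : forall i, 'I_(m i) -> 'I_n) :
  blocks idx -> (\sum_i m i)%N = n.
Proof.
move=> /bij_eq_card; rewrite card_ord card_tagged sumnE big_map big_enum /= => <-.
by apply: eq_bigr => i _; rewrite card_ord.
Qed.

Lemma bdiag_perm (T : nzRingType) k (s : {perm 'I_k}) (m : 'I_k -> nat) n
  (idx : forall i, 'I_(m i) -> 'I_n) (h : forall i, 'M[T]_(m i)) :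
  bdiag (fun i => idx (s i)) (fun i => h (s i)) = bdiag idx h.
Proof. by apply/matrixP => p q; rewrite !mxE [RHS](reindex_inj (@perm_inj _ s)). Qed.

Lemma bdiagM (T : nzRingType) n k (m : 'I_k -> nat) (idx : forall i, 'I_(m i) -> 'I_n)
    (g h : forall i, 'M[T]_(m i)) : blocks idx ->
  bdiag idx g *m bdiag idx h = bdiag idx (fun i => g i *m h i).
Proof.
move=> bi; have [inv invK Kinv] := bi.
pose E (u : {i : 'I_k & 'I_(m i)}) : 'I_n := idx (tag u) (tagged u).
(* In tagged coordinates an entry is read off from its block, and a matrix product becomes a sum
   within one block. *)
have bE (h1 : forall i, 'M[T]_(m i)) (u v : {i : 'I_k & 'I_(m i)}) :
    bdiag idx h1 (E u) (E v) =
    if tag u == tag v then h1 (tag u) (tagged u) (tagged_as u v) else 0.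
  pose tg i (a : 'I_(m i)) := Tagged (fun i => 'I_(m i)) a.
  have Eeq i a j b : (idx i a == idx j b) = (tg i a == tg j b).
    by rewrite -(inj_eq (bij_inj bi)).
  have tgE i a b : (tg i a == tg i b) = (a == b).
    by rewrite /tg -tag_eqE /tag_eq /= eqxx tagged_asE.
  have tgN i a j b : i != j -> (tg i a == tg j b) = false.
    by move=> ij; rewrite /tg -tag_eqE /tag_eq /= (negPf ij).
  case: u v => i a [j b]; rewrite /E mxE (bigD1 i) //= [X in _ + X]big1 ?addr0 => [|l li].
    rewrite (big_pred1 a) => [|d]; last by rewrite Eeq tgE.
    case: (eqVneq i j) => [e|ij]; last by rewrite big_pred0 // => d; rewrite Eeq tgN.
    case: j / e b => b; rewrite tagged_asE (big_pred1 b) // => d.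
    by rewrite Eeq tgE.
  by rewrite big_pred0 // => d; rewrite Eeq tgN.
apply/matrixP => p q; rewrite -(Kinv p) -(Kinv q) -/(E (inv p)) -/(E (inv q)) bE.
move: (inv p) (inv q) => u v; rewrite mxE (reindex E) /=; last first.
  by exists inv => ? _; [exact: invK|exact: Kinv].
transitivity (\sum_w (if tag u == tag w then g (tag u) (tagged u) (tagged_as u w) else 0) *
   (if tag w == tag v then h (tag w) (tagged w) (tagged_as w v) else 0)).
  by apply: eq_bigr => w _; rewrite !bE.
rewrite -(sig_big_dep xpredT (fun _ _ => true) (fun i a =>
   let w := Tagged (fun i => 'I_(m i)) a in
   (if tag u == i then g (tag u) (tagged u) (tagged_as u w) else 0) *
   (if i == tag v then h i a (tagged_as w v) else 0))) /=.
rewrite (bigD1 (tag u)) //= [X in _ + X]big1 ?addr0 => [|i iu]; last first.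
  by apply: big1 => a _; rewrite eq_sym (negPf iu) mul0r.
case: u v => i a [j b] /=; case: (eqVneq i j) => [e|ij]; last first.
  by apply: big1 => l _; rewrite mulr0.
case: j / e b => b; rewrite tagged_asE mxE; apply: eq_bigr => l _.
by rewrite eqxx !tagged_asE.
Qed.

Lemma bdiag1 (T : nzRingType) n k (m : 'I_k -> nat) (idx : forall i, 'I_(m i) -> 'I_n) :
  blocks idx -> bdiag idx (fun i => 1%:M : 'M[T]_(m i)) = 1%:M.
Proof.
move=> bi; have [inv invK Kinv] := bi.
apply/matrixP => p q; rewrite !mxE.
transitivity (\sum_i \sum_(a | idx i a == p) (p == q)%:R : T).
  apply: eq_bigr => i _; apply: eq_bigr => a /eqP <-.
  rewrite (eq_bigr (fun b => (a == b)%:R)) => [|b _]; last by rewrite mxE.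
  case: (boolP (idx i a == q)) => [qa|qa].
    rewrite (bigD1 a) //= eqxx big1 ?addr0 // => b /andP[_ ba].
    by rewrite eq_sym (negPf ba).
  by rewrite big1 // => b qb; case: eqP => // e; rewrite e qb in qa.
rewrite (sig_big_dep xpredT (fun i a => idx i a == p) (fun _ _ => (p == q)%:R)) /=.
rewrite (big_pred1 (inv p)) // => u.
by rewrite -{1}(Kinv p) (inj_eq (bij_inj bi)).
Qed.

(** The universal map is precomposed with [unperm]. Group and representation stay the same, so the
    factors may be sorted freely. *)
Lemma factorized_perm M t k (s : {perm 'I_k}) (m : 'I_k -> nat)
    (idx : forall i, 'I_(m i) -> 'I_r) x xi (s_ : forall i, prerep R A (m i)) :
  factorized M t idx x xi s_ ->
  factorized (m := fun i => m (s i)) M t (fun i => idx (s i)) x xi (fun i => s_ (s i)).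
Proof.
move=> [sm bi xxi HM [tm [tpcar tlin teq tuniv]]].
have GLu (h : forall i, 'M[A]_(m (s i))) : (forall i, GL (h i)) ->
    forall j, GL (unperm (T := fun j => 'M[A]_(m j)) h j).
  by move=> Gh; apply: (perm_cover (s := s)) => i; rewrite unpermE.
have bu (h : forall i, 'M[A]_(m (s i))) : bdiag (fun i => idx (s i)) h =
    bdiag idx (unperm (T := fun j => 'M[A]_(m j)) h).
  rewrite -[RHS](bdiag_perm s); congr (bdiag (m := fun i => m (s i)) _ _).
  by apply: functional_extensionality_dep => i; rewrite unpermE.
have pcu (v : forall i, psp (s_ (s i))) : (forall i, pcar (v i)) ->
    forall j, pcar (unperm (T := fun j => psp (s_ j)) v j).
  by move=> pv; apply: (perm_cover (s := s)) => i; rewrite unpermE.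
split=> //.
- exact: blocks_perm.
- move=> h; rewrite HM; split=> -[h_ Gh ->].
    by exists (fun i => h_ (s i)) => //; rewrite bdiag_perm.
  by exists (unperm (T := fun j => 'M[A]_(m j)) h_); [exact: GLu|rewrite bu].
exists (fun v => tm (unperm (T := fun j => psp (s_ j)) v)); split.
- by move=> v pv; apply: tpcar; exact: pcu.
- move=> v pv i a y z py pz; rewrite !unperm_dfwith; apply: tlin => //.
  exact: pcu.
- move=> h_ v Gh pv; rewrite bu -teq //; [|exact: GLu|exact: pcu].
  congr tm; apply: functional_extensionality_dep; apply: (perm_cover (s := s)) => i.
  by rewrite !unpermE.
- move=> V b blin.
  have bl : multilinear_on (fun i => @pcar _ _ _ _ (s_ i)) (fun v => b (fun i => v (s i))).
    move=> v pv; apply: (perm_cover (s := s)) => i a y z py pz.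
    by rewrite !dfwith_perm; apply: blin => // j; exact: pv.
  have [[g glin gE] guniq] := tuniv V _ bl; split.
    exists g => // v pv; rewrite gE; last exact: pcu.
    by congr b; apply: functional_extensionality_dep => i; rewrite unpermE.
  move=> g1 g2 l1 l2 e; apply: guniq => // v pv.
  by have := e (fun i => v (s i)) (fun i => pv _); rewrite eq_unperm.
Qed.

(* The universal map takes values in W since it factors through the type of
   vectors of W. *)
Lemma factorized_univ M t k (m : 'I_k -> nat) (idx : forall i, 'I_(m i) -> 'I_r) x xi
    (s_ : forall i, prerep R A (m i)) (tm : (forall i, psp (s_ i)) -> psp t)
    (V : lmodType C) (W : V -> Prop) (b : (forall i, psp (s_ i)) -> V) :
  (forall (V : lmodType C) (b : (forall i, psp (s_ i)) -> V),
            multilinear_on (fun i => @pcar _ _ _ _ (s_ i)) b ->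
            (exists2 g : psp t -> V, linear_on (@pcar _ _ _ r t) g
               & forall u, (forall i, pcar (u i)) -> g (tm u) = b u)) ->
  subspace W -> multilinear_on (fun i => @pcar _ _ _ _ (s_ i)) b ->
  (forall i, subspace (@pcar _ _ _ _ (s_ i))) ->
  (forall v, (forall i, pcar (v i)) -> W (b v)) ->
  exists g : psp t -> V, [/\ linear_on (@pcar _ _ _ _ t) g, forall v, W (g v)
    & forall v, (forall i, pcar (v i)) -> g (tm v) = b v].
Proof.
move=> tuniv sW blin sub_ bW; pose VW : lmodType C := subspace_type sW.
pose bb v : VW := insubd 0 (b v).
have bbE v : (forall i, pcar (v i)) -> subspace_val (bb v) = b v.
  by move=> pv; rewrite [LHS]insubdK //; apply/asboolP; exact: bW.
have pcw (v : forall i, psp (s_ i)) i y : (forall i, pcar (v i)) -> pcar y ->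
    forall j, pcar (dfwith v (i := i) y j).
  move=> pv py j; case: (eqVneq i j) => [e|ij]; first by case: j / e; rewrite dfwith_in.
  by rewrite dfwith_out.
have bblin : multilinear_on (fun i => @pcar _ _ _ _ (s_ i)) bb.
  move=> v pv i a y z py pz; apply: val_inj; rewrite linearP /=.
  have pyz : pcar (a *: y + z) by have [_] := sub_ i; exact.
  by rewrite !bbE ?blin //; exact: pcw.
have [g glin gE] := tuniv VW bb bblin.
exists (fun v => subspace_val (g v)); split.
- by move=> a u v pu pv; rewrite glin //= linearP.
- by move=> v; case: (g v) => w /= /asboolP.
- by move=> v pv; rewrite gE // bbE.
Qed.

(** Each universal property is applied to the other universal map. The intertwining relation holds
    on pure tensors, and the uniqueness clause extends it to all vectors. *)
Lemma factorized_iso M M' t t' k (m : 'I_k -> nat) (idx idx' : forall i, 'I_(m i) -> 'I_r)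
    x xi x' xi' (s_ : forall i, prerep R A (m i)) :
  (forall i, smooth_rep (@GL F A (m i)) (s_ i)) ->
  factorized M t idx x xi s_ -> factorized M' t' idx' x' xi' s_ ->
  exists (f : psp t -> psp t') (g : psp t' -> psp t),
    [/\ linear_on (@pcar _ _ _ _ t) f, linear_on (@pcar _ _ _ _ t') g,
        (forall v, pcar (f v)) /\ (forall v, pcar (g v)),
        (forall v, pcar v -> g (f v) = v) /\ (forall v, pcar v -> f (g v) = v)
      & forall h_ v, (forall i, GL (h_ i)) -> pcar v ->
        f (pact (x *m bdiag idx h_ *m xi) v) = pact (x' *m bdiag idx' h_ *m xi') (f v)].
Proof.
move=> sm_ [sm bi xxi HM [tm [tpcar tlin teq tuniv]]].
move=> [sm' bi' xxi' HM' [tm' [tpcar' tlin' teq' tuniv']]].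
have [sub lin _ _ _] := sm; have [sub' lin' _ _ _] := sm'.
have sub_ i : subspace (@pcar _ _ _ _ (s_ i)) by have [] := sm_ i.
have [f [flin fp fE]] :=
  factorized_univ M idx x xi (fun V b H => (tuniv V b H).1) sub' tlin' sub_ tpcar'.
have [g [glin gp gE]] :=
  factorized_univ M' idx' x' xi' (fun V b H => (tuniv' V b H).1) sub tlin sub_ tpcar.
exists f, g; split=> //; first split.
- apply: (tuniv _ tm tlin).2 => // [a u v pu pv|v pv].
    by rewrite flin // glin //; exact: fp.
  by rewrite fE // gE.
- apply: (tuniv' _ tm' tlin').2 => // [a u v pu pv|v pv].
    by rewrite glin // flin //; exact: gp.
  by rewrite gE // fE.
- move=> h_ v Gh pv.
  have Mh : M (x *m bdiag idx h_ *m xi) by apply/HM; exists h_.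
  have Mh' : M' (x' *m bdiag idx' h_ *m xi') by apply/HM'; exists h_.
  have [lh ph] := lin _ Mh; have [lh' ph'] := lin' _ Mh'.
  have ml : multilinear_on (fun i => @pcar _ _ _ _ (s_ i))
      (fun v => f (pact (x *m bdiag idx h_ *m xi) (tm v))).
    move=> w pw i a y z py pz; rewrite tlin // lh ?flin //.
    + by apply: ph; apply: tpcar => j; case: (eqVneq i j) => [e|ij];
        [case: j / e; rewrite dfwith_in|rewrite dfwith_out].
    + by apply: ph; apply: tpcar => j; case: (eqVneq i j) => [e|ij];
        [case: j / e; rewrite dfwith_in|rewrite dfwith_out].
    + by apply: tpcar => j; case: (eqVneq i j) => [e|ij];
        [case: j / e; rewrite dfwith_in|rewrite dfwith_out].
    + by apply: tpcar => j; case: (eqVneq i j) => [e|ij];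
        [case: j / e; rewrite dfwith_in|rewrite dfwith_out].
  apply: ((tuniv _ _ ml).2 (fun v => f (pact (x *m bdiag idx h_ *m xi) v))
    (fun v => pact (x' *m bdiag idx' h_ *m xi') (f v))) => //.
  + by move=> a u w pu pw; rewrite lh // flin //; exact: ph.
  + by move=> a u w pu pw; rewrite flin // lh' //; exact: fp.
  move=> w pw; have pw' i : pcar (pact (h_ i) (w i)).
    by have [_ H _ _ _] := sm_ i; have [_] := H _ (Gh i); apply.
  by rewrite -teq // fE // fE // teq'.
Qed.

End Factorized.

(** * Langlands quotients induced from a given Levi subgroup *)

Section LanglandsQuotient.
Import Order.TTheory GRing.Theory Num.Theory.
Local Open Scope ring_scope.
Context {R : realType} {F : localField} {A : divAlg F}.
Local Notation C := R[i].

Lemma bdiag_relocate (T : nzRingType) n k (m : 'I_k -> nat)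
    (idx idx' : forall i, 'I_(m i) -> 'I_n) (s : 'S_n) (h : forall i, 'M[T]_(m i)) :
  (forall i a, s (idx i a) = idx' i a) ->
  bdiag idx h = perm_mx s *m bdiag idx' h *m perm_mx s^-1.
Proof.
move=> H; rewrite -col_permE -row_permE; apply/matrixP => p q; rewrite !mxE.
apply: eq_bigr => i _; under eq_bigl => a do rewrite -(inj_eq (@perm_inj _ s)) H.
by apply: eq_bigr => a _; apply: eq_bigl => b; rewrite -(inj_eq (@perm_inj _ s)) H.
Qed.

Lemma blocks_relocate n k (m : 'I_k -> nat) (idx idx' : forall i, 'I_(m i) -> 'I_n) :
  blocks idx -> blocks idx' -> exists s : 'S_n, forall i a, s (idx i a) = idx' i a.
Proof.
move=> [g gK fK] bi'; pose f' (u : {i : 'I_k & 'I_(m i)}) := idx' (tag u) (tagged u).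
have fI : injective (f' \o g) := inj_comp (bij_inj bi') (can_inj fK).
by exists (perm fI) => i a; rewrite permE /= (gK (Tagged (fun i => 'I_(m i)) a)).
Qed.

Lemma perm_mxK n (s : 'S_n) : inverse_mx (perm_mx s : 'M[A]_n) (perm_mx s^-1).
Proof. by split; rewrite -perm_mxM ?mulgV ?mulVg perm_mx1. Qed.

(** The standard Levi subgroup is conjugate to M by [y], which is x times the permutation matrix
    matching the two placements of the blocks. Left translation by y, combined with the isomorphism
    between the two tensor products, carries one induced representation to the other. *)
Lemma langlands_quotient_parind r (M : 'M[A]_r -> Prop) (t p : prerep R A r)
    k (m : 'I_k -> nat) (idx : forall i, 'I_(m i) -> 'I_r) x xi (s : forall i, prerep R A (m i)) :
  (forall i, smooth_rep (@GL F A (m i)) (s i)) ->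
  factorized M t idx x xi s -> langlands_quotient s p ->
  exists c0 c x' xi', [/\ inverse_mx x' xi', forall i j, c0 i = c0 j,
    forall h, M h <-> levi c x' xi' h & quotient_rep (@GL F A r) (parind c0 c x' xi' t) p].
Proof.
move=> ss fact [idx' [c0 [c [t' [_ [_ c0c] fact' [_ [q [qlin qp qsurj qeq]]] _]]]]].
have [ss_t bi xxi HM _] := fact; have [ss_t' bi' _ HM' _] := fact'.
have [f [g [flin glin [fp gp] [gf fg] feq]]] := factorized_iso ss fact fact'.
have [sg Hsg] := blocks_relocate bi' bi.
pose y := x *m perm_mx sg^-1; pose yi := perm_mx sg *m xi.
have yyi : inverse_mx y yi := inverse_mxM xxi (inverse_mxC (perm_mxK sg)).
have ybd (h : forall i, 'M[A]_(m i)) : y *m bdiag idx' h *m yi = x *m bdiag idx h *m xi.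
  rewrite (bdiag_relocate h Hsg) /y /yi !mulmxA -(mulmxA x).
  have [_ sK] := perm_mxK sg; rewrite sK mulmx1.
  by rewrite -(mulmxA _ (perm_mx sg^-1)) sK mulmx1.
clearbody y yi.
have Ml h : M h <-> levi c y yi h.
  have -> : levi c y yi h <-> levi c 1%:M 1%:M (yi *m h *m y).
    by rewrite /levi (GL_frame h yyi) mulmx1 mul1mx.
  rewrite HM HM'; split=> -[h_ Gh e]; exists h_ => //.
    by rewrite mul1mx mulmx1 e -ybd; exact: frameK (inverse_mxC yyi).
  by rewrite -ybd -(frameK h yyi) e mul1mx mulmx1.
have feq' l v : levi c 1%:M 1%:M l -> pcar v -> f (pact (y *m l *m yi) v) = pact l (f v).
  move=> /HM'[h_ Gh ->] pv; have := feq h_ v Gh pv; rewrite -ybd => <-.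
  by rewrite mul1mx mulmx1.
have e1 := inverse_mx1 (A := A) r.
have L1 h : levi c0 1%:M 1%:M h <-> GL h by rewrite levi_const.
have Ly h : levi c0 y yi h <-> GL h by rewrite levi_const.
have Gy : GL y := inverse_mx_GL yyi; have Gyi : GL yi := inverse_mx_GL (inverse_mxC yyi).
have [yyi1 yiy1] := yyi.
have [sub lin _ _ _] := ss_t; have [sub' lin' _ _ _] := ss_t'.
have f0 : f 0 = 0 by exact: linear_on0 sub flin.
have g0 : g 0 = 0 by exact: linear_on0 sub' glin.
exists c0, c, y, yi; split=> //.
pose phi (u : 'M[A]_r -> psp t) : 'M[A]_r -> psp t' := fun h => f (u (y *m h)).
have phip u : @pcar _ _ _ _ (parind c0 c y yi t) u ->
    @pcar _ _ _ _ (parind c0 c 1%:M 1%:M t') (phi u).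
  move=> [u0 up uP [N HN]]; split.
  - move=> h nL; rewrite /phi u0 // => /Ly H; apply: nL; apply/L1.
    have -> : h = yi *m (y *m h) by rewrite mulmxA yiy1 mul1mx.
    exact: GLM.
  - by move=> h; exact: fp.
  - move=> n l h Un Ll Lh; rewrite /phi.
    have -> : y *m (n *m l *m h) = (y *m n *m yi) *m (y *m l *m yi) *m (y *m h).
      by rewrite -(frameM _ _ (inverse_mxC yyi)) !mulmxA -(mulmxA _ yi y) yiy1 mulmx1.
    have Un' : unip c0 c y yi (y *m n *m yi).
      rewrite unipE (frameK n (inverse_mxC yyi)); move: Un; rewrite unipE.
      by rewrite mul1mx mulmx1.
    have Ll' : levi c y yi (y *m l *m yi).
      split; first by rewrite (GL_frame _ (inverse_mxC yyi)); case: Ll.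
      by rewrite (frameK l (inverse_mxC yyi)); case: Ll => _; rewrite mul1mx mulmx1.
    have Lh' : levi c0 y yi (y *m h) by apply/Ly; apply: GLM => //; exact/L1.
    have [_ pl] := lin _ ((Ml _).2 Ll').
    rewrite (uP _ _ _ Un' Ll' Lh') (linear_onZ _ sub flin); last exact: pl.
    by rewrite (feq' _ _ Ll (up _)) (frameK l (inverse_mxC yyi)) mul1mx mulmx1.
  - exists N => h h' Lh Kh Lh'; rewrite /phi mulmxA HN //; first exact/Ly/L1.
    by apply/Ly; apply: GLM => //; exact/L1.
exists (fun u => q (phi u)); split.
- move=> a u v pu pv; have -> : phi (a *: u + v) = a *: phi u + phi v.
    apply/funext => h; rewrite /phi -[RHS]/(a *: f (u (y *m h)) + f (v (y *m h))).
    by rewrite -flin //; [case: pu|case: pv].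
  by rewrite qlin //; exact: phip.
- by move=> u pu; apply/qp/phip.
- move=> v pv; have [w pw <-] := qsurj v pv.
  pose u (h : 'M[A]_r) : psp t := g (w (yi *m h)).
  have [w0 wp wP [N HN]] := pw.
  exists u; last first.
    congr q; apply/funext => h; rewrite /phi /u mulmxA yiy1 mul1mx fg //; exact: wp.
  split.
  + move=> h nL; rewrite /u w0 // => /L1 H; apply: nL; apply/Ly.
    have -> : h = y *m (yi *m h) by rewrite mulmxA yyi1 mul1mx.
    exact: GLM.
  + by move=> h; exact: gp.
  + move=> n l h Un Ll Lh; rewrite /u.
    have -> : yi *m (n *m l *m h) = (yi *m n *m y) *m (yi *m l *m y) *m (yi *m h).
      by rewrite -(frameM _ _ yyi) !mulmxA -(mulmxA _ y yi) yyi1 mulmx1.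
    have Un' : unip c0 c 1%:M 1%:M (yi *m n *m y) by rewrite unipE mul1mx mulmx1.
    have Ll' : levi c 1%:M 1%:M (yi *m l *m y).
      split; first by rewrite (GL_frame _ yyi); case: Ll.
      by rewrite mul1mx mulmx1; case: Ll.
    have Lh' : levi c0 1%:M 1%:M (yi *m h) by apply/L1; apply: GLM => //; exact/Ly.
    have [_ pl] := lin' _ Ll'; have [_ pl1] := lin _ ((Ml _).2 Ll).
    rewrite (wP _ _ _ Un' Ll' Lh') (linear_onZ _ sub' glin); last exact: pl.
    rewrite mul1mx mulmx1; congr (_ *: _).
    rewrite -[in LHS](fg _ (wp _)) -(feq' _ _ Ll' (gp _)) (frameK l yyi) gf //.
    exact: pl1.
  + exists N => h h' Lh Kh Lh'; rewrite /u mulmxA HN //; first exact/L1/Ly.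
    by apply/L1; apply: GLM => //; exact/Ly.
- move=> h u Gh pu; rewrite -qeq //; last exact: phip.
  by congr q; apply/funext => h'; rewrite /phi /= mulmxA.
Qed.

Lemma standard_data_perm r k (m : 'I_k -> nat) (s : forall i, prerep R A (m i)) :
  (forall i, (0 < m i)%N /\ ess_square_integrable (s i)) -> (\sum_i m i)%N = r ->
  exists pi : {perm 'I_k}, standard_data r (fun i => s (pi i)).
Proof.
move=> Hs sm.
have /choice[e He] : forall i, exists e : R, ess_square_integrable_exp e (s i).
  by move=> i; have [_] := Hs i.
(* Reversed, so that sorting produces decreasing exponents. *)
pose le (i j : 'I_k) := e j <= e i.
have le_tr : transitive le by move=> i j l ij jl; exact: le_trans jl ij.
have le_tot : total le by move=> i j; exact: le_total.
have [pi Hpi] : exists pi : {perm 'I_k}, sort le (ord_tuple k) = [seq pi i | i <- enum 'I_k].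
  have /tuple_permP[pi Hpi] : perm_eq (sort le (ord_tuple k)) (ord_tuple k).
    by rewrite perm_sort.
  exists pi; rewrite Hpi; apply: eq_map => i; by rewrite tnth_ord_tuple.
exists pi; split.
- by move=> i; have [] := Hs (pi i).
- by rewrite -sm [RHS](reindex_inj (@perm_inj _ pi)).
exists (fun i => e (pi i)); split=> // i j ij.
have st := sort_sorted le_tot (ord_tuple k); rewrite Hpi in st.
have sz : size [seq pi i | i <- enum 'I_k] = k by rewrite size_map size_enum_ord.
have := sorted_leq_nth le_tr (fun _ => lexx _) (pi i) st i j.
rewrite !inE sz !ltn_ord => /(_ isT isT ij).
by rewrite !(nth_map i) -?enumT ?size_enum_ord // !nth_ord_enum.
Qed.

End LanglandsQuotient.

(** * The Weil group and parameters *)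

Section WeilGroup.
Import Order.TTheory GRing.Theory Num.Theory.
Local Open Scope ring_scope.
Context {R : realType} {F : localField} (Fs : sepClosure F).
Local Notation C := R[i].
Implicit Types (w : Fs -> Fs) (x : Fs).

Lemma galois_horner w (p : {poly F}) x : galois_elt w ->
  w (map_poly (sc_in Fs) p).[x] = (map_poly (sc_in Fs) p).[w x].
Proof.
move=> [_ wD wM wF]; have w0 : w 0 = 0 by rewrite -(rmorph0 (sc_in Fs)) wF.
have w1 : w 1 = 1 by rewrite -(rmorph1 (sc_in Fs)) wF.
elim/poly_ind: p => [|p c IH]; first by rewrite rmorph0 !horner0.
by rewrite rmorphD rmorphM /= map_polyX map_polyC !hornerMXaddC wD wM IH wF.
Qed.

Lemma galois_integral w x : galois_elt w -> integral x -> integral (w x).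
Proof.
move=> gw [p [pm pv /rootP px]]; exists p; split=> //; apply/rootP.
rewrite -galois_horner // px; case: gw => _ _ _ wF.
by rewrite -(rmorph0 (sc_in Fs)) wF.
Qed.

Lemma galois_comp w w' : galois_elt w -> galois_elt w' -> galois_elt (w \o w').
Proof.
move=> [wb wD wM wF] [wb' wD' wM' wF']; split=> [|x y|x y|a] /=.
- exact: bij_comp.
- by rewrite wD' wD.
- by rewrite wM' wM.
- by rewrite wF' wF.
Qed.

Lemma galois_inv w : galois_elt w ->
  exists w', [/\ galois_elt w', cancel w w' & cancel w' w].
Proof.
move=> [wb wD wM wF]; have wI := bij_inj wb; have [w' wK w'K] := wb; exists w'; split=> //.
split=> [|x y|x y|a]; first by exists w.
- by apply: wI; rewrite wD !w'K.
- by apply: wI; rewrite wM !w'K.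
- by apply: wI; rewrite wF w'K.
Qed.

Lemma galois0 w : galois_elt w -> w 0 = 0.
Proof. by case=> _ _ _ wF; rewrite -(rmorph0 (sc_in Fs)) wF. Qed.

Lemma galoisN w x : galois_elt w -> w (- x) = - w x.
Proof.
move=> gw; have w0 := galois0 gw; case: gw => _ wD _ _.
by apply: (addrI (w x)); rewrite -wD !addrN.
Qed.

Lemma galoisV w x : galois_elt w -> w x^-1 = (w x)^-1.
Proof.
move=> gw; have w0 := galois0 gw; case: (gw) => wb _ wM wF.
have [->|x0] := eqVneq x 0; first by rewrite w0 invr0 w0.
have wx0 : w x != 0 by rewrite -w0 (inj_eq (bij_inj wb)).
apply: (mulfI wx0); rewrite -wM mulfV // mulfV //.
by rewrite -(rmorph1 (sc_in Fs)) wF.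
Qed.

Lemma galoisX w x n : galois_elt w -> w (x ^+ n) = w x ^+ n.
Proof.
move=> gw; case: (gw) => _ _ wM wF; elim: n => [|n IH].
  by rewrite !expr0 -(rmorph1 (sc_in Fs)) wF.
by rewrite !exprS wM IH.
Qed.

Lemma galois_max_ideal w x : galois_elt w -> in_max_ideal x -> in_max_ideal (w x).
Proof.
move=> gw [->|nx]; first by left; exact: galois0.
right; rewrite -galoisV // => H; apply: nx.
by have [w' [gw' wK _]] := galois_inv gw; rewrite -(wK x^-1); exact: galois_integral.
Qed.

(** The minimal ingredient for inverting Weil elements: the difference in [frob_power] then changes
    sign, while [in_max_ideal] is phrased through integrality of x^-1. The polynomial is (-1)^n
    p(-X). *)
Lemma integralN x : integral x -> integral (- x).
Proof.
move=> [p [/monicP pm pv /rootP px]].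
pose n := (size p).-1; pose q : {poly F} := (-1) ^+ n *: (p \Po (- 'X)).
have qE i : q`_i = (-1) ^+ n * ((-1) ^+ i * p`_i).
  rewrite coefZ; congr (_ * _).
  have -> : p \Po (- 'X) = \poly_(j < size p) ((-1) ^+ j * p`_j).
    rewrite comp_polyE poly_def; apply: eq_bigr => j _.
    have -> : (- 'X : {poly F}) ^+ j = (-1) ^+ j *: 'X^j.
      by rewrite [LHS]exprNn -[RHS]mul_polyC polyC_exp polyCN.
    by rewrite scalerA mulrC.
  by rewrite coef_poly; case: ltnP => // le; rewrite nth_default // mulr0.
have vs i : vge (0 : int) ((-1 : F) ^+ i).
  by rewrite -signr_odd; case: odd; rewrite ?expr1 ?expr0; apply: vgeW (vge_lf_val _);
    rewrite ?lf_valN1 ?lf_val1.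
exists q; split.
- have sz : size q = size p.
    rewrite size_scale ?signr_eq0 // size_comp_poly2 //.
    by rewrite size_polyN size_polyX.
  rewrite monicE lead_coefE sz qE mulrA -exprD -/n addnn -signr_odd odd_double mul1r.
  by rewrite /n -lead_coefE pm.
- by move=> i; rewrite qE; rewrite -[0](addr0 (0 : int)); apply: vgeM => //;
    rewrite -[0](addr0 (0 : int)); apply: vgeM.
apply/rootP; rewrite linearZ /= hornerZ map_comp_poly horner_comp rmorphN /= map_polyX.
by rewrite hornerN hornerX opprK px mulr0.
Qed.

Lemma max_idealN x : in_max_ideal x -> in_max_ideal (- x).
Proof.
move=> [->|nx]; [by left; rewrite oppr0|right].
by rewrite invrN => /integralN; rewrite opprK.
Qed.

Lemma weil_inv w : weil w -> exists w', [/\ weil w', cancel w w' & cancel w' w].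
Proof.
move=> [gw [a [b fw]]]; have [w' [gw' wK w'K]] := galois_inv gw; exists w'; split=> //.
(* Inversion exchanges the two exponents and changes the sign of the difference. *)
split=> //; exists b, a => x ix; have := fw _ (galois_integral gw' ix).
by rewrite w'K => /max_idealN; rewrite opprB.
Qed.

Lemma inertia_weil w : inertia w -> weil w.
Proof. by case=> gw fw; split=> //; exists 0%N, 0%N. Qed.

Lemma geometric_frobenius_weil w : geometric_frobenius w -> weil w.
Proof. by case=> gw fw; split=> //; exists 1%N, 0%N. Qed.

(** This normality is what lets Frobenius act on the inertia invariants. *)
Lemma inertia_conj w v v' : galois_elt v -> galois_elt v' -> cancel v' v -> cancel v v' ->
  inertia w -> inertia (v' \o (w \o v)).
Proof.
move=> gv gv' vK v'K [gw fw]; split; first by do 2![apply: galois_comp => //].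
move=> x ix; have := galois_max_ideal gv' (fw _ (galois_integral gv ix)).
by case: (gv') => _ v'D _ _; rewrite v'D (galoisN _ gv') !(galoisX _ _ gv') /= v'K.
Qed.

(** Among the matrices whose row space lies in the subspace, one of maximal rank must span it:
    adjoining a further vector cannot raise the rank. *)
Lemma subspace_basis N (P : 'cV[C]_N -> Prop) :
  P 0 -> (forall a u v, P u -> P v -> P (a *: u + v)) ->
  exists k (B : 'M[C]_(N, k)), \rank B = k /\ forall u, P u <-> exists y, u = B *m y.
Proof.
move=> P0 PD; pose Q (M : 'M[C]_N) := forall v : 'rV_N, (v <= M)%MS -> P v^T.
have Q0 : Q 0 by move=> v; rewrite submx0 => /eqP->; rewrite trmx0.
pose rk n := `[< exists2 M, Q M & \rank M = n >].
have rk0 : exists n, rk n by exists 0%N; apply/asboolP; exists 0; rewrite ?mxrank0.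
have rkN n : rk n -> (n <= N)%N by move=> /asboolP[M _ <-]; exact: rank_leq_row.
case: (ex_maxnP rk0 rkN) => n /asboolP[M QM rM] nmax.
exists (\rank M), (row_base M)^T; split.
  by rewrite mxrank_tr; apply/eqP; exact: row_base_free.
move=> u; split=> [Pu|[y ->]]; last first.
  rewrite -[_ *m y]trmxK trmx_mul trmxK; apply: QM.
  by apply: submx_trans (submxMl _ _) _; rewrite eq_row_base.
suff /submxP[y e] : (u^T <= row_base M)%MS.
  by exists y^T; rewrite -[u]trmxK e trmx_mul.
rewrite eq_row_base.
have QMu : Q (M + u^T)%MS.
  move=> v /sub_addsmxP[[v1 v2] /= ->]; rewrite raddfD /= addrC.
  have -> : (v2 *m u^T)^T = v2 0 0 *: u.
    by rewrite [v2]mx11_scalar mul_scalar_mx linearZ /= trmxK mxE eqxx mulr1n.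
  by apply: PD => //; apply: QM; exact: submxMl.
have le : (\rank (M + u^T)%MS <= \rank M)%N.
  by rewrite rM; apply: nmax; apply/asboolP; exists (M + u^T)%MS.
have := mxrank_leqif_sup (addsmxSl M u^T) => -[_]; rewrite eqn_leq le andbT mxrankS ?addsmxSl //.
by move=> /esym; exact: submx_trans (addsmxSr _ _).
Qed.

(** [is_Z_V] speaks only about a trace that is given, so one has to be exhibited. The columns of [T]
    express the images of the basis vectors under Frobenius. *)
Lemma trace_on_inertia_invariants_exists N (f : (Fs -> Fs) -> 'M[C]_N) (Phi : Fs -> Fs) :
  geometric_frobenius Phi ->
  (forall w w', weil w -> weil w' -> f (w \o w') = f w *m f w') ->
  exists t, trace_on_inertia_invariants f Phi t.
Proof.
move=> gPhi fM; have wPhi := geometric_frobenius_weil gPhi.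
have [k [B [rB HB]]] := subspace_basis (P := fun u => forall w, inertia w -> f w *m u = u)
  (fun w _ => mulmx0 _ _)
  (fun a u v Pu Pv w iw => etrans (mulmxDr _ _ _)
     (f_equal2 +%R (etrans (esym (scalemxAr _ _ _)) (congr1 ( *:%R a) (Pu w iw))) (Pv w iw))).
have stab (u : 'cV[C]_N) : (forall w, inertia w -> f w *m u = u) ->
    forall w, inertia w -> f w *m (f Phi *m u) = f Phi *m u.
  move=> Hu w iw; have [Phi' [gPhi' PK P'K]] := galois_inv gPhi.1.
  have iw' := inertia_conj gPhi.1 gPhi' P'K PK iw.
  rewrite mulmxA -fM //; last exact: inertia_weil.
  have -> : w \o Phi = Phi \o (Phi' \o (w \o Phi)) by apply/funext => x /=; rewrite P'K.
  by rewrite (fM _ _ wPhi (inertia_weil iw')) -mulmxA Hu.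
have /choice[y Hy] : forall j, exists y : 'cV[C]_k, f Phi *m col j B = B *m y.
  move=> j; apply/HB/stab/HB; exists (delta_mx j 0).
  by rewrite -colE.
pose T : 'M[C]_k := \matrix_(i, j) y j i 0.
exists (\tr T), k, B, T; split=> //.
apply/matrixP => i j; have /matrixP/(_ i 0) := Hy j; rewrite !mxE => e.
transitivity (\sum_j0 f Phi i j0 * col j B j0 0).
  by apply: eq_bigr => l _; rewrite mxE.
by rewrite e; apply: eq_bigr => l _; rewrite mxE.
Qed.

End WeilGroup.

(** * Direct sums of parameters and their traces *)

Section WeilDeligneSums.
Import Order.TTheory GRing.Theory Num.Theory.
Local Open Scope ring_scope.
Context {R : realType} {F : localField} (Fs : sepClosure F).

Lemma wd_iso_refl n (f : wdrep R Fs n) : wd_iso f f.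
Proof. by exists 1%:M; [exact: unitmx1|split=> [w _|]; rewrite mulmx1 mul1mx]. Qed.

Definition wdsum k (m : 'I_k -> nat) n (idx : forall i, 'I_(m i) -> 'I_n)
    (f : forall i, wdrep R Fs (m i)) : wdrep R Fs n :=
  WDRep (fun w => bdiag idx (fun i => wd_r (f i) w)) (bdiag idx (fun i => wd_N (f i))).

Lemma wdsum_perm k (s : {perm 'I_k}) (m : 'I_k -> nat) n (idx : forall i, 'I_(m i) -> 'I_n)
    (f : forall i, wdrep R Fs (m i)) :
  wdsum (fun i => idx (s i)) (fun i => f (s i)) = wdsum idx f.
Proof.
congr WDRep; last exact: (bdiag_perm s).
by apply/funext => w; exact: (bdiag_perm s).
Qed.

(** [ar_mul] requires invertible matrices; invertibility of the parameter follows from its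
    multiplicativity and from inverses in the Weil group. *)
Lemma wdsum_trace k (m : 'I_k -> nat) n (idx : forall i, 'I_(m i) -> 'I_n)
    (f : forall i, wdrep R Fs (m i)) (V : algRep R Fs n) (Phi : Fs -> Fs) :
  geometric_frobenius Phi -> blocks idx -> (forall i, frob_semisimple_wdrep (f i)) ->
  exists t, trace_on_inertia_invariants (fun w => V (wd_r (wdsum idx f) w) w) Phi t.
Proof.
move=> gPhi bi fss; apply: trace_on_inertia_invariants_exists => //.
have rM w w' : weil w -> weil w' ->
    wd_r (wdsum idx f) (w \o w') = wd_r (wdsum idx f) w *m wd_r (wdsum idx f) w'.
  move=> ww ww' /=; rewrite bdiagM //; congr bdiag.
  by apply: functional_extensionality_dep => i; have [_ H _ _ _] := fss i; exact: H.
have rU w : weil w -> wd_r (wdsum idx f) w \in unitmx.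
  move=> ww; have [w' [ww' wK w'K]] := weil_inv ww.
  suff /mulmx1_unit[] : wd_r (wdsum idx f) w *m wd_r (wdsum idx f) w' = 1%:M by [].
  rewrite -rM //= -[RHS](bdiag1 _ bi); congr bdiag.
  apply: functional_extensionality_dep => i; have [H _ _ _ _] := fss i; rewrite -H.
  by congr wd_r; apply/funext => x /=; rewrite w'K.
by move=> w w' ww ww'; rewrite rM // ar_mul //; exact: rU.
Qed.

Lemma eq_bernsteinCentre (A : divAlg F) r (z z' : bernsteinCentre R A r) :
  (forall y, z y = z' y) -> z = z'.
Proof.
case: z z' => [f c g] [f' c' g'] /= /funext e; case: f' / e c' g' => c' g'.
by rewrite (Prop_irrelevance c c') (Prop_irrelevance g g').
Qed.

Lemma da_deg_gt0 (A : divAlg F) : (0 < da_deg A)%N.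
Proof.
by rewrite lt0n; apply: contraTneq (dA_gt0 (A := A)) => e; rewrite da_dim e.
Qed.

Lemma ess_square_integrable_irrep (A : divAlg F) m (p : prerep R A m) :
  ess_square_integrable p -> irrep (@GL F A m) p.
Proof. by case=> e []. Qed.

Lemma irrep_smooth (A : divAlg F) m (L : 'M[A]_m -> Prop) (p : prerep R A m) :
  irrep L p -> smooth_rep L p.
Proof. by case. Qed.

Lemma langlands_quotient_irrep (A : divAlg F) r k (m : 'I_k -> nat)
    (s : forall i, prerep R A (m i)) (p : prerep R A r) :
  langlands_quotient s p -> irrep (@GL F A r) p.
Proof. by case=> idx [c0 [c [t [_ _ _ []]]]]. Qed.

End WeilDeligneSums.

(** * Comparison of the two functions at a point and its image *)

Theorem corollary1p3 (R : realType) (F : localField) (Fs : sepClosure F)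
  (Phi : Fs -> Fs) (hPhi : geometric_frobenius Phi)
  (D : divAlg F) (r : nat) (hr : (0 < r)%N)
  (rec : forall m, prerep R (baseAlg F) m -> wdrep R Fs m)
  (hrec : langlands_correspondence rec)
  (JL : forall m, prerep R D m -> prerep R (baseAlg F) (m * da_deg D))
  (hJL : jacquet_langlands JL)
  (hLQ : langlands_quotient_theorem R D)
  (hLQs : langlands_quotient_theorem R (baseAlg F))
  (supp : cuspPair R D r -> cuspPair R (baseAlg F) (r * da_deg D))
  (hsupp : forall y, JL_support JL y (supp y))
  (T : bernsteinCentre R (baseAlg F) (r * da_deg D) -> bernsteinCentre R D r)
  (hT : forall z y, T z y = z (supp y))
  (V : algRep R Fs (r * da_deg D))
  (Z : bernsteinCentre R D r)
  (hZ : is_Z_V (dm := fun m => (m * da_deg D)%N)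
          (fun m p => rec (m * da_deg D)%N (JL m p)) Phi V Z)
  (Zs : bernsteinCentre R (baseAlg F) (r * da_deg D))
  (hZs : is_Z_V (dm := id) rec Phi V Zs) :
  T Zs = Z.
Proof.
apply: eq_bernsteinCentre => y; rewrite hT.
have [k [m [s [idx [x [xi [Ms [tau [idx' [x' [xi' [hs fact fact' hsup]]]]]]]]]]]] := hsupp y.
have hs' i : (0 < m i * da_deg D)%N /\ ess_square_integrable (JL (m i) (s i)).
  have [mi si] := hs i; split; first by rewrite muln_gt0 mi da_deg_gt0.
  by have [H _ _ _] := hJL (m i) mi; exact: H.
have [_ bi _ _ _] := fact; have [_ bi' _ _ _] := fact'.
have sirr i := irrep_smooth (ess_square_integrable_irrep (hs i).2).
have sirr' i := irrep_smooth (ess_square_integrable_irrep (hs' i).2).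
have [pi std] := standard_data_perm hs (blocks_sum bi).
(* [jacquet_langlands] does not relate the exponents of s i and JL (s i), so the transferred family
   is sorted on its own. *)
have [pi' std'] := standard_data_perm hs' (blocks_sum bi').
have [p lq] := hLQ _ _ _ _ hr std.
have hrd : (0 < r * da_deg D)%N by rewrite muln_gt0 hr da_deg_gt0.
have [p' lq'] := hLQs _ _ _ _ hrd std'.
have psup : has_support (@GL F D r) p y.
  have [c0 [c [x1 [xi1 [xxi c0c ML q]]]]] :=
    langlands_quotient_parind (fun i => sirr (pi i)) (factorized_perm pi fact) lq.
  exact: has_support_self xxi c0c ML q.
have psup' : has_support (@GL F (baseAlg F) _) p' (supp y).
  have [c0 [c [x1 [xi1 [xxi c0c ML q]]]]] :=
    langlands_quotient_parind (fun i => sirr' (pi' i)) (factorized_perm pi' fact') lq'.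
  exact: has_support_trans xxi c0c ML hsup q.
(* The sum is formed in the original order. By [wdsum_perm] it equals both sorted sums on the nose,
   so it is a parameter of p and of p' through the identity isomorphism. *)
pose f := wdsum idx' (fun i => rec _ (JL (m i) (s i))).
have fss i : frob_semisimple_wdrep (rec _ (JL (m i) (s i))).
  have [H _] := hrec; apply: H; first by case: (hs' i).
  exact: ess_square_integrable_irrep (hs' i).2.
have [t tr] := wdsum_trace V hPhi bi' fss.
have par : parameter_of (fun m p => rec (m * da_deg D)%N (JL m p)) p f.
  exists k, (fun i => m (pi i)), (fun i => s (pi i)), (fun i => idx' (pi i)); split=> //.
    exact: (blocks_perm pi bi').
  rewrite /f -(wdsum_perm pi); exact: wd_iso_refl.
have par' : parameter_of (dm := id) rec p' f.
  exists k, (fun i => m (pi' i) * da_deg D)%N, (fun i => JL _ (s (pi' i))), (fun i => idx' (pi' i)).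
  split=> //; first exact: (blocks_perm pi' bi').
  rewrite /f -(wdsum_perm pi'); exact: wd_iso_refl.
rewrite (hZ y p f t (langlands_quotient_irrep lq) psup par tr).
exact: (hZs (supp y) p' f t (langlands_quotient_irrep lq') psup' par' tr).
Qed.
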